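(* Consider the network, the original system (S), the observer system (R) and the error system (Diff) for $\delta=R-S$ described in the context. Define $T_0=\max_{e\in E}\frac{L^e}{c}$ and let $T>2T_0$ be given. For all $e\in E$ let initial states $y^e_+,y^e_-,z^e_+,z^e_-\in L^\infty(0,L^e)$ be given. For each node $v\in V$ let a number $\mu^v$ with $|\mu^v|\le 1$ be given. Assume that there exists a set $\tilde V\subset V$ with the following property: for all $e\in E$ there exists $v\in\tilde V$ such that $e\in E_0(v)$ and $|\mu^v|<1$. Assume that there exists a real number $J$ such that $y^e_\pm-J$, $z^e_\pm-J$ ($e\in E$) and the boundary controls $u^e-J\in L^\infty(0,T)$ (for the edges $e$ incident to a node $v$ with $|E_0(v)|=1$) have sufficiently small $L^\infty$-norm such that solutions of the systems (S) and (R) exist on $[0,T]$ with components in $L^\infty((0,T)\times(0,L^e))$, $e\in E$, and satisfy, with a constant $\tilde M$, for all $e\in E$ and almost all $x\in[0,L^e]$, $$|S^e_+(s,x)-S^e_-(s,x)|\le\tilde M,\qquad |S^e_+(s,x)-S^e_-(s,x)+\delta^e_+(s,x)-\delta^e_-(s,x)|\le\tilde M \tag{A}$$ for almost every $s\in[0,T]$. (i) Then the solution of (Diff) is exponentially stable in the sense that there exist constants $C_1>0$ and $\mu_0>0$ such that for all $t\in[0,T]$ $$\sum_{e\in E}(D^e)^2\int_0^{L^e}|\delta^e_+(t,x)|^2+|\delta^e_-(t,x)|^2\,dx\le C_1\exp(-\mu_0 t)\sum_{e\in E}(D^e)^2\int_0^{L^e}|\delta^e_+(0,x)|^2+|\delta^e_-(0,x)|^2\,dx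 .$$ (ii) Assume in addition that the derivatives $\partial_x y^e_\pm$ have sufficiently small $L^\infty$-norm and that the initial data are compatible with the node conditions and the boundary conditions such that a solution of system (S) exists on $[0,T]$ with components in $C([0,T],W^{1,\infty}(0,L^e))$, $e\in E$, satisfying (A) and, for some real number $\tilde B>0$, for all $e\in E$, $$\|\partial_t(S^e_+-S^e_-)(\cdot,x)\|_{L^\infty(0,T)}\le\tilde B\quad\text{for almost every }x\in(0,L^e),$$ and that the solution of (Diff) has components in $C([0,T],H^1(0,L^e))$, $e\in E$. Assume that $$8\,T_0\,(\Delta(\nu T_0))^2\max_{e\in E}\nu^e\le\frac{c}{C_1(\tilde M,\tilde B)}\min_{e\in E}\Big[\sum_{v\in V_0(e)}\frac{1-|\mu^v|^2}{1+|\mu^v|^2}\Big],\qquad \Delta(\nu T_0):=\exp\Big(8\max_{e\in E}\nu^e\,\tilde B\,T_0\Big),$$ where $C_1(\tilde M,\tilde B)$ is the $H^1$-observability constant given in the context. Then, in addition to (i), the $L^2$-norms of the time derivatives decay exponentially fast in the sense that there exists a number $\mu_1\in(0,\mu_0)$ such that for some $\tilde C>0$ we have, for all $t\in[0,T]$, $$\sum_{e\in E}(D^e)^2\int_0^{L^e}|\partial_t\delta^e_+(t,x)|^2+|\partial_t\delta^e_-(t,x)|^2\,dx\le\tilde C e^{-\mu_1 t}\sum_{e\in E}(D^e)^2\int_0^{L^e}|\partial_t\delta^e_+(0,x)|^2+|\partial_t\delta^e_-(0,x)|^2+|\delta^e_+(0,x)|^2+|\delta^e_-(0,x)|^2\,dx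 .$$
   Context: Network. $G=(V,E)$ is a finite graph; each edge $e\in E$ is identified with an interval $[0,L^e]$, $L^e>0$, has diameter $D^e>0$ and friction coefficient $\lambda^e_{fric}>0$; $\theta^e=\lambda^e_{fric}/D^e$ and $\nu^e=\theta^e/4$. $E_0(v)$ is the set of edges incident to $v\in V$, $V_0(e)$ the set of (two) nodes adjacent to $e$, and $x^e(v)\in\{0,L^e\}$ is the end of $[0,L^e]$ corresponding to $v\in V_0(e)$. $c>0$ is a constant (sound speed), the same for all edges. $\omega_v=2/\sum_{f\in E_0(v)}(D^f)^2$. Numbers $\mu^v\in[-1,1]$, $v\in V$, are given. Notation. For a pair $(S^e_+,S^e_-)$ of functions on edge $e$ and $e\in E_0(v)$: if $x^e(v)=L^e$, then $S^e_{in}(t,x^e(v))=S^e_+(t,L^e)$ and $S^e_{out}(t,x^e(v))=S^e_-(t,L^e)$; if $x^e(v)=0$, then $S^e_{in}(t,x^e(v))=S^e_-(t,0)$ and $S^e_{out}(t,x^e(v))=S^e_+(t,0)$. The same notation is used for $R$ and $\delta$. Moreover $\sigma^e(a,b)=\nu^e|a-b|(a-b)$. System (S): for all $e\in E$, $S^e_\pm(0,x)=y^e_\pm(x)$ on $(0,L^e)$ and $\partial_tS^e_++c\,\partial_xS^e_+=-\sigma^e(S^e_+,S^e_-)$, $\ \partial_tS^e_--c\,\partial_xS^e_-=\sigma^e(S^e_+,S^e_-)$ on $[0,T]\times[0,L^e]$; for $t\in(0,T)$, $v\in V$, $e\in E_0(v)$: if $|E_0(v)|=1$, $S^e_{out}(t,x^e(v))=(1-\mu^v)u^e(t)+\mu^vS^e_{in}(t,x^e(v))$;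 if $|E_0(v)|\ge2$, $S^e_{out}(t,x^e(v))=-S^e_{in}(t,x^e(v))+\omega_v\sum_{g\in E_0(v)}(D^g)^2S^g_{in}(t,x^g(v))$. Observer system (R): the same differential equations with $R$ in place of $S$, initial conditions $R^e_\pm(0,x)=z^e_\pm(x)$, and for $t\in(0,T)$, $e\in E_0(v)$: if $|E_0(v)|=1$, $R^e_{out}(t,x^e(v))=(1-\mu^v)u^e(t)+\mu^vR^e_{in}(t,x^e(v))$; if $|E_0(v)|\ge2$, $R^e_{out}(t,x^e(v))=S^e_{out}(t,x^e(v))-\mu^v[R^e_{in}(t,x^e(v))-S^e_{in}(t,x^e(v))]+\mu^v\omega_v\sum_{g\in E_0(v)}(D^g)^2[R^g_{in}(t,x^g(v))-S^g_{in}(t,x^g(v))]$. Error system (Diff) for $\delta=R-S$: $\delta^e_\pm(0,x)=z^e_\pm(x)-y^e_\pm(x)$; $\partial_t\delta^e_\pm\pm c\,\partial_x\delta^e_\pm=\mp\big(\sigma^e(\delta^e_++S^e_+,\delta^e_-+S^e_-)-\sigma^e(S^e_+,S^e_-)\big)$; if $|E_0(v)|=1$, $\delta^e_{out}(t,x^e(v))=\mu^v\delta^e_{in}(t,x^e(v))$; if $|E_0(v)|\ge2$, $\delta^e_{out}(t,x^e(v))=-\mu^v\delta^e_{in}(t,x^e(v))+\mu^v\omega_v\sum_{g\in E_0(v)}(D^g)^2\delta^g_{in}(t,x^g(v))$. Solutions are understood as functions satisfying the integrated form of the differential equations along the characteristic lines of slope $\pm c$ (starting from initial, boundary or node values), with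 boundary and node conditions holding for almost every $t$. $H^1$-observability constant: $$C_1(\tilde M,\tilde B)=C_0(\tilde M)+2c+\max_{e\in E}\,16\,\nu^eL^e\,\Upsilon\exp\Big(\tfrac{4\nu^e}{c}(\tilde M+\tilde B)L^e\Big),\quad \Upsilon=\frac{\max\{\tilde B^2,\tilde M^2\}}{\tilde M+\tilde B},$$ $$C_0(\tilde M)=\max_{e\in E}2\Big[2c+4L^e\nu^e\tilde M\exp\Big(\tfrac{4L^e\nu^e\tilde M}{c}\Big)\Big].$$ (The constant $C_1$ in conclusion (i) is a different, unrelated constant.) *)

(* Defs.v *)
From HB Require Import structures.
From mathcomp Require Export all_boot all_order all_algebra.
From mathcomp Require Export all_classical all_reals all_analysis.

Set Implicit Arguments.
Unset Strict Implicit.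
Unset Printing Implicit Defensive.

Import Order.TTheory GRing.Theory Num.Theory.
Import numFieldNormedType.Exports.

Local Open Scope classical_set_scope.
Local Open Scope ring_scope.

Section Network.
Context {R : realType} {V E : finType}.

(* Edge e is the interval [0, len e]; its end 0 is the node [node0 e] and its
   end [len e] is the node [nodeL e].  Parallel edges are allowed. *)
Record network := Network {
  node0 : E -> V;
  nodeL : E -> V;
  len : E -> R;
  diam : E -> R;
  fric : E -> R;
  node0_neq_nodeL : forall e, node0 e != nodeL e;
  len_gt0 : forall e, 0 < len e;
  diam_gt0 : forall e, 0 < diam e;
  fric_gt0 : forall e, 0 < fric e }.

Variable G : network.

Definition V0 (e : E) : {set V} := [set node0 G e; nodeL G e]%SET.

Definition E0 (v : V) : {set E} := [set e | v \in V0 e]%SET.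

Definition theta (e : E) : R := fric G e / diam G e.

Definition nu (e : E) : R := theta e / 4.

Definition omega (v : V) : R := 2 / \sum_(f in E0 v) diam G f ^+ 2.

Definition sigma (e : E) (a b : R) : R := nu e * `|a - b| * (a - b).

Definition xend (e : E) (v : V) : R := if v == nodeL G e then len G e else 0.

End Network.

Arguments network : clear implicits.

(* A pair (w_+, w_-). *)
Record pm (X : Type) := PM { plus : X; minus : X }.

Definition pm_sub {R : realType} {E : finType} (w1 w2 : E -> pm (R -> R -> R))
    (e : E) : pm (R -> R -> R) :=
  PM (fun t x => plus (w1 e) t x - plus (w2 e) t x)
     (fun t x => minus (w1 e) t x - minus (w2 e) t x).

Section Functions.
Context {R : realType}.
Local Notation leb := (@lebesgue_measure R).

(* L^p(A), through extension by zero outside A. *)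
Definition Lp_on (p : \bar R) (A : set R) (f : R -> R) : Prop :=
  f \_ A \in Lfun leb p.

Definition Lp_norm (p : \bar R) (A : set R) (f : R -> R) : \bar R :=
  Lnorm leb p (EFin \o (f \_ A)).

(* The closed rectangle is used in order that the traces w(., 0), w(., l) and
   the sections w(t, .), for every t in [0, T], are measurable as well. *)
Definition Linfty_rect (T l : R) (w : R -> R -> R) : Prop :=
  (fun z : R * R => w z.1 z.2) \_ (`[0, T] `*` `[0, l])
    \in Lfun (leb \x leb)%E +oo%E.

(* Test functions are the C^1 functions with compact support in ]0, l[. *)
Definition test_function (l : R) (phi : R -> R) : Prop :=
  [/\ forall x, derivable phi x 1,
      continuous (derive1 phi) &
      exists a b : R, [/\ 0 < a, b < l &
        forall x, x \notin `[a, b] -> phi x = 0]].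

Definition weak_derivative (l : R) (f g : R -> R) : Prop :=
  forall phi, test_function l phi ->
    \int[leb]_(x in `]0, l[) (f x * derive1 phi x) =
    - \int[leb]_(x in `]0, l[) (g x * phi x).

(* f belongs to W^{1,p}(0, l) and g is its weak derivative. *)
Definition W1p (p : \bar R) (l : R) (f g : R -> R) : Prop :=
  [/\ Lp_on p `]0, l[ f, Lp_on p `]0, l[ g & weak_derivative l f g].

(* w belongs to C([0, T], W^{1,p}(0, l)). *)
Definition C_W1p (p : \bar R) (T l : R) (w : R -> R -> R) : Prop :=
  exists dxw : R -> R -> R,
    (forall t : R, t \in `[0, T] -> W1p p l (w t) (dxw t)) /\
    (forall t0 : R, t0 \in `[0, T] ->
      (fun t => Lp_norm p `]0%R, l[ (fun x => w t x - w t0 x)%R +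
                Lp_norm p `]0%R, l[ (fun x => dxw t x - dxw t0 x)%R)%E
        @ within `[0, T] (nbhs t0) --> 0%E).

(* For every t0 in [0, T], dw t0 is the derivative at t0 (one-sided if t0 = 0
   or t0 = T) of the curve t |-> w t in L^2(0, l). *)
Definition L2_time_derivative (T l : R) (w dw : R -> R -> R) : Prop :=
  (forall t : R, t \in `[0, T] -> Lp_on 2%:E `]0, l[ (dw t)) /\
  (forall t0 : R, t0 \in `[0, T] ->
    (fun t => Lp_norm 2%:E `]0, l[
       (fun x => (w t x - w t0 x) / (t - t0) - dw t0 x))
      @ within `[0, T] t0^' --> 0%E).

(* Solutions of
     d_t w_+ + c d_x w_+ = - g,   d_t w_- - c d_x w_- = g,   w_pm(0, .) = ini_pm
   on [0, T] x [0, l], integrated along the characteristics: the identities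
   hold on almost every characteristic of slope c (resp. - c) issued from
   t = 0, and on almost every one issued from x = 0 (resp. x = l). *)
Definition mild_solution (c T l : R) (g : R -> R -> R) (ini : pm (R -> R))
    (w : pm (R -> R -> R)) : Prop :=
  [/\ \forall xi \ae leb, xi \in `]0, l[ ->
        forall s : R, 0 <= s -> s <= T -> xi + c * s <= l ->
        plus w s (xi + c * s) =
          plus ini xi - \int[leb]_(r in `[0, s]) g r (xi + c * r),
      \forall tau \ae leb, tau \in `]0, T[ ->
        forall s : R, 0 <= s -> tau + s <= T -> c * s <= l ->
        plus w (tau + s) (c * s) =
          plus w tau 0 - \int[leb]_(r in `[0, s]) g (tau + r) (c * r),
      \forall xi \ae leb, xi \in `]0, l[ ->
        forall s : R, 0 <= s -> s <= T -> 0 <= xi - c * s ->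
        minus w s (xi - c * s) =
          minus ini xi + \int[leb]_(r in `[0, s]) g r (xi - c * r) &
      \forall tau \ae leb, tau \in `]0, T[ ->
        forall s : R, 0 <= s -> tau + s <= T -> 0 <= l - c * s ->
        minus w (tau + s) (l - c * s) =
          minus w tau l + \int[leb]_(r in `[0, s]) g (tau + r) (l - c * r)].

End Functions.

Section Systems.
Context {R : realType} {V E : finType} (G : network R V E).
Local Notation leb := (@lebesgue_measure R).

(* At the end x = l the incoming component is w_+, at the end x = 0 it is w_-. *)
Definition trace_in (w : E -> pm (R -> R -> R)) (e : E) (v : V) (t : R) : R :=
  if v == nodeL G e then plus (w e) t (xend G e v)
  else minus (w e) t (xend G e v).

Definition trace_out (w : E -> pm (R -> R -> R)) (e : E) (v : V) (t : R) : R :=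
  if v == nodeL G e then minus (w e) t (xend G e v)
  else plus (w e) t (xend G e v).

Variables (c : R) (mu : V -> R) (T : R).

Definition system_S (y : E -> pm (R -> R)) (u : E -> R -> R)
    (S : E -> pm (R -> R -> R)) : Prop :=
  (forall e, mild_solution c T (len G e)
    (fun t x => sigma G e (plus (S e) t x) (minus (S e) t x)) (y e) (S e)) /\
  \forall t \ae leb, t \in `]0, T[ -> forall v e, e \in E0 G v ->
    (#|E0 G v| = 1%N ->
       trace_out S e v t = (1 - mu v) * u e t + mu v * trace_in S e v t) /\
    ((2 <= #|E0 G v|)%N ->
       trace_out S e v t = - trace_in S e v t +
         omega G v * \sum_(g in E0 G v) diam G g ^+ 2 * trace_in S g v t).

Definition system_R (S : E -> pm (R -> R -> R)) (z : E -> pm (R -> R))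
    (u : E -> R -> R) (Rs : E -> pm (R -> R -> R)) : Prop :=
  (forall e, mild_solution c T (len G e)
    (fun t x => sigma G e (plus (Rs e) t x) (minus (Rs e) t x)) (z e) (Rs e)) /\
  \forall t \ae leb, t \in `]0, T[ -> forall v e, e \in E0 G v ->
    (#|E0 G v| = 1%N ->
       trace_out Rs e v t = (1 - mu v) * u e t + mu v * trace_in Rs e v t) /\
    ((2 <= #|E0 G v|)%N ->
       trace_out Rs e v t = trace_out S e v t
         - mu v * (trace_in Rs e v t - trace_in S e v t)
         + mu v * omega G v * \sum_(g in E0 G v)
             diam G g ^+ 2 * (trace_in Rs g v t - trace_in S g v t)).

Definition system_Diff (S : E -> pm (R -> R -> R)) (y z : E -> pm (R -> R))
    (delta : E -> pm (R -> R -> R)) : Prop :=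
  (forall e, mild_solution c T (len G e)
    (fun t x =>
       sigma G e (plus (delta e) t x + plus (S e) t x)
                 (minus (delta e) t x + minus (S e) t x)
       - sigma G e (plus (S e) t x) (minus (S e) t x))
    (PM (fun x => plus (z e) x - plus (y e) x)
        (fun x => minus (z e) x - minus (y e) x))
    (delta e)) /\
  \forall t \ae leb, t \in `]0, T[ -> forall v e, e \in E0 G v ->
    (#|E0 G v| = 1%N ->
       trace_out delta e v t = mu v * trace_in delta e v t) /\
    ((2 <= #|E0 G v|)%N ->
       trace_out delta e v t = - mu v * trace_in delta e v t
         + mu v * omega G v * \sum_(g in E0 G v)
             diam G g ^+ 2 * trace_in delta g v t).

(* Extended-real valued, so that no integrability is hidden in a default
   value. *)
Definition energy (w : E -> pm (R -> R -> R)) (t : R) : \bar R :=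
  (\sum_(e : E) (diam G e ^+ 2)%:E *
     \int[leb]_(x in `[0%R, len G e])
       (`|plus (w e) t x| ^+ 2 + `|minus (w e) t x| ^+ 2)%R%:E)%E.

(* On a nonempty finite edge set these are the maximum and the minimum. *)
Definition max_edge (f : E -> R) : R := sup (range f).

Definition min_edge (f : E -> R) : R := inf (range f).

Definition T0 : R := max_edge (fun e => len G e / c).

Definition obs_C0 (M : R) : R :=
  max_edge (fun e => 2 * (2 * c +
    4 * len G e * nu G e * M * expR (4 * len G e * nu G e * M / c))).

Definition Upsilon (M B : R) : R := Num.max (B ^+ 2) (M ^+ 2) / (M + B).

Definition obs_C1 (M B : R) : R :=
  obs_C0 M + 2 * c +
  max_edge (fun e => 16 * nu G e * len G e * Upsilon M B *
                     expR (4 * nu G e / c * (M + B) * len G e)).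

Definition Delta (B : R) : R := expR (8 * max_edge (nu G) * B * T0).

Definition H1_smallness (M B : R) : Prop :=
  8 * T0 * Delta B ^+ 2 * max_edge (nu G) <=
  c / obs_C1 M B *
    min_edge (fun e => \sum_(v in V0 G e)
      (1 - `|mu v| ^+ 2) / (1 + `|mu v| ^+ 2)).

Definition Linfty_state (w : E -> pm (R -> R -> R)) : Prop :=
  forall e, Linfty_rect T (len G e) (plus (w e)) /\
            Linfty_rect T (len G e) (minus (w e)).

Definition Linfty_data (y : E -> pm (R -> R)) : Prop :=
  forall e, Lp_on +oo%E `]0, len G e[ (plus (y e)) /\
            Lp_on +oo%E `]0, len G e[ (minus (y e)).

Definition bound_A (M : R) (S delta : E -> pm (R -> R -> R)) : Prop :=
  forall e, \forall x \ae leb, x \in `[0, len G e] ->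
    \forall s \ae leb, s \in `[0, T] ->
      `|plus (S e) s x - minus (S e) s x| <= M /\
      `|plus (S e) s x - minus (S e) s x
        + plus (delta e) s x - minus (delta e) s x| <= M.

(* J enters only through the (qualitative) smallness of the data around it,
   whose role is to provide the solutions S and Rs with [bound_A]. *)
Record synchronization (M : R) (y z : E -> pm (R -> R)) (u : E -> R -> R)
    (S Rs delta : E -> pm (R -> R -> R)) : Prop := Synchronization {
  sync_y : Linfty_data y;
  sync_z : Linfty_data z;
  sync_J : exists J : R,
    [/\ Linfty_data (fun e => PM (fun x => plus (y e) x - J)
                                 (fun x => minus (y e) x - J)),
        Linfty_data (fun e => PM (fun x => plus (z e) x - J)
                                 (fun x => minus (z e) x - J)) &
        forall v e, e \in E0 G v -> #|E0 G v| = 1%N ->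
          Lp_on +oo%E `]0, T[ (fun t => u e t - J)];
  sync_S : system_S y u S;
  sync_R : system_R S z u Rs;
  sync_S_Linfty : Linfty_state S;
  sync_R_Linfty : Linfty_state Rs;
  sync_delta : delta = pm_sub Rs S;
  sync_Diff : system_Diff S y z delta;
  sync_A : bound_A M S delta }.

Record regular_synchronization (B : R) (y : E -> pm (R -> R))
    (S delta : E -> pm (R -> R -> R)) : Prop := RegularSynchronization {
  reg_y : forall e,
    (exists dy, W1p +oo%E (len G e) (plus (y e)) dy) /\
    (exists dy, W1p +oo%E (len G e) (minus (y e)) dy);
  reg_S : forall e, C_W1p +oo%E T (len G e) (plus (S e)) /\
                    C_W1p +oo%E T (len G e) (minus (S e));
  reg_S_dt : forall e, \forall x \ae leb, x \in `]0, len G e[ ->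
    exists g : R -> R,
      W1p +oo%E T (fun t => plus (S e) t x - minus (S e) t x) g /\
      (Lp_norm +oo%E `]0%R, T[ g <= B%:E)%E;
  reg_delta : forall e, C_W1p 2%:E T (len G e) (plus (delta e)) /\
                        C_W1p 2%:E T (len G e) (minus (delta e)) }.

Definition time_derivative (w dw : E -> pm (R -> R -> R)) : Prop :=
  forall e, L2_time_derivative T (len G e) (plus (w e)) (plus (dw e)) /\
            L2_time_derivative T (len G e) (minus (w e)) (minus (dw e)).

End Systems.

(* Main.v *)
Require Import Defs.
From mathcomp Require Import measurable_realfun ess_sup_inf ring lra.

(* Energy method.  Squaring the equations along almost every characteristic
   yields, for the weighted L^2 energy E of delta,
     E(t2) + node losses + friction dissipation = E(t1).
   Every edge e has an end v with |mu v| < 1, and each characteristic of e meets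
   that end within a time L / c, so E at the middle of a window of length 2 tau
   is bounded by the losses and the dissipation in the window.  Hence E is
   contracted over each such window and decays exponentially.  Only an upper
   bound on the friction coefficient enters the constants.

   A time increment w_h = delta(. + h) - delta solves a system of the same kind
   with an additional source of size nu |S(. + h) - S| |delta| <= nu B h |delta|.
   By the first part this source decays exponentially, so the contraction
   argument gives a decay of w_h / h that is uniform in h; then h -> 0. *)

Set Implicit Arguments.
Unset Strict Implicit.
Unset Printing Implicit Defensive.

Import Order.TTheory GRing.Theory Num.Theory.
Import numFieldNormedType.Exports.

Local Open Scope classical_set_scope.
Local Open Scope ring_scope.

(** * Essentially bounded functions *)

(** The solutions are only bounded and satisfy the equations in integrated form on almost every
    characteristic, so one can neither integrate by parts nor differentiate the system. The energy
    identities are proved on single characteristics and integrated over their labels [x - c * t] by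
    Fubini; the component of speed [- c] is brought to speed [c] by reflecting the edge. For the
    same reason time increments stand in for time derivatives. The middle of the window is the right
    time because an end sees the two components in opposite time directions: one has left it shortly
    before, the other reaches it shortly after. Monotonicity of the friction law controls the
    source: up to a defect it has the sign of [w_+ - w_-] and its square is bounded by the
    dissipation, so what it adds to the observation is paid for by the quantity that makes the
    energy decrease. Only the defect can raise the energy, and Young's inequality charges it to half
    of the contraction gain. Both conclusions are instances of one statement on damped systems,
    whose constants depend neither on the final time nor on the solution, hence not on [h]. *)

Section AlmostEverywhere.
Context d (X : measurableType d) (R : realType).
Variable mu : {measure set X -> \bar R}.

Lemma ae_imp (P Q : X -> Prop) : (forall x, P x -> Q x) ->
  (\forall x \ae mu, P x) -> \forall x \ae mu, Q x.
Proof. by move=> PQ; apply: filterS. Qed.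

Lemma ae_imp2 (P Q S : X -> Prop) : (forall x, P x -> Q x -> S x) ->
  (\forall x \ae mu, P x) -> (\forall x \ae mu, Q x) -> \forall x \ae mu, S x.
Proof. by move=> PQ; apply: filterS2. Qed.

End AlmostEverywhere.

Section EssentiallyBounded.
Context d (X : measurableType d) (R : realType).
Variable mu : {measure set X -> \bar R}.
Implicit Types (D : set X) (f g : X -> R).

(** On sets of finite measure this class is an algebra of integrable functions, so the integrability
    side conditions for solutions and sources reduce to closure properties. The bound is only almost
    everywhere because the states are given as elements of L^infinity. *)
Definition ess_bounded D f : Prop :=
  measurable_fun D f /\ exists K : R, \forall x \ae mu, D x -> `|f x| <= K.

Lemma ess_boundedS D D' f : measurable D -> D' `<=` D ->
  ess_bounded D f -> ess_bounded D' f.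
Proof.
move=> mD D'D [mf [K fK]]; split; first exact: measurable_funS mf.
by exists K; apply: filterS fK => x + /D'D.
Qed.

Lemma ess_boundedD D f g :
  ess_bounded D f -> ess_bounded D g -> ess_bounded D (fun x => f x + g x).
Proof.
move=> [mf [K fK]] [mg [K' gK]]; split; first exact: measurable_funD.
exists (K + K'); near=> x => Dx.
by rewrite (le_trans (ler_normD _ _))// lerD//; [exact: (near fK x)|exact: (near gK x)].
Unshelve. all: by end_near. Qed.

Lemma ess_boundedM D f g :
  ess_bounded D f -> ess_bounded D g -> ess_bounded D (fun x => f x * g x).
Proof.
move=> [mf [K fK]] [mg [K' gK]]; split; first exact: measurable_funM.
exists (K * K'); near=> x => Dx.
by rewrite normrM ler_pM//; [exact: (near fK x)|exact: (near gK x)].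
Unshelve. all: by end_near. Qed.

Lemma ess_bounded_cst D (r : R) : ess_bounded D (fun=> r).
Proof. by split; [exact: measurable_cst|exists `|r|; exact: nearW]. Qed.

Lemma ess_boundedN D f : ess_bounded D f -> ess_bounded D (fun x => - f x).
Proof.
move=> [mf [K fK]]; split; first exact: measurableT_comp.
by exists K; apply: filterS fK => x; rewrite normrN.
Qed.

Lemma ess_boundedB D f g :
  ess_bounded D f -> ess_bounded D g -> ess_bounded D (fun x => f x - g x).
Proof. by move=> bf bg; apply: ess_boundedD => //; exact: ess_boundedN. Qed.

Lemma ess_bounded_norm D f : ess_bounded D f -> ess_bounded D (fun x => `|f x|).
Proof.
move=> [mf [K fK]]; split; first exact: measurableT_comp.
by exists K; apply: filterS fK => x; rewrite normr_id.
Qed.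

Lemma ess_boundedX D f n : ess_bounded D f -> ess_bounded D (fun x => f x ^+ n).
Proof.
move=> bf; elim: n => [|n IHn]; first by under eq_fun do rewrite expr0; exact: ess_bounded_cst.
by under eq_fun do rewrite exprS; exact: ess_boundedM.
Qed.

Lemma ess_bounded_integrable D f : measurable D -> (mu D < +oo)%E ->
  ess_bounded D f -> mu.-integrable D (EFin \o f).
Proof.
move=> mD Doo [mf [K fK]]; apply/integrableP; split; first exact/measurable_EFinP.
apply: (@le_lt_trans _ _ (\int[mu]_(x in D) (cst `|K|%:E) x)%E).
  apply: ae_ge0_le_integral => //.
  - by apply: measurableT_comp => //; exact/measurable_EFinP.
  - by move=> x _; rewrite lee_fin.
  - apply: filterS fK => x + Dx => /(_ Dx) fx.
    by rewrite lee_fin (le_trans fx)// ler_norm.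
rewrite integral_cst//; apply: lte_mul_pinfty => //.
Qed.

Lemma integrable_restrict_EFin D f : measurable D ->
  mu.-integrable D (EFin \o f) -> mu.-integrable setT (EFin \o (f \_ D)).
Proof. by move=> mD /(integrable_mkcond _ mD).1; rewrite restrict_EFin. Qed.

Lemma ae_le_Rintegral D f g : measurable D ->
  mu.-integrable D (EFin \o f) -> mu.-integrable D (EFin \o g) ->
  (\forall x \ae mu, D x -> f x <= g x) ->
  \int[mu]_(x in D) f x <= \int[mu]_(x in D) g x.
Proof.
move=> mD intf intg fg; rewrite -subr_ge0 -RintegralB//.
have intgf : mu.-integrable D (EFin \o (fun x => g x - f x)).
  rewrite (_ : _ \o _ = (EFin \o g) \- (EFin \o f))%E; last exact/funext.
  exact: integrableB.
have -> : \int[mu]_(x in D) (g x - f x) = \int[mu]_(x in D) `|g x - f x|.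
  congr fine; apply: ae_eq_integral => //.
  - exact: (measurable_int mu).
  - exact: (measurable_int mu (integrable_norm intgf)).
  - by apply: filterS fg => x + Dx => /(_ Dx) fgx; rewrite ger0_norm// subr_ge0.
exact: Rintegral_ge0.
Qed.

Lemma le_Rintegral_subset D D' f : measurable D -> measurable D' -> D' `<=` D ->
  (forall x, 0 <= f x) -> mu.-integrable D (EFin \o f) ->
  \int[mu]_(x in D') f x <= \int[mu]_(x in D) f x.
Proof.
move=> mD mD' sub f0 intf; apply: fine_le.
- by apply: integrable_fin_num => //; exact: integrableS intf.
- exact: integrable_fin_num.
- apply: ge0_subset_integral => //; first exact: (measurable_int mu).
  by move=> x _; rewrite lee_fin.
Qed.

Lemma ae_eq_Rintegral D f g : measurable D ->
  measurable_fun D f -> measurable_fun D g ->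
  (\forall x \ae mu, D x -> f x = g x) ->
  \int[mu]_(x in D) f x = \int[mu]_(x in D) g x.
Proof.
move=> mD mf mg fg; congr fine; apply: ae_eq_integral => //.
- exact/measurable_EFinP.
- exact/measurable_EFinP.
- by apply: filterS fg => x + Dx => /(_ Dx) ->.
Qed.

End EssentiallyBounded.

(** * Transfer along maps that multiply the measure of preimages by a constant *)

Section ScaledTransfer.
Context d1 d2 (X : measurableType d1) (Y : measurableType d2) (R : realType).
Variables (mu : {measure set X -> \bar R}) (nu : {measure set Y -> \bar R}).
Variables (k : R) (phi : X -> Y).
Hypothesis k0 : 0 <= k.
Hypothesis mphi : measurable_fun setT phi.
Hypothesis scale_phi :
  forall A, measurable A -> mu (phi @^-1` A) = (k%:E * nu A)%E.

Lemma measurable_preimage_map A : measurable A -> measurable (phi @^-1` A).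
Proof. by move=> mA; rewrite -[_ @^-1` _]setTI; exact: mphi. Qed.

(** All changes of variables below (affine maps of the line, shears, reflections, time shifts,
    exchange of coordinates) enter only through the factor by which they scale measures. *)
Lemma scaled_ae (P : Y -> Prop) :
  (\forall y \ae nu, P y) -> \forall x \ae mu, P (phi x).
Proof.
move=> [N [mN N0 PN]]; exists (phi @^-1` N); split.
- exact: measurable_preimage_map.
- by rewrite scale_phi// N0 mule0.
- by move=> x /= /PN.
Qed.

Lemma scaled_ess_bounded D f : measurable D ->
  ess_bounded nu D f -> ess_bounded mu (phi @^-1` D) (f \o phi).
Proof.
move=> mD [mf [K fK]]; split.
  apply: (measurable_comp (F := D)) => //.
    by move=> ? [x Dx <-].
  exact: measurable_funTS.
by exists K; exact: (scaled_ae fK).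
Qed.

Lemma scaled_ge0_integral D (f : Y -> \bar R) : measurable D ->
  measurable_fun D f -> (forall y, 0 <= f y)%E ->
  (\int[mu]_(x in phi @^-1` D) f (phi x) = k%:E * \int[nu]_(y in D) f y)%E.
Proof.
move=> mD mf f0.
rewrite -(@ge0_integral_pushforward _ _ _ _ _ _ mphi)//.
rewrite -[X in (X%:E * _)%E]/((NngNum k0)%:num).
rewrite -ge0_integral_mscale//.
by apply: eq_measure_integral => A mA _; exact: scale_phi.
Qed.

Lemma scaled_Rintegral D (f : Y -> R) : measurable D ->
  nu.-integrable D (EFin \o f) ->
  \int[mu]_(x in phi @^-1` D) f (phi x) = k * \int[nu]_(y in D) f y.
Proof.
move=> mD intf; have mf : measurable_fun D (EFin \o f) by exact: measurable_int intf.
rewrite /Rintegral integralE [in RHS]integralE.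
have fp : (\int[nu]_(x in D) (EFin \o f)^\+ x)%E \is a fin_num.
  by apply: integrable_pos_fin_num.
have fn : (\int[nu]_(x in D) (EFin \o f)^\- x)%E \is a fin_num.
  by apply: integrable_neg_fin_num.
have -> : (fun x => (f (phi x))%:E) = (EFin \o f) \o phi by [].
rewrite funepos_comp funeneg_comp.
rewrite (scaled_ge0_integral mD (measurable_funepos mf) (funepos_ge0 _)).
rewrite (scaled_ge0_integral mD (measurable_funeneg mf) (funeneg_ge0 _)).
rewrite -(fineK fp) -(fineK fn) -!EFinM -!EFinB /=; ring.
Qed.

End ScaledTransfer.

(** * Changes of variables in the plane *)

Section AffineMaps.
Context {R : realType}.
Local Notation leb := (@lebesgue_measure R).
Local Notation leb2 := (leb \x leb)%E.

Definition affine (k n x : R) : R := k * x + n.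

Lemma measurable_affine k n D : measurable_fun D (affine k n).
Proof. by apply: measurable_funD => //; exact: measurable_funM. Qed.

(** Uniqueness of Lebesgue measure: [|k|] times the image measure agrees with it on half-open
    intervals. For [k < 0] the preimage of []a, b]] is half-open on the other side. *)
Lemma affine_measure k n (A : set R) : k != 0 -> measurable A ->
  leb (affine k n @^-1` A) = ((`|k|^-1)%:E * leb A)%E.
Proof.
move=> k0 mA.
have nk0 : 0 <= `|k| by [].
pose m := mscale (NngNum nk0) (pushforward leb (affine k n : measurableTypeR R -> measurableTypeR R)).
have mk : measurable_fun setT (affine k n : measurableTypeR R -> measurableTypeR R).
  exact: measurable_affine.
suff -> : leb A = m mk A.
  by rewrite /m/= /mscale/= /pushforward muleA -EFinM mulVf ?normr_eq0// mul1e.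
apply: lebesgue_measure_unique => //.
move=> _ [[a b]] _ <-.
rewrite [RHS](_ : _ = (`|k|%:E * leb (affine k n @^-1` `]a, b]%classic))%E)//.
have [k_gt0|k_lt0|k_eq0] := ltgtP 0 k; last by rewrite k_eq0 eqxx in k0.
- rewrite (_ : _ @^-1` _ = `](a - n) / k, (b - n) / k]%classic); last first.
    apply/seteqP; split=> x; rewrite /affine /= !in_itv/= ltr_pdivrMr// ler_pdivlMr// => /andP[? ?]; apply/andP; split; lra.
  rewrite !lebesgue_measure_itv/= !lte_fin ltr_pM2r ?invr_gt0//.
  have -> : (a - n < b - n) = (a < b) by rewrite ltrD2r.
  case: ifPn => _; last by rewrite mule0.
  rewrite -!EFinB -EFinM gtr0_norm//; congr EFin; field; lra.
- rewrite (_ : _ @^-1` _ = `[(b - n) / k, (a - n) / k[%classic); last first.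
    apply/seteqP; split=> x; rewrite /affine /= !in_itv/= ltr_ndivlMr// ler_ndivrMr// => /andP[? ?]; apply/andP; split; lra.
  rewrite !lebesgue_measure_itv/= !lte_fin ltr_nM2r ?invr_lt0//.
  have -> : (a - n < b - n) = (a < b) by rewrite ltrD2r.
  case: ifPn => _; last by rewrite mule0.
  rewrite -!EFinB -EFinM ltr0_norm//; congr EFin; field; lra.
Qed.

(** One family for the shear along characteristics ([0 1 c 0]), the reflection of an edge
    ([0 (-1) 0 L]) and the time shift ([h 1 0 0]). *)
Definition skew (h k m n : R) (z : R * R) : R * R :=
  (z.1 + h, k * z.2 + (m * z.1 + n)).

Lemma measurable_skew h k m n D : measurable_fun D (skew h k m n).
Proof.
apply: measurable_funTS; apply: measurable_fun_pair => /=.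
  by apply: measurable_funD => //; exact: measurable_fst.
apply: measurable_funD; first by apply: measurable_funM => //; exact: measurable_snd.
apply: measurable_funD => //; apply: measurable_funM => //; exact: measurable_fst.
Qed.

(** By Fubini: at each fixed time the section is the preimage of a section under an affine map of
    slope [k], which produces the factor; the translation of time that remains preserves the
    measure. *)
Lemma skew_measure h k m n (A : set (R * R)) : k != 0 -> measurable A ->
  leb2 (skew h k m n @^-1` A) = ((`|k|^-1)%:E * leb2 A)%E.
Proof.
move=> k0 mA; rewrite /product_measure1/=.
have E s : leb (xsection (skew h k m n @^-1` A) s) =
    ((`|k|^-1)%:E * leb (xsection A (affine 1 h s)))%E.
  rewrite -(affine_measure (m * s + n))//; last exact: measurable_xsection.
  congr (leb _); apply/seteqP; split=> x; rewrite /xsection /= !inE /skew/affine/= mul1r//.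
under eq_integral do rewrite /= E.
rewrite ge0_integralZl//; last first.
  apply: (measurableT_comp (f := leb \o xsection A)); first exact: measurable_fun_xsection.
  exact: measurable_affine.
congr (_ * _)%E.
have H1 B : measurable B -> leb (affine 1 h @^-1` B) = (1%:E * leb B)%E.
  by move=> mB; rewrite affine_measure ?oner_eq0// normr1 invr1.
have := @scaled_ge0_integral _ _ _ _ _ leb leb 1 (affine 1 h) ler01
  (measurable_affine 1 h (D := setT)) H1 setT (leb \o xsection A) (@measurableT _ _)
  (measurable_fun_xsection leb mA) (fun x => measure_ge0 leb _).
by rewrite preimage_setT mul1e => <-.
Qed.

End AffineMaps.

(** * Null sets of a product and their sections *)

Section ProductSections.
Context d1 d2 (T1 : measurableType d1) (T2 : measurableType d2) (R : realType).
Variable m1 : {sigma_finite_measure set T1 -> \bar R}.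
Variable m2 : {sigma_finite_measure set T2 -> \bar R}.

Let measurable_swap_pair :
  measurable_fun setT (fun z : T1 * T2 => (z.2, z.1)).
Proof.
by apply: measurable_fun_pair; [exact: measurable_snd|exact: measurable_fst].
Qed.

Lemma swap_measure (A : set (T2 * T1)) : measurable A ->
  (m1 \x m2)%E ((fun z => (z.2, z.1)) @^-1` A) = (m2 \x m1)%E A.
Proof.
move=> mA; have ms := measurable_swap_pair.
apply/esym; apply: (@product_measure_unique _ _ _ _ _ _ _
  (pushforward (m1 \x m2)%E (fun z => (z.2, z.1)))) => // B C mB mC.
transitivity ((m1 \x m2)%E (C `*` B)); last by rewrite product_measure1E// muleC.
by congr ((m1 \x m2)%E _); apply/seteqP; split=> -[x y] /= [].
Qed.

Lemma ae_xsection (P : T1 * T2 -> Prop) : (\forall z \ae (m1 \x m2)%E, P z) ->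
  \forall x \ae m1, \forall y \ae m2, P (x, y).
Proof.
move=> [N [mN N0 PN]].
have : (\int[m1]_x `|(m2 \o xsection N) x|)%E = 0%E.
  by under eq_integral do rewrite gee0_abs//.
have H := @ae_eq_integral_abs _ _ _ m1 setT measurableT _ (measurable_fun_xsection m2 mN).
move/H; apply: filterS => x /= /(_ I) Nx; exists (xsection N x); split => //.
  exact: measurable_xsection.
by move=> y /= nP; rewrite /xsection/= inE; apply: PN.
Qed.

End ProductSections.

Section ProductSections2.
Context d1 d2 (T1 : measurableType d1) (T2 : measurableType d2) (R : realType).
Variable m1 : {sigma_finite_measure set T1 -> \bar R}.
Variable m2 : {sigma_finite_measure set T2 -> \bar R}.

Let measurable_swap_pair :
  measurable_fun setT (fun z : T2 * T1 => (z.2, z.1)).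
Proof.
by apply: measurable_fun_pair; [exact: measurable_snd|exact: measurable_fst].
Qed.

Lemma ae_ysection (P : T1 * T2 -> Prop) : (\forall z \ae (m1 \x m2)%E, P z) ->
  \forall y \ae m2, \forall x \ae m1, P (x, y).
Proof.
move=> Pz; apply: (@ae_xsection _ _ _ _ _ m2 m1 (fun z => P (z.2, z.1))).
apply: (@scaled_ae _ _ _ _ _ (m2 \x m1)%E (m1 \x m2)%E 1 (fun z : T2 * T1 => (z.2, z.1))) => //.
by move=> A mA; rewrite mul1e; exact: swap_measure.
Qed.

(** Tonelli's converse of [ae_ysection]. The exceptional set has to be measurable: null sections
    alone do not bound the measure of a set of the product. *)
Lemma ae_from_ysection (N : set (T1 * T2)) : measurable N ->
  (\forall y \ae m2, \forall x \ae m1, ~ N (x, y)) ->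
  \forall z \ae (m1 \x m2)%E, ~ N z.
Proof.
move=> mN H; exists N; split => //; last by move=> z /= /contrapT.
have mN' : measurable ((fun z : T2 * T1 => (z.2, z.1)) @^-1` N).
  by rewrite -[_ @^-1` _]setTI; exact: measurable_swap_pair.
rewrite -(swap_measure m2 m1 mN) /product_measure1/=.
rewrite (@ae_eq_integral _ _ _ m2 setT (cst 0%E))//; first by rewrite integral0.
  exact: (measurable_fun_xsection m1).
apply: filterS H => y [M [mM M0 NM]] _ /=.
apply: (@subset_measure0 _ _ _ _ _ M) => //; first exact: measurable_xsection.
by move=> x; rewrite /xsection/= inE => Nx; apply: NM => /=; rewrite notK.
Qed.

End ProductSections2.

(** * Integrals over time intervals and the square of an integrated equation *)

Section IntervalIntegrals.
Context {R : realType}.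
Local Notation leb := (@lebesgue_measure R).

Lemma lebesgue_itv_lty (a b : R) : (leb `[a, b] < +oo)%E.
Proof. by rewrite lebesgue_measure_itv/=; case: ifPn => // _; rewrite -EFinB ltry. Qed.

Lemma fine_lebesgue_itv (a b : R) : a <= b -> fine (leb `[a, b]) = b - a.
Proof.
move=> ab; rewrite lebesgue_measure_itv/= lte_fin.
by case: ltgtP ab => //= ->; rewrite subrr.
Qed.

Lemma integrable_itvS (a b s t : R) (f : R -> R) : a <= s -> t <= b ->
  leb.-integrable `[a, b] (EFin \o f) -> leb.-integrable `[s, t] (EFin \o f).
Proof.
move=> as_ tb; apply: integrableS => // x /=; rewrite !in_itv/= => /andP[sx xt].
by rewrite (le_trans as_ sx) (le_trans xt tb).
Qed.

Lemma Rintegral_itv_split (a m b : R) (f : R -> R) : a <= m -> m <= b ->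
  leb.-integrable `[a, b] (EFin \o f) ->
  \int[leb]_(x in `[a, b]) f x =
    \int[leb]_(x in `[a, m]) f x + \int[leb]_(x in `[m, b]) f x.
Proof.
move=> am mb intf; have := @Rintegral_itvB _ f (BLeft a) (BRight b) m intf.
rewrite !bnd_simp => /(_ am mb); rewrite Rintegral_itv_obnd_cbnd; first lra.
by apply: integrableS intf => // x /=; rewrite !in_itv/= => /andP[/ltW mx ->]; rewrite (le_trans am mx).
Qed.

Lemma le_Rintegral_itvS (a b s t : R) (f : R -> R) :
  a <= s -> s <= t -> t <= b -> (forall x, 0 <= f x) ->
  leb.-integrable `[a, b] (EFin \o f) ->
  \int[leb]_(x in `[s, t]) f x <= \int[leb]_(x in `[a, b]) f x.
Proof.
move=> as_ st tb f0 intf.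
rewrite (Rintegral_itv_split (le_trans as_ st) tb intf).
rewrite (Rintegral_itv_split as_ st); last exact: integrable_itvS intf.
have := @Rintegral_ge0 _ _ _ leb `[a, s] f (fun x _ => f0 x).
have := @Rintegral_ge0 _ _ _ leb `[t, b] f (fun x _ => f0 x); lra.
Qed.

Lemma Rintegral_itv_le (a b K : R) (f : R -> R) : a <= b ->
  measurable_fun `[a, b] f ->
  (\forall x \ae leb, x \in `[a, b] -> `|f x| <= K) ->
  `|\int[leb]_(x in `[a, b]) f x| <= K * (b - a).
Proof.
move=> ab mf fK.
have intf : leb.-integrable `[a, b] (EFin \o f).
  apply: ess_bounded_integrable => //; first exact: lebesgue_itv_lty.
  by split => //; exists K.
apply: le_trans (le_normr_Rintegral _ intf) _ => //.
rewrite -(fine_lebesgue_itv ab) -Rintegral_cst//.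
apply: ae_le_Rintegral => //.
- exact: (integrable_norm intf).
- apply: ess_bounded_integrable => //; first exact: lebesgue_itv_lty.
  exact: ess_bounded_cst.
Qed.

(** Cut [[a, b]] into [n] equal pieces: the increments add up to at most
    [n * C * ((b - a) / n) ^+ 2], which tends to 0. This takes the place of differentiating
    [psi]. *)
Lemma quadratic_increment_cst (a b C : R) (psi : R -> R) : a <= b ->
  (forall s t, a <= s -> s <= t -> t <= b -> `|psi t - psi s| <= C * (t - s) ^+ 2) ->
  psi b = psi a.
Proof.
move=> ab H; apply/eqP; rewrite -subr_eq0 -normr_le0.
have C0 : 0 <= C * (b - a) ^+ 2 by apply: le_trans (H a b _ _ _).
have step n k h : h = (b - a) / n.+1%:R -> (k <= n.+1)%N ->
    `|psi (a + h * k%:R) - psi a| <= k%:R * (C * h ^+ 2).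
  have n0 : 0 < n.+1%:R :> R by [].
  move=> hE; elim: k => [|k IHk] kn; first by rewrite mulr0 addr0 subrr normr0 mul0r.
  have h0 : 0 <= h by rewrite hE divr_ge0// subr_ge0.
  have -> : psi (a + h * k.+1%:R) - psi a =
    (psi (a + h * k.+1%:R) - psi (a + h * k%:R)) + (psi (a + h * k%:R) - psi a) by ring.
  rewrite (le_trans (ler_normD _ _))// (_ : k.+1%:R * (C * h ^+ 2) = C * h ^+ 2 + k%:R * (C * h ^+ 2)); last first.
    by rewrite -natr1; ring.
  apply: lerD; last exact/IHk/ltnW.
  have -> : C * h ^+ 2 = C * ((a + h * k.+1%:R) - (a + h * k%:R)) ^+ 2.
    by rewrite -natr1; ring.
  apply: H; first by rewrite lerDl mulr_ge0.
    by rewrite lerD2l ler_wpM2l// ler_nat.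
  have : h * k.+1%:R <= h * n.+1%:R by rewrite ler_wpM2l// ler_nat.
  have -> : h * n.+1%:R = b - a by rewrite hE mulfVK// pnatr_eq0.
  set X := h * _; lra.
rewrite leNgt; apply/negP => p0.
pose D := C * (b - a) ^+ 2.
have [n Hn] : exists n : nat, D / `|psi b - psi a| < n%:R.
  exists (Num.truncn (D / `|psi b - psi a|)).+1; exact: truncnS_gt.
have := step n n.+1 _ erefl (leqnn _).
have : n.+1%:R != 0 :> R by rewrite pnatr_eq0.
have : n%:R < n.+1%:R :> R by rewrite ltr_nat.
move: n.+1%:R => N nN N0.
rewrite (_ : a + _ = b); last by field.
apply/negP; rewrite -ltNge.
have -> : N * (C * ((b - a) / N) ^+ 2) = D / N by rewrite /D; field.
rewrite ltr_pdivrMr ?(le_lt_trans _ nN)// mulrC -ltr_pdivrMr//.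
exact: lt_trans nN.
Qed.

(** The chain rule for [z ^+ 2] along one characteristic, where [z] is merely Lipschitz: [z t ^+ 2]
    plus twice the integral of [z * g] up to [t] has increments of second order, hence is
    constant. *)
Lemma mild_square (a b K : R) (z g : R -> R) : a <= b ->
  measurable_fun `[a, b] z -> measurable_fun `[a, b] g ->
  (\forall r \ae leb, r \in `[a, b] -> `|g r| <= K) ->
  (forall s t, a <= s -> s <= t -> t <= b ->
     z t = z s - \int[leb]_(r in `[s, t]) g r) ->
  z b ^+ 2 = z a ^+ 2 - 2 * \int[leb]_(r in `[a, b]) (z r * g r).
Proof.
move=> ab mz mg gK H.
have lip s t : a <= s -> s <= t -> t <= b -> `|z t - z s| <= K * (t - s).
  move=> as_ st tb; rewrite (H s t)//.
  have -> : z s - \int[leb]_(r in `[s, t]) g r - z s = - \int[leb]_(r in `[s, t]) g r by ring.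
  have sub : `[s, t]%classic `<=` `[a, b]%classic.
    by move=> x /=; rewrite !in_itv/= => /andP[sx xt]; rewrite (le_trans as_ sx) (le_trans xt tb).
  rewrite normrN; apply: Rintegral_itv_le => //; first exact: measurable_funS mg.
  by apply: (ae_imp _ gK) => x + xst => /(_ (sub _ xst)).
have gI : leb.-integrable `[a, b] (EFin \o g).
  apply: ess_bounded_integrable => //; first exact: lebesgue_itv_lty.
  by split => //; exists K.
have zbd : ess_bounded leb `[a, b] z.
  split => //; exists (`|z a| + K * (b - a)); apply: nearW => x /=.
  rewrite in_itv/= => /andP[ax xb].
  have -> : z x = z a + (z x - z a) by ring.
  rewrite (le_trans (ler_normD _ _))// lerD2l (le_trans (lip a x _ _ _))//.
  have K0 : a < b -> 0 <= K.
    move=> lab; have := lip a b (lexx _) ab (lexx _).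
    move=> /(le_trans (normr_ge0 _)); rewrite pmulr_lge0// subr_gt0//.
  have [lab|] := ltP a b; last by move=> ba; have : x = b by [lra]; move=> ->.
  by rewrite ler_wpM2l ?K0//; lra.
have gbd : ess_bounded leb `[a, b] g by split => //; exists K.
have zgI : leb.-integrable `[a, b] (EFin \o (fun r => z r * g r)).
  apply: ess_bounded_integrable => //; first exact: lebesgue_itv_lty.
  exact: ess_boundedM.
pose psi t := z t ^+ 2 + 2 * \int[leb]_(r in `[a, t]) (z r * g r).
have : psi b = psi a.
  apply: (@quadratic_increment_cst a b (2 * K ^+ 2)) => // s t as_ st tb.
  have sub : `[s, t]%classic `<=` `[a, b]%classic.
    by move=> x /=; rewrite !in_itv/= => /andP[sx xt]; rewrite (le_trans as_ sx) (le_trans xt tb).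
  have zgst := integrable_itvS as_ tb zgI.
  have gst := integrable_itvS as_ tb gI.
  rewrite /psi (@Rintegral_itv_split a s t)//; last first.
    by apply: integrable_itvS zgI.
  (* Since [z t ^+ 2 - z s ^+ 2 = 2 * m * (z t - z s)], the increment of [psi] is twice the integral
     of [(z r - m) * g r], and [z r - m] is itself of order [t - s]. *)
  pose m := (z t + z s) / 2.
  have E : \int[leb]_(r in `[s, t]) ((z r - m) * g r) =
      \int[leb]_(r in `[s, t]) (z r * g r) - m * \int[leb]_(r in `[s, t]) g r.
    rewrite -RintegralZl// -RintegralB//.
      by apply: eq_Rintegral => r _; ring.
    by apply: (integrableZl _ m gst).
  have -> : z t ^+ 2 + 2 * (\int[leb]_(x in `[a, s]) (z x * g x) +
      \int[leb]_(x in `[s, t]) (z x * g x)) -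
      (z s ^+ 2 + 2 * \int[leb]_(r in `[a, s]) (z r * g r)) =
      2 * \int[leb]_(r in `[s, t]) ((z r - m) * g r).
    by rewrite E /m (H s t)//; field.
  have -> : 2 * K ^+ 2 * (t - s) ^+ 2 = 2 * ((K * (t - s) * K) * (t - s)) by ring.
  rewrite normrM ger0_norm// ler_pM2l//.
  apply: Rintegral_itv_le => //.
    apply: measurable_funM; last exact: measurable_funS mg.
    apply: measurable_funB => //; exact: measurable_funS mz.
  apply: (ae_imp _ gK) => r + rst => /(_ (sub _ rst)) grK.
  rewrite normrM ler_pM//.
  move: rst; rewrite /= in_itv/= => /andP[sr rt].
  have l1 := lip s r as_ sr (le_trans rt tb).
  have l2 := lip r t (le_trans as_ sr) rt tb.
  have -> : z r - m = ((z r - z s) - (z t - z r)) / 2 by rewrite /m; field.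
  rewrite normrM [`|2^-1|]ger0_norm//.
  have := ler_normB (z r - z s) (z t - z r).
  have K0 : 0 <= K by exact: le_trans grK.
  have : 0 <= K * (t - r) by rewrite mulr_ge0// subr_ge0.
  have : 0 <= K * (r - s) by rewrite mulr_ge0// subr_ge0.
  nra.
rewrite /psi set_itv1 Rintegral_set1; lra.
Qed.

(** Cauchy-Schwarz against the constant 1, obtained by integrating [2 * k * g <= k ^+ 2 + g ^+ 2]
    with [k] the mean value of [g]. *)
Lemma Rintegral_itv_sqr (a b : R) (g : R -> R) : a <= b ->
  ess_bounded leb `[a, b] g ->
  (\int[leb]_(r in `[a, b]) g r) ^+ 2 <= (b - a) * \int[leb]_(r in `[a, b]) (g r ^+ 2).
Proof.
move=> ab bg; have I f : ess_bounded leb `[a, b] f -> leb.-integrable `[a, b] (EFin \o f).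
  by apply: ess_bounded_integrable => //; exact: lebesgue_itv_lty.
have [lab|] := ltP a b; last first.
  move=> ba; have -> : a = b by lra.
  by rewrite set_itv1 !Rintegral_set1 mulr0 expr0n.
set G := \int[leb]_(r in `[a, b]) g r; set Q := \int[leb]_(r in `[a, b]) _.
pose k := G / (b - a).
have : \int[leb]_(r in `[a, b]) (2 * k * g r) <= \int[leb]_(r in `[a, b]) (k ^+ 2 + g r ^+ 2).
  apply: le_Rintegral => //.
  - by apply: I; apply: ess_boundedM => //; exact: ess_bounded_cst.
  - by apply: I; apply: ess_boundedD; [exact: ess_bounded_cst|exact: ess_boundedX].
  - by move=> x _; have := sqr_ge0 (k - g x); rewrite sqrrB; lra.
rewrite RintegralZl//; last exact: I.
rewrite RintegralD//; [|apply: I; exact: ess_bounded_cst|apply: I; exact: ess_boundedX].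
rewrite Rintegral_cst// fine_lebesgue_itv// -/G -/Q /k => H.
have : 0 <= Q - G ^+ 2 / (b - a).
  suff : 2 * (G / (b - a)) * G - (G / (b - a)) ^+ 2 * (b - a) = G ^+ 2 / (b - a) by lra.
  by field; lra.
rewrite subr_ge0 ler_pdivrMr ?subr_gt0//; lra.
Qed.

Lemma ae_exists (D : set R) (P : R -> Prop) : measurable D -> (0 < leb D)%E ->
  (\forall x \ae leb, D x -> P x) -> exists2 x, D x & P x.
Proof.
move=> mD D0 [N [mN N0 HN]]; apply: contrapT => nex.
suff : (leb D <= leb N)%E by rewrite N0 leNgt D0.
apply: le_measure; rewrite ?inE// => x Dx; apply: HN => /= H.
by apply: nex; exists x => //; exact: H.
Qed.

End IntervalIntegrals.

(** * Functions transported along characteristics *)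

Section Transport.
Context {R : realType}.
Local Notation leb := (@lebesgue_measure R).
Local Notation leb2 := (leb \x leb)%E.

Definition slab (t1 t2 L : R) : set (R * R) := `[t1, t2] `*` `[0, L].

Lemma measurable_slab t1 t2 L : measurable (slab t1 t2 L).
Proof. exact: measurableX. Qed.

Lemma slabS t1 t2 s1 s2 L : t1 <= s1 -> s2 <= t2 -> slab s1 s2 L `<=` slab t1 t2 L.
Proof.
move=> ts st [s x] [/=]; rewrite in_itv/= => /andP[h1 h2] xL; split => //=.
by rewrite in_itv/= (le_trans ts h1) (le_trans h2 st).
Qed.

Lemma slab_lty t1 t2 L : (leb2 (slab t1 t2 L) < +oo)%E.
Proof.
rewrite product_measure1E//; apply: lte_mul_pinfty => //; last exact: lebesgue_itv_lty.
by rewrite ge0_fin_numE//; exact: lebesgue_itv_lty.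
Qed.

Lemma ess_bounded_slab_integrable t1 t2 L (F : R * R -> R) :
  ess_bounded leb2 (slab t1 t2 L) F -> leb2.-integrable (slab t1 t2 L) (EFin \o F).
Proof.
by apply: ess_bounded_integrable; [exact: measurable_slab|exact: slab_lty].
Qed.

Lemma ess_bounded_itv_integrable (a b : R) (f : R -> R) :
  ess_bounded leb `[a, b] f -> leb.-integrable `[a, b] (EFin \o f).
Proof. by apply: ess_bounded_integrable => //; exact: lebesgue_itv_lty. Qed.

Lemma measurable_slab_l t1 t2 L (F : R * R -> R) t :
  measurable_fun (slab t1 t2 L) F -> t \in `[t1, t2] ->
  measurable_fun `[0, L] (fun x => F (t, x)).
Proof.
move=> mF tT; apply: (@measurable_comp _ _ _ _ _ _ (slab t1 t2 L) F _ (pair t)) => //.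
- exact: measurable_slab.
- by move=> ? [x xL <-].
- exact: measurable_funTS.
Qed.

Lemma measurable_slab_r t1 t2 L (F : R * R -> R) x :
  measurable_fun (slab t1 t2 L) F -> x \in `[0, L] ->
  measurable_fun `[t1, t2] (fun t => F (t, x)).
Proof.
move=> mF xL; apply: (@measurable_comp _ _ _ _ _ _ (slab t1 t2 L) F _ (pair^~ x)) => //.
- exact: measurable_slab.
- by move=> ? [t tT <-].
- exact: measurable_funTS.
Qed.

Variables (c L : R).
Hypotheses (c_gt0 : 0 < c) (L_gt0 : 0 < L).

(** The second coordinate of the argument is the label [x - c * t] of a characteristic, so the
    characteristics become the sections at a fixed second coordinate. *)
Definition shear (z : R * R) : R * R := (z.1, z.2 + c * z.1).

Let shearE : shear = skew 0 1 c 0.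
Proof. by apply/funext => z; rewrite /shear /skew mul1r !addr0. Qed.

Lemma measurable_shear D : measurable_fun D shear.
Proof. by rewrite shearE; exact: measurable_skew. Qed.

Lemma shear_measure (A : set (R * R)) : measurable A ->
  leb2 (shear @^-1` A) = (1%:E * leb2 A)%E.
Proof. by move=> mA; rewrite shearE skew_measure ?oner_eq0// normr1 invr1. Qed.

Definition line (t1 t2 eta : R) : set R := [set s | slab t1 t2 L (s, eta + c * s)].

Lemma measurable_line t1 t2 eta : measurable (line t1 t2 eta).
Proof.
rewrite (_ : line _ _ _ = ysection (shear @^-1` slab t1 t2 L) eta).
  apply: measurable_ysection; rewrite -[_ @^-1` _]setTI.
  by apply: measurable_shear => //; exact: measurable_slab.
by apply/seteqP; split => s; rewrite /line /ysection /= inE.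
Qed.

Lemma itv_line t1 t2 eta s t : t1 <= s -> t <= t2 -> 0 <= eta + c * s ->
  eta + c * t <= L -> `[s, t]%classic `<=` line t1 t2 eta.
Proof.
move=> ts tt h1 h2 r /=; rewrite !in_itv/= => /andP[sr rt].
split; rewrite /= in_itv/= ?(le_trans ts sr) ?(le_trans rt tt)//.
by rewrite (le_trans h1) ?(le_trans _ h2)// lerD2l ler_pM2l.
Qed.

Lemma ess_bounded_line t1 t2 (F : R * R -> R) :
  ess_bounded leb2 (slab t1 t2 L) F ->
  exists K, \forall eta \ae leb,
    measurable_fun (line t1 t2 eta) (fun s => F (s, eta + c * s)) /\
    \forall s \ae leb, line t1 t2 eta s -> `|F (s, eta + c * s)| <= K.
Proof.
move=> bF.
have mS := measurable_slab t1 t2 L.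
have := @scaled_ess_bounded _ _ _ _ _ leb2 leb2 1 shear (@measurable_shear setT) shear_measure _ _ mS bF.
move=> [mFs [K FK]]; exists K.
apply: (ae_imp _ (ae_ysection FK)) => eta HK; split => //.
apply: (@measurable_comp _ _ _ _ _ _ (slab t1 t2 L) F _ (fun s => shear (s, eta))) => //.
- by move=> ? [s h <-].
- exact: bF.1.
- by apply: (measurableT_comp (f := shear)); [exact: measurable_shear|exact: measurable_funTS].
Qed.

(** Between any two times on almost every characteristic, whether it enters the rectangle through
    [t = 0] or through [x = 0]. In contrast to [mild_solution], initial and boundary lines are not
    distinguished, which makes the notion stable under differences and time shifts. *)
Definition transported (T : R) (p g : R -> R -> R) : Prop :=
  \forall eta \ae leb, forall s t, 0 <= s -> s <= t -> t <= T ->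
    0 <= eta + c * s -> eta + c * t <= L ->
    p t (eta + c * t) = p s (eta + c * s) - \int[leb]_(r in `[s, t]) g r (eta + c * r).

Definition uncur (p : R -> R -> R) (z : R * R) : R := p z.1 z.2.

Lemma ae_neq (a : R) : \forall x \ae leb, x != a.
Proof.
exists [set a]; split => //; first exact: lebesgue_measure_set1.
by move=> x /= /negP; rewrite negbK => /eqP.
Qed.

(** Almost every line carries a time at which the bound on the rectangle holds, and the equation
    limits the variation from there. The result holds at every time of the line, as needed on
    sections and traces, which are null sets of the rectangle. *)
Lemma line_bounded T p g : 0 < T ->
  ess_bounded leb2 (slab 0 T L) (uncur p) -> ess_bounded leb2 (slab 0 T L) (uncur g) ->
  transported T p g ->
  exists K, \forall eta \ae leb, forall s, line 0 T eta s -> `|p s (eta + c * s)| <= K.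
Proof.
move=> T0 bp bg tr; have [Kp Hp] := ess_bounded_line bp.
have [Kg Hg] := ess_bounded_line bg.
exists (Kp + `|Kg| * T).
apply: (ae_imp2 _ (ae_imp2 (fun _ x y => conj x y) Hp Hg)
         (ae_imp2 (fun _ x y => conj x y) tr (ae_imp2 (fun _ x y => conj x y) (ae_neq L) (ae_neq (- c * T))))).
move=> eta [[_ pK] [mg gK]] [Htr [/eqP nL /eqP nT]] s0 ls0.
have [/=] := ls0; rewrite !in_itv/= => /andP[s00 s0T] /andP[h1 h2].
(* Times of entry and exit. The discarded labels [L] and [- c * T] are those of lines that meet the
   rectangle in a single point; for the others [a < b], so a good time exists. *)
pose a := Num.max 0 (- eta / c); pose b := Num.min T ((L - eta) / c).
have eL : eta < L by rewrite lt_neqAle; apply/andP; split; [exact/eqP|have : 0 <= c * s0 by [rewrite mulr_ge0// ltW]; lra].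
have eT : - c * T < eta.
  rewrite lt_neqAle; apply/andP; split; first exact/eqP/nesym.
  have : c * s0 <= c * T by rewrite ler_pM2l. lra.
have ab : a < b.
  rewrite /a /b gt_max !lt_min T0/= divr_gt0 ?subr_gt0//=.
  by apply/andP; split; [rewrite ltr_pdivrMr//; lra|rewrite ltr_pM2r ?invr_gt0//; rewrite -[ltLHS]add0r ltrD2r].
have abl : `[a, b]%classic `<=` line 0 T eta.
  apply: itv_line.
  - by rewrite le_max lexx.
  - by rewrite ge_min lexx.
  - suff : - eta <= c * a by lra.
    by rewrite mulrC -ler_pdivrMr// le_max lexx orbT.
  - suff : c * b <= L - eta by lra.
    by rewrite mulrC -ler_pdivlMr// ge_min lexx orbT.
have [s1 s1ab p1] : exists2 s1, `[a, b]%classic s1 & `|p s1 (eta + c * s1)| <= Kp.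
  apply: ae_exists => //; first by rewrite lebesgue_measure_itv/= lte_fin ab -EFinB lte_fin subr_gt0.
  by apply: (ae_imp _ pK) => s + /abl.
have ls1 := abl _ s1ab; have [/=] := ls1; rewrite !in_itv/= => /andP[s10 s1T] /andP[k1 k2].
have key s t : 0 <= s -> s <= t -> t <= T -> 0 <= eta + c * s -> eta + c * t <= L ->
    `|p t (eta + c * t) - p s (eta + c * s)| <= `|Kg| * T.
  move=> h3 h4 h5 h6 h7; rewrite (Htr s t)//.
  rewrite addrAC subrr add0r normrN.
  apply: (@le_trans _ _ (`|Kg| * (t - s))); last by rewrite ler_wpM2l//; lra.
  have sub : `[s, t]%classic `<=` line 0 T eta by exact: itv_line.
  apply: Rintegral_itv_le => //; first exact: (measurable_funS (measurable_line 0 T eta) sub mg).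
  by apply: (ae_imp _ gK) => r + /sub lr => /(_ lr) /le_trans; apply; rewrite ler_norm.
have [s01|s10'] := leP s0 s1.
  have := key s0 s1 s00 s01 s1T h1 k2.
  rewrite -normrN opprB => h.
  have -> : p s0 (eta + c * s0) = p s1 (eta + c * s1) + (p s0 (eta + c * s0) - p s1 (eta + c * s1)) by ring.
  by rewrite (le_trans (ler_normD _ _))// lerD.
have h := key s1 s0 s10 (ltW s10') s0T k1 h2.
have -> : p s0 (eta + c * s0) = p s1 (eta + c * s1) + (p s0 (eta + c * s0) - p s1 (eta + c * s1)) by ring.
by rewrite (le_trans (ler_normD _ _))// lerD.
Qed.

Lemma ae_affine k n (P : R -> Prop) : k != 0 -> (\forall x \ae leb, P x) ->
  \forall x \ae leb, P (k * x + n).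
Proof.
move=> k0; apply: (@scaled_ae _ _ _ _ _ leb leb (`|k|^-1) (affine k n)).
- exact: measurable_affine.
- by move=> A mA; exact: affine_measure.
Qed.

(** The points of a section correspond to labels by [x - c * t], which preserves null sets, and
    [line_bounded] holds at the time [t] of almost every line. *)
Lemma ess_bounded_section T p g t : 0 < T ->
  ess_bounded leb2 (slab 0 T L) (uncur p) -> ess_bounded leb2 (slab 0 T L) (uncur g) ->
  transported T p g -> t \in `[0, T] -> ess_bounded leb `[0, L] (p t).
Proof.
move=> T0 bp bg tr tT; split; first exact: (measurable_slab_l bp.1 tT).
have [K HK] := line_bounded T0 bp bg tr; exists K.
have := @ae_affine 1 (- c * t) _ (oner_neq0 _) HK.
apply: ae_imp => x /(_ t); rewrite mul1r mulNr subrK => H xL; apply: H.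
by split; rewrite /= ?subrK.
Qed.

Lemma ess_bounded_trace T p g x : 0 < T ->
  ess_bounded leb2 (slab 0 T L) (uncur p) -> ess_bounded leb2 (slab 0 T L) (uncur g) ->
  transported T p g -> x \in `[0, L] -> ess_bounded leb `[0, T] (p^~ x).
Proof.
move=> T0 bp bg tr xL; split; first exact: (measurable_slab_r bp.1 xL).
have [K HK] := line_bounded T0 bp bg tr; exists K.
have c0 : - c != 0 by rewrite oppr_eq0 gt_eqF.
have := @ae_affine (- c) x _ c0 HK.
have E s : - c * s + x + c * s = x by ring.
by apply: ae_imp => s /(_ s); rewrite E => H sT; apply: H; split; rewrite /= ?E.
Qed.

End Transport.

(** * Integration over the family of characteristics *)

Section EnergyOnLines.
Context {R : realType}.
Local Notation leb := (@lebesgue_measure R).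
Local Notation leb2 := (leb \x leb)%E.

Lemma Rintegral_affine (k n u v u' v' : R) (f : R -> R) : k != 0 ->
  (affine k n @^-1` `[u', v'] = `[u, v]%classic) ->
  leb.-integrable `[u', v'] (EFin \o f) ->
  \int[leb]_(x in `[u, v]) f (k * x + n) = `|k|^-1 * \int[leb]_(x in `[u', v']) f x.
Proof.
move=> k0 <- intf; rewrite -(@scaled_Rintegral _ _ _ _ _ leb leb _ (affine k n))//.
- exact: measurable_affine.
- by move=> A mA; exact: affine_measure.
Qed.

Lemma Rintegral_shift (n u v : R) (f : R -> R) :
  leb.-integrable `[u + n, v + n] (EFin \o f) ->
  \int[leb]_(x in `[u, v]) f (x + n) = \int[leb]_(x in `[u + n, v + n]) f x.
Proof.
move=> intf; rewrite -[RHS]mul1r -[X in X * _]invr1 -[X in X^-1]normr1.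
rewrite -(@Rintegral_affine 1 n u v)//; first by under eq_Rintegral do rewrite -[X in X + n]mul1r.
by apply/seteqP; split => x; rewrite /affine /= !in_itv/= mul1r !lerD2r.
Qed.

Lemma Rintegral_reflect (k n u v : R) (f : R -> R) : 0 < k ->
  leb.-integrable `[(n - v) / k, (n - u) / k] (EFin \o f) ->
  \int[leb]_(x in `[u, v]) f ((n - x) / k) =
    k * \int[leb]_(x in `[(n - v) / k, (n - u) / k]) f x.
Proof.
move=> k0 intf; have nk0 : - k^-1 != 0 by rewrite oppr_eq0 invr_eq0 gt_eqF.
have -> : k * \int[leb]_(x in `[(n - v) / k, (n - u) / k]) f x =
   `|- k^-1|^-1 * \int[leb]_(x in `[(n - v) / k, (n - u) / k]) f x.
  by rewrite normrN gtr0_norm ?invr_gt0// invrK.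
rewrite -(@Rintegral_affine (- k^-1) (n / k) u v)//.
  by apply: eq_Rintegral => x _; congr f; ring.
apply/seteqP; split => x; rewrite /affine /= !in_itv/= !ler_pdivrMr// !ler_pdivlMr//.
  have -> : (- k^-1 * x + n / k) * k = n - x by field; rewrite gt_eqF.
  by move=> /andP[? ?]; apply/andP; split; lra.
have -> : (- k^-1 * x + n / k) * k = n - x by field; rewrite gt_eqF.
by move=> /andP[? ?]; apply/andP; split; lra.
Qed.

Variables (c L : R).
Hypotheses (c_gt0 : 0 < c) (L_gt0 : 0 < L).

(** The shape [0 - eta], parallel to [L - eta] in [exit_time], is the case [n = 0] of the
    substitution in [Rintegral_reflect]. *)
Definition entry_time (t1 eta : R) := Num.max t1 ((0 - eta) / c).
Definition exit_time (t2 eta : R) := Num.min t2 ((L - eta) / c).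

Lemma lineE t1 t2 eta : line c L t1 t2 eta = `[entry_time t1 eta, exit_time t2 eta]%classic.
Proof.
apply/seteqP; split => s; rewrite /line /slab /entry_time /exit_time /= !in_itv/= ge_max le_min.
  rewrite ler_pdivrMr// ler_pdivlMr// => -[/andP[-> ->]] /andP[? ?].
  by apply/andP; split => /=; lra.
rewrite ler_pdivrMr// ler_pdivlMr// => /andP[/andP[-> h1] /andP[-> h2]]; split => //.
by apply/andP; split; lra.
Qed.

Lemma entry_exit t1 t2 eta : t1 <= t2 -> eta \in `[0 - c * t2, L - c * t1] ->
  [/\ t1 <= entry_time t1 eta, entry_time t1 eta <= exit_time t2 eta,
      exit_time t2 eta <= t2, 0 <= eta + c * entry_time t1 eta &
      eta + c * exit_time t2 eta <= L].
Proof.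
move=> t12; rewrite in_itv/= => /andP[h1 h2].
have c1 : c^-1 * c = 1 by rewrite mulVf// gt_eqF.
split.
- by rewrite le_max lexx.
- rewrite /entry_time /exit_time ge_max !le_min t12/=.
  apply/andP; split; first by rewrite ler_pdivlMr//; lra.
  by apply/andP; split; [rewrite ler_pdivrMr//; lra|rewrite ler_pM2r ?invr_gt0//; have := L_gt0; lra].
- by rewrite ge_min lexx.
- suff : 0 - eta <= c * entry_time t1 eta by lra.
  by rewrite mulrC -ler_pdivrMr// le_max lexx orbT.
- suff : c * exit_time t2 eta <= L - eta by lra.
  by rewrite mulrC -ler_pdivlMr// ge_min lexx orbT.
Qed.

Lemma line_empty t1 t2 eta : t1 <= t2 -> eta \notin `[0 - c * t2, L - c * t1] ->
  line c L t1 t2 eta = set0.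
Proof.
move=> t12 nJ; apply/seteqP; split => // s [/=].
rewrite !in_itv/= => /andP[h1 h2] /andP[h3 h4].
move/negP: nJ; apply; rewrite in_itv/=.
have : c * t1 <= c * s by rewrite ler_pM2l.
have : c * s <= c * t2 by rewrite ler_pM2l.
by move=> h5 h6; apply/andP; split; lra.
Qed.

Definition line_integral (t1 t2 : R) (F : R * R -> R) (eta : R) : R :=
  \int[leb]_(s in `[entry_time t1 eta, exit_time t2 eta]) F (s, eta + c * s).

(** Fubini in the coordinates time and label, which preserve the area. Only the labels in the stated
    interval have a nonempty line; measurability of the inner integral comes from Fubini's theorem
    as well. *)
Lemma fubini_lines t1 t2 (F : R * R -> R) : t1 <= t2 ->
  ess_bounded leb2 (slab t1 t2 L) F ->
  ess_bounded leb `[0 - c * t2, L - c * t1] (line_integral t1 t2 F) /\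
  \int[leb2]_(z in slab t1 t2 L) F z =
    \int[leb]_(eta in `[0 - c * t2, L - c * t1]) line_integral t1 t2 F eta.
Proof.
move=> t12 bF; have mS := measurable_slab t1 t2 L.
have [K HK] := ess_bounded_line c bF.
set D := shear c @^-1` slab t1 t2 L.
have mD : measurable D.
  by rewrite /D -[_ @^-1` _]setTI; apply: measurable_shear => //.
have bD := @scaled_ess_bounded _ _ _ _ _ leb2 leb2 1 (shear c)
   (@measurable_shear _ c setT) (@shear_measure _ c) _ _ mS bF.
have Doo : (leb2 D < +oo)%E by rewrite /D shear_measure// mul1e slab_lty.
pose f := (F \o shear c) \_ D.
have intD : leb2.-integrable D (EFin \o (F \o shear c)).
  exact: ess_bounded_integrable.
have intf : leb2.-integrable setT (EFin \o f).
  exact: integrable_restrict_EFin.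
have EF : \int[leb2]_(z in slab t1 t2 L) F z = \int[leb2]_(z in setT) f z.
  rewrite -Rintegral_mkcond -[LHS]mul1r.
  rewrite -(@scaled_Rintegral _ _ _ _ _ leb2 leb2 1 (shear c))//.
  - exact: measurable_shear.
  - exact: shear_measure.
  - exact: ess_bounded_slab_integrable.
pose G eta := (\int[leb]_s (f (s, eta))%:E)%E.
have GE eta : G eta = (\int[leb]_(s in line c L t1 t2 eta) (F (s, eta + c * s))%:E)%E.
  rewrite [RHS]integral_mkcond; apply: eq_integral => s _.
  rewrite /f /patch /=; have -> // : ((s, eta) \in D) = (s \in line c L t1 t2 eta).
    by apply/idP/idP; rewrite !inE.
  by case: ifPn.
have mG : measurable_fun setT G by exact: (measurable_fubini_G intf).
have bnd : \forall eta \ae leb, eta \in `[0 - c * t2, L - c * t1] ->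
    `|line_integral t1 t2 F eta| <= `|K| * (t2 - t1).
  apply: (ae_imp _ HK) => y [me Ke] etaJ.
  have [h1 h2 h3 _ _] := entry_exit t12 etaJ.
  rewrite lineE in me Ke; apply: (@le_trans _ _ (`|K| * (exit_time t2 y - entry_time t1 y))); last first.
    by rewrite ler_wpM2l//; lra.
  apply: Rintegral_itv_le => //.
  by apply: (ae_imp _ Ke) => r h rI; rewrite (le_trans (h rI))// ler_norm.
have LE y : line_integral t1 t2 F y = fine (G y) by rewrite GE lineE.
have bL : ess_bounded leb `[0 - c * t2, L - c * t1] (line_integral t1 t2 F).
  split; last by exists (`|K| * (t2 - t1)).
  rewrite (_ : line_integral _ _ _ = fine \o G); last exact/funext.
  by apply: measurable_funTS; apply: measurableT_comp.
split => //; rewrite EF /Rintegral; congr fine.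
rewrite -integral21_prod_meas1// -/(fubini_G leb _).
rewrite [RHS]integral_mkcond; apply: ae_eq_integral => //.
  apply/(measurable_restrictT _ _).1 => //.
  by apply/measurable_EFinP; exact: bL.1.
apply: (ae_imp _ HK) => y [me Ke] _.
rewrite /fubini_G -/(G y) /patch; case: ifPn => [|etaJ]; last first.
  by rewrite GE line_empty ?integral_set0//; apply: contra etaJ => yJ; rewrite inE.
rewrite inE/= => etaJ; rewrite LE fineK// GE lineE.
rewrite lineE in me Ke; apply: integrable_fin_num => //.
apply: (@ess_bounded_itv_integrable R _ _ (fun s => F (s, y + c * s))).
by split => //; exists K.
Qed.

End EnergyOnLines.

(** * Energy along the characteristics of one edge *)

Section EdgeEnergy.
Context {R : realType}.
Local Notation leb := (@lebesgue_measure R).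
Local Notation leb2 := (leb \x leb)%E.
Variables (c L T : R) (p g : R -> R -> R).
Hypotheses (c_gt0 : 0 < c) (L_gt0 : 0 < L) (T_gt0 : 0 < T).
Hypothesis bp : ess_bounded leb2 (slab 0 T L) (uncur p).
Hypothesis bg : ess_bounded leb2 (slab 0 T L) (uncur g).
Hypothesis trp : transported c L T p g.
Variables t1 t2 : R.
Hypotheses (t10 : 0 <= t1) (t12 : t1 <= t2) (t2T : t2 <= T).

Let hyps : [/\ 0 <= t1, t1 <= t2, t2 <= T, 0 < c & 0 < L]. Proof. by []. Qed.

Let J := `[0 - c * t2, L - c * t1].
Let entry eta := p (entry_time c t1 eta) (eta + c * entry_time c t1 eta).
Let exit eta := p (exit_time c L t2 eta) (eta + c * exit_time c L t2 eta).

Let ess_bounded_sub F : ess_bounded leb2 (slab 0 T L) F -> ess_bounded leb2 (slab t1 t2 L) F.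
Proof. by apply: ess_boundedS; [exact: measurable_slab|exact: slabS]. Qed.

Let measurable_at (tau : R -> R) : measurable_fun setT tau ->
  (forall eta, eta \in J -> slab 0 T L (tau eta, eta + c * tau eta)) ->
  measurable_fun [set` J] (fun eta => p (tau eta) (eta + c * tau eta)).
Proof.
move=> mtau sub.
apply: (@measurable_comp _ _ _ _ _ _ (slab 0 T L) (uncur p) _ (fun eta => (tau eta, eta + c * tau eta))) => //.
- exact: measurable_slab.
- by move=> ? [eta etaJ <-]; exact: sub.
- exact: bp.1.
- apply: measurable_funTS; apply: measurable_fun_pair => //.
  by apply: measurable_funD => //; exact: measurable_funM.
Qed.

Let measurable_entry_time : measurable_fun setT (entry_time c t1).
Proof.
apply: measurable_maxr => //; apply: measurable_funM => //; exact: measurable_funB.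
Qed.

Let measurable_exit_time : measurable_fun setT (exit_time c L t2).
Proof.
apply: measurable_minr => //; apply: measurable_funM => //; exact: measurable_funB.
Qed.

Let entry_slab eta : eta \in J -> slab 0 T L (entry_time c t1 eta, eta + c * entry_time c t1 eta).
Proof.
have [? ? ? ? ?] := hyps.
move=> /(entry_exit c_gt0 L_gt0 t12) [h1 h2 h3 h4 h5]; split; rewrite /= in_itv/=.
  by apply/andP; split; lra.
rewrite h4/= (le_trans _ h5)// lerD2l ler_pM2l//.
Qed.

Let exit_slab eta : eta \in J -> slab 0 T L (exit_time c L t2 eta, eta + c * exit_time c L t2 eta).
Proof.
have [? ? ? ? ?] := hyps.
move=> /(entry_exit c_gt0 L_gt0 t12) [h1 h2 h3 h4 h5]; split; rewrite /= in_itv/=.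
  by apply/andP; split; lra.
rewrite h5 andbT (le_trans h4)// lerD2l ler_pM2l//.
Qed.

Let ess_bounded_entry : ess_bounded leb [set` J] entry.
Proof.
split; first exact: measurable_at.
have [K HK] := line_bounded c_gt0 L_gt0 T_gt0 bp bg trp; exists K.
by apply: (ae_imp _ HK) => y Hy /entry_slab; exact: Hy.
Qed.

Let ess_bounded_exit : ess_bounded leb [set` J] exit.
Proof.
split; first exact: measurable_at.
have [K HK] := line_bounded c_gt0 L_gt0 T_gt0 bp bg trp; exists K.
by apply: (ae_imp _ HK) => y Hy /exit_slab; exact: Hy.
Qed.

Let bpg : ess_bounded leb2 (slab t1 t2 L) (fun z => uncur p z * uncur g z).
Proof. by apply: ess_bounded_sub; exact: ess_boundedM. Qed.

Let bgg : ess_bounded leb2 (slab t1 t2 L) (fun z => uncur g z ^+ 2).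
Proof. by apply: ess_bounded_sub; exact: ess_boundedX. Qed.

(** The first relation is the energy balance on a line. The other two compare the end values in both
    directions, by [(u + v) ^+ 2 <= 2 * u ^+ 2 + 2 * v ^+ 2] and Cauchy-Schwarz for the integral of
    the source; they serve for observation. *)
Let along_lines : \forall eta \ae leb, eta \in J ->
  [/\ exit eta ^+ 2 = entry eta ^+ 2
        - 2 * line_integral c L t1 t2 (fun z => uncur p z * uncur g z) eta,
      exit eta ^+ 2 <= 2 * entry eta ^+ 2
        + 2 * (t2 - t1) * line_integral c L t1 t2 (fun z => uncur g z ^+ 2) eta &
      entry eta ^+ 2 <= 2 * exit eta ^+ 2
        + 2 * (t2 - t1) * line_integral c L t1 t2 (fun z => uncur g z ^+ 2) eta].
Proof.
have [? ? ? ? ?] := hyps.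
have [Kg Hg] := ess_bounded_line c bg; have [Kp Hp] := ess_bounded_line c bp.
apply: (ae_imp2 _ (ae_imp2 (fun _ x y => conj x y) Hg Hp) trp) => y [[mg gK] [mp _]] tr yJ.
have [h1 h2 h3 h4 h5] := entry_exit c_gt0 L_gt0 t12 yJ.
rewrite /exit /entry /line_integral /uncur/=.
set a := entry_time c t1 y in h1 h2 h4 *; set b := exit_time c L t2 y in h2 h3 h5 *.
have sub : `[a, b]%classic `<=` line c L 0 T y.
  by apply: itv_line => //; lra.
have mgab : measurable_fun `[a, b] (fun s => g s (y + c * s)).
  exact: (measurable_funS (measurable_line c L 0 T y) sub mg).
have mpab : measurable_fun `[a, b] (fun s => p s (y + c * s)).
  exact: (measurable_funS (measurable_line c L 0 T y) sub mp).
have gKab : \forall r \ae leb, r \in `[a, b] -> `|g r (y + c * r)| <= Kg.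
  by apply: (ae_imp _ gK) => r + rab => /(_ (sub _ rab)).
have trab s t : a <= s -> s <= t -> t <= b ->
    p t (y + c * t) = p s (y + c * s) - \int[leb]_(r in `[s, t]) g r (y + c * r).
  move=> as_ st tb; have cas : c * a <= c * s by rewrite ler_pM2l.
  have ctb : c * t <= c * b by rewrite ler_pM2l.
  by apply: tr => //; lra.
have E1 := mild_square h2 mpab mgab gKab trab.
have E2 := trab a b (lexx _) h2 (lexx _).
have bgab : ess_bounded leb `[a, b] (fun s => g s (y + c * s)) by split => //; exists Kg.
have := Rintegral_itv_sqr h2 bgab.
have Q0 : 0 <= \int[leb]_(r in `[a, b]) (g r (y + c * r) ^+ 2).
  by apply: Rintegral_ge0 => r _; exact: sqr_ge0.
move: E1 E2 Q0; set G := \int[leb]_(r in _) g _ _; set Q := \int[leb]_(r in _) _ ^+ 2.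
set P := \int[leb]_(r in _) _; move: (p b _) (p a _) => u v E1 E2 Q0 GQ.
have GQ' : G ^+ 2 <= (t2 - t1) * Q.
  by apply: (le_trans GQ); rewrite ler_wpM2r//; lra.
split => //.
- have -> : u = v - G by [].
  have := sqr_ge0 (v + G); lra.
- have -> : v = u + G by rewrite E2; ring.
  have := sqr_ge0 (u - G); lra.
Qed.

Let I1 f : ess_bounded leb [set` J] f -> leb.-integrable [set` J] (EFin \o f).
Proof. exact: ess_bounded_itv_integrable. Qed.

Let c_neq0 : c != 0. Proof. by rewrite gt_eqF. Qed.

Let section_at t : t \in `[0, T] -> ess_bounded leb `[0, L] (fun x => p t x ^+ 2).
Proof. move=> tT; apply: ess_boundedX; exact: (ess_bounded_section c_gt0 L_gt0 T_gt0 bp bg trp). Qed.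

Let trace_at x : x \in `[0, L] -> ess_bounded leb `[0, T] (fun t => p t x ^+ 2).
Proof.
move=> xL.
exact: (ess_boundedX 2 (ess_bounded_trace c_gt0 L_gt0 T_gt0 bp bg trp xL)).
Qed.

Let trace_int x a b : x \in `[0, L] -> 0 <= a -> b <= T ->
  leb.-integrable `[a, b] (EFin \o (fun t => p t x ^+ 2)).
Proof.
move=> xL a0 bT; apply: (integrable_itvS a0 bT); apply: ess_bounded_itv_integrable; exact: trace_at.
Qed.

(** These labels belong to the lines that are still inside the edge at time [t2]. *)
Let exit_section : \int[leb]_(eta in `[0 - c * t2, L - c * t2]) (exit eta ^+ 2) =
  \int[leb]_(x in `[0, L]) (p t2 x ^+ 2).
Proof.
have [? ? ? ? ?] := hyps.
transitivity (\int[leb]_(eta in `[0 - c * t2, L - c * t2]) (p t2 (eta + c * t2) ^+ 2)).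
  apply: eq_Rintegral => y; rewrite inE/= in_itv/= => /andP[_ y2].
  rewrite /exit (_ : exit_time c L t2 y = t2)//.
  by apply/min_idPl; rewrite ler_pdivlMr//; lra.
rewrite (@Rintegral_shift _ (c * t2) _ _ (fun x => p t2 x ^+ 2)) !subrK//.
by apply: ess_bounded_itv_integrable; apply: section_at; rewrite in_itv/=; apply/andP; split; lra.
Qed.

Let entry_section : \int[leb]_(eta in `[0 - c * t1, L - c * t1]) (entry eta ^+ 2) =
  \int[leb]_(x in `[0, L]) (p t1 x ^+ 2).
Proof.
have [? ? ? ? ?] := hyps.
transitivity (\int[leb]_(eta in `[0 - c * t1, L - c * t1]) (p t1 (eta + c * t1) ^+ 2)).
  apply: eq_Rintegral => y; rewrite inE/= in_itv/= => /andP[y1 _].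
  rewrite /entry (_ : entry_time c t1 y = t1)//.
  by apply/max_idPl; rewrite ler_pdivrMr//; lra.
rewrite (@Rintegral_shift _ (c * t1) _ _ (fun x => p t1 x ^+ 2)) !subrK//.
by apply: ess_bounded_itv_integrable; apply: section_at; rewrite in_itv/=; apply/andP; split; lra.
Qed.

(* On [L - c s2, L - c s1] the characteristics leave through x = L. *)
Let exit_trace_integral s1 s2 : t1 <= s1 -> s2 <= t2 ->
  \int[leb]_(eta in `[L - c * s2, L - c * s1]) (exit eta ^+ 2) =
  c * \int[leb]_(t in `[s1, s2]) (p t L ^+ 2).
Proof.
have [? ? ? ? ?] := hyps.
move=> ts st.
transitivity (\int[leb]_(eta in `[L - c * s2, L - c * s1]) (p ((L - eta) / c) L ^+ 2)).
  apply: eq_Rintegral => y; rewrite inE/= in_itv/= => /andP[y1 y2].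
  have cs : c * s2 <= c * t2 by rewrite ler_pM2l.
  rewrite /exit (_ : exit_time c L t2 y = (L - y) / c)//.
    by congr (p _ _ ^+ 2); field.
  by apply/min_idPr; rewrite ler_pdivrMr//; lra.
have E s : (L - (L - c * s)) / c = s by field.
rewrite (@Rintegral_reflect _ c L _ _ (fun t => p t L ^+ 2))// !E//.
apply: trace_int; first by rewrite in_itv/= lexx ltW.
- exact: le_trans ts.
- exact: le_trans t2T.
Qed.

Let entry_trace_integral s1 s2 : t1 <= s1 -> s2 <= t2 ->
  \int[leb]_(eta in `[0 - c * s2, 0 - c * s1]) (entry eta ^+ 2) =
  c * \int[leb]_(t in `[s1, s2]) (p t 0 ^+ 2).
Proof.
have [? ? ? ? ?] := hyps.
move=> ts st.
transitivity (\int[leb]_(eta in `[0 - c * s2, 0 - c * s1]) (p ((0 - eta) / c) 0 ^+ 2)).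
  apply: eq_Rintegral => y; rewrite inE/= in_itv/= => /andP[y1 y2].
  have cs : c * t1 <= c * s1 by rewrite ler_pM2l.
  rewrite /entry (_ : entry_time c t1 y = (0 - y) / c)//.
    by congr (p _ _ ^+ 2); field.
  by apply/max_idPr; rewrite ler_pdivlMr//; lra.
have E s : (0 - (0 - c * s)) / c = s by field.
rewrite (@Rintegral_reflect _ c 0 _ _ (fun t => p t 0 ^+ 2))// !E//.
apply: trace_int; first by rewrite in_itv/= lexx ltW.
- exact: le_trans ts.
- exact: le_trans t2T.
Qed.

(** The balance on lines, integrated over the labels. Cutting the label interval at [L - c * t2]
    separates the lines that end at [t2] from those that leave through [L]; cutting it at [- c * t1]
    separates those present at [t1] from those that enter through 0. The factor [c] is the Jacobian
    between labels and times of passage. *)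
Lemma edge_energy_identity :
  \int[leb]_(x in `[0, L]) (p t2 x ^+ 2) + c * \int[leb]_(t in `[t1, t2]) (p t L ^+ 2)
  = \int[leb]_(x in `[0, L]) (p t1 x ^+ 2) + c * \int[leb]_(t in `[t1, t2]) (p t 0 ^+ 2)
    - 2 * \int[leb2]_(z in slab t1 t2 L) (uncur p z * uncur g z).
Proof.
have [? ? ? ? ?] := hyps.
have [bl ->] := fubini_lines c_gt0 L_gt0 t12 bpg.
have b2exit : ess_bounded leb [set` J] (fun eta => exit eta ^+ 2) by exact: ess_boundedX.
have b2entry : ess_bounded leb [set` J] (fun eta => entry eta ^+ 2) by exact: ess_boundedX.
have bl2 : ess_bounded leb [set` J]
   (fun eta => 2 * line_integral c L t1 t2 (fun z => uncur p z * uncur g z) eta).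
  by apply: ess_boundedM => //; exact: ess_bounded_cst.
have : \int[leb]_(eta in [set` J]) (exit eta ^+ 2) = \int[leb]_(eta in [set` J])
   (entry eta ^+ 2 - 2 * line_integral c L t1 t2 (fun z => uncur p z * uncur g z) eta).
  apply: ae_eq_Rintegral => //; first exact: b2exit.1.
    by apply: (ess_boundedB b2entry bl2).1.
  by apply: (ae_imp _ along_lines) => y + yJ => /(_ yJ) [].
rewrite RintegralB//; [|exact: I1|exact: I1].
rewrite RintegralZl//; last exact: I1.
have ct12 : c * t1 <= c * t2 by rewrite ler_pM2l.
have [J1 J2] : 0 - c * t2 <= L - c * t2 /\ L - c * t2 <= L - c * t1 by split; lra.
have [J3 J4] : 0 - c * t2 <= 0 - c * t1 /\ 0 - c * t1 <= L - c * t1 by split; lra.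
rewrite /J (Rintegral_itv_split J1 J2); last exact: I1.
rewrite exit_section exit_trace_integral//.
rewrite (Rintegral_itv_split J3 J4); last exact: I1.
rewrite entry_section entry_trace_integral//.
set A := \int[leb]_(x in _) _; set B := \int[leb]_(x in _) _; lra.
Qed.

(** [X] and [E] are the values at the two ends of a line in either order, so that one argument
    covers both directions of observation. *)
Let bound_lines (E X : R -> R) u v : 0 - c * t2 <= u -> u <= v -> v <= L - c * t1 ->
  ess_bounded leb [set` J] X -> ess_bounded leb [set` J] E ->
  (\forall eta \ae leb, eta \in J -> X eta ^+ 2 <= 2 * E eta ^+ 2
        + 2 * (t2 - t1) * line_integral c L t1 t2 (fun z => uncur g z ^+ 2) eta) ->
  \int[leb]_(eta in `[u, v]) (X eta ^+ 2) <= 2 * \int[leb]_(eta in `[u, v]) (E eta ^+ 2)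
    + 2 * (t2 - t1) * \int[leb2]_(z in slab t1 t2 L) (uncur g z ^+ 2).
Proof.
have [? ? ? ? ?] := hyps.
move=> hu huv hv bX bE H.
have [bl ->] := fubini_lines c_gt0 L_gt0 t12 bgg.
set l := line_integral _ _ _ _ _ in bl H *.
have sub : `[u, v]%classic `<=` [set` J].
  move=> x; rewrite /J /= !in_itv/= => /andP[ux xv].
  by rewrite (le_trans hu ux) (le_trans xv hv).
have res f : ess_bounded leb [set` J] f -> ess_bounded leb `[u, v] f.
  exact: ess_boundedS.
have I f : ess_bounded leb `[u, v] f -> leb.-integrable `[u, v] (EFin \o f).
  exact: ess_bounded_itv_integrable.
have bE2 : ess_bounded leb `[u, v] (fun x => 2 * E x ^+ 2).
  by apply: ess_boundedM; [exact: ess_bounded_cst|apply: ess_boundedX; exact: res].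
have bl2 : ess_bounded leb `[u, v] (fun x => 2 * (t2 - t1) * l x).
  by apply: ess_boundedM; [exact: ess_bounded_cst|exact: res].
apply: (@le_trans _ _ (\int[leb]_(x in `[u, v]) (2 * E x ^+ 2 + 2 * (t2 - t1) * l x))).
  apply: ae_le_Rintegral => //; first by apply: I; apply: ess_boundedX; exact: res.
    by apply: I; exact: ess_boundedD.
  by apply: (ae_imp _ H) => y + yuv => /(_ (sub _ yuv)).
rewrite RintegralD//; [|exact: I|exact: I].
rewrite RintegralZl//; last by apply: I; apply: ess_boundedX; exact: res.
rewrite RintegralZl//; last by apply: I; exact: res.
rewrite lerD2l ler_wpM2l//; first by rewrite mulr_ge0// subr_ge0.
apply: le_Rintegral_itvS => //; last exact: I1.
by move=> x; apply: Rintegral_ge0 => r _; exact: sqr_ge0.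
Qed.

(** Crossing the edge takes the time [L / c], so every line inside the edge at [t2] has entered
    through 0 after [t2 - L / c], hence within the window. *)
Lemma observe_entry : L / c <= t2 - t1 ->
  \int[leb]_(x in `[0, L]) (p t2 x ^+ 2) <=
  2 * c * \int[leb]_(t in `[t1, t2]) (p t 0 ^+ 2)
  + 2 * (t2 - t1) * \int[leb2]_(z in slab t1 t2 L) (uncur g z ^+ 2).
Proof.
have [? ? ? ? ?] := hyps.
move=> Lc; rewrite -exit_section.
have Lc' : L <= c * t2 - c * t1.
  by move: Lc; rewrite ler_pdivrMr//; lra.
apply: (le_trans (@bound_lines entry exit _ _ _ _ _ _ _ _)) => //; [lra|lra|by apply: (ae_imp _ along_lines) => y + yJ => /(_ yJ) []|].
rewrite lerD2r -mulrA ler_pM2l//.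
have -> : L - c * t2 = 0 - c * (t2 - L / c) by field.
have s1 : t1 <= t2 - L / c by lra.
have Lc0 : 0 < L / c by rewrite divr_gt0.
rewrite entry_trace_integral// ler_pM2l//.
apply: le_Rintegral_itvS => //; [lra|by move=> x; exact: sqr_ge0|].
by apply: trace_int => //; rewrite in_itv/= lexx ltW.
Qed.

(** Reversed in time: every line inside the edge at [t1] leaves through [L] before [t1 + L / c]. *)
Lemma observe_exit : L / c <= t2 - t1 ->
  \int[leb]_(x in `[0, L]) (p t1 x ^+ 2) <=
  2 * c * \int[leb]_(t in `[t1, t2]) (p t L ^+ 2)
  + 2 * (t2 - t1) * \int[leb2]_(z in slab t1 t2 L) (uncur g z ^+ 2).
Proof.
have [? ? ? ? ?] := hyps.
move=> Lc; rewrite -entry_section.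
have Lc' : L <= c * t2 - c * t1.
  by move: Lc; rewrite ler_pdivrMr//; lra.
apply: (le_trans (@bound_lines exit entry _ _ _ _ _ _ _ _)) => //; [lra|lra|by apply: (ae_imp _ along_lines) => y + yJ => /(_ yJ) []|].
rewrite lerD2r -mulrA ler_pM2l//.
have -> : 0 - c * t1 = L - c * (t1 + L / c) by field.
have s1 : t1 + L / c <= t2 by lra.
have Lc0 : 0 < L / c by rewrite divr_gt0.
rewrite exit_trace_integral// ler_pM2l//.
apply: le_Rintegral_itvS => //; [lra|by move=> x; exact: sqr_ge0|].
by apply: trace_int => //; rewrite in_itv/= lexx ltW.
Qed.

End EdgeEnergy.

(** * Reflection, time shift and difference of transported functions *)

Section TransportClosure.
Context {R : realType}.
Local Notation leb := (@lebesgue_measure R).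
Local Notation leb2 := (leb \x leb)%E.

Definition mirror (L : R) (z : R * R) : R * R := (z.1, L - z.2).

Lemma mirrorE L : mirror L = skew 0 (-1) 0 L.
Proof. by apply/funext => z; rewrite /mirror /skew; congr pair; ring. Qed.

Lemma mirror_slab L t1 t2 : mirror L @^-1` slab t1 t2 L = slab t1 t2 L.
Proof.
by apply/seteqP; split=> -[s x] [/= sT]; rewrite !in_itv/= => /andP[? ?];
  split => //=; rewrite in_itv/=; apply/andP; split; lra.
Qed.

Lemma measurable_mirror L D : measurable_fun D (mirror L).
Proof. by rewrite mirrorE; exact: measurable_skew. Qed.

Lemma mirror_measure L (A : set (R * R)) : measurable A ->
  leb2 (mirror L @^-1` A) = (1%:E * leb2 A)%E.
Proof. by move=> mA; rewrite mirrorE skew_measure ?oppr_eq0 ?oner_eq0// normrN normr1 invr1. Qed.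

Lemma ess_bounded_mirror L t1 t2 (F : R * R -> R) :
  ess_bounded leb2 (slab t1 t2 L) F -> ess_bounded leb2 (slab t1 t2 L) (F \o mirror L).
Proof.
move=> bF; rewrite -[X in ess_bounded _ X]mirror_slab.
apply: (@scaled_ess_bounded _ _ _ _ _ leb2 leb2 1 (mirror L)) => //.
- exact: measurable_mirror.
- exact: mirror_measure.
- exact: measurable_slab.
Qed.

Lemma Rintegral_mirror L t1 t2 (F : R * R -> R) :
  ess_bounded leb2 (slab t1 t2 L) F ->
  \int[leb2]_(z in slab t1 t2 L) F (mirror L z) = \int[leb2]_(z in slab t1 t2 L) F z.
Proof.
move=> bF; rewrite -[X in Rintegral _ X _ = _]mirror_slab -[RHS]mul1r.
apply: (@scaled_Rintegral _ _ _ _ _ leb2 leb2 1 (mirror L)) => //.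
- exact: measurable_mirror.
- exact: mirror_measure.
- exact: measurable_slab.
- exact: ess_bounded_slab_integrable.
Qed.

Lemma ess_bounded_shift L T h (F : R * R -> R) : 0 <= h ->
  ess_bounded leb2 (slab 0 T L) F ->
  ess_bounded leb2 (slab 0 (T - h) L) (fun z => F (z.1 + h, z.2)).
Proof.
move=> h0 bF.
have E : (fun z => F (z.1 + h, z.2)) = F \o skew h 1 0 0.
  by apply/funext => z; rewrite /skew /= mul0r !addr0 mul1r.
rewrite E; apply: (@ess_boundedS _ _ _ leb2 (skew h 1 0 0 @^-1` slab 0 T L)).
- rewrite -[X in measurable X]setTI.
  by apply: (@measurable_skew R h 1 0 0 setT) => //; exact: measurable_slab.
- move=> [s x] [/=]; rewrite !in_itv/= => /andP[? ?] xL; split => /=.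
    by rewrite in_itv/=; apply/andP; split; lra.
  by rewrite mul0r !addr0 mul1r in_itv.
apply: (@scaled_ess_bounded _ _ _ _ _ leb2 leb2 `|1|^-1) => //.
- exact: measurable_skew.
- by move=> A mA; apply: skew_measure; rewrite ?oner_eq0.
- exact: measurable_slab.
Qed.

Variables (c L : R).
Hypotheses (c_gt0 : 0 < c) (L_gt0 : 0 < L).

Let line_integrable T (g : R -> R -> R) : ess_bounded leb2 (slab 0 T L) (uncur g) ->
  \forall eta \ae leb, forall s t, 0 <= s -> t <= T -> 0 <= eta + c * s ->
    eta + c * t <= L -> leb.-integrable `[s, t] (EFin \o (fun r => g r (eta + c * r))).
Proof.
move=> bg; have [K HK] := ess_bounded_line c bg.
apply: (ae_imp _ HK) => y [mg gK] s t s0 tT h1 h2.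
have sub : `[s, t]%classic `<=` line c L 0 T y by exact: itv_line.
have bl : ess_bounded leb (line c L 0 T y) (fun r => g r (y + c * r)).
  by split => //; exists K.
apply: (ess_bounded_itv_integrable (f := fun r => g r (y + c * r))).
exact: (@ess_boundedS _ _ _ leb _ _ _ (measurable_line c L 0 T y) sub bl).
Qed.

Lemma transportedB T p1 g1 p2 g2 :
  ess_bounded leb2 (slab 0 T L) (uncur g1) -> ess_bounded leb2 (slab 0 T L) (uncur g2) ->
  transported c L T p1 g1 -> transported c L T p2 g2 ->
  transported c L T (fun t x => p1 t x - p2 t x) (fun t x => g1 t x - g2 t x).
Proof.
move=> b1 b2 tr1 tr2.
apply: (ae_imp2 _ (ae_imp2 (fun _ x y => conj x y) tr1 tr2)
  (ae_imp2 (fun _ x y => conj x y) (line_integrable b1) (line_integrable b2))).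
move=> y [H1 H2] [I1 I2] s t s0 st tT h1 h2.
rewrite RintegralB//; [|exact: I1|exact: I2].
by rewrite (H1 s t)// (H2 s t)//; ring.
Qed.

Lemma transported_shift T h p g : 0 <= h ->
  ess_bounded leb2 (slab 0 T L) (uncur g) -> transported c L T p g ->
  transported c L (T - h) (fun t => p (t + h)) (fun t => g (t + h)).
Proof.
move=> h0 bg tr.
(* After the time shift the line with label [y] is the former line with label [y - c * h]. *)
have := @ae_affine R 1 (- (c * h)) _ (oner_neq0 _)
  (ae_imp2 (fun _ x y => conj x y) tr (line_integrable bg)).
apply: ae_imp => y; rewrite mul1r => -[H I] s t s0 st tT h1 h2.
have E r : y - c * h + c * (r + h) = y + c * r by ring.
have := H (s + h) (t + h); rewrite !E => -> //; [|lra|lra|lra].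
congr (_ - _); rewrite -(@Rintegral_shift _ h s t (fun r => g r (y - c * h + c * r))).
  by apply: eq_Rintegral => r _; rewrite E.
by apply: I; rewrite ?E//; lra.
Qed.

(** Lines with a positive label start at [t = 0], those with a negative one at [x = 0]; subtracting
    the integrated equations at two times removes the starting value. The sign [k] is 1 for the plus
    component and [-1] for the reflected minus component. *)
Lemma mild_transported T k (p g : R -> R -> R) (ini : R -> R) : 0 < T ->
  ess_bounded leb2 (slab 0 T L) (uncur g) ->
  (\forall xi \ae leb, xi \in `]0, L[ ->
     forall s : R, 0 <= s -> s <= T -> xi + c * s <= L ->
     p s (xi + c * s) = ini xi - k * \int[leb]_(r in `[0, s]) g r (xi + c * r)) ->
  (\forall tau \ae leb, tau \in `]0, T[ ->
     forall s : R, 0 <= s -> tau + s <= T -> c * s <= L ->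
     p (tau + s) (c * s) = p tau 0 - k * \int[leb]_(r in `[0, s]) g (tau + r) (c * r)) ->
  transported c L T p (fun t x => k * g t x).
Proof.
move=> T0 bg H1 H2; have c0 : - c^-1 != 0 by rewrite oppr_eq0 invr_eq0 gt_eqF.
have cc : c != 0 by rewrite gt_eqF.
apply: (ae_imp2 _ (ae_imp2 (fun _ x y => conj x y) H1 (ae_affine 0 c0 H2))
  (ae_imp2 (fun _ x y => conj x y) (line_integrable bg) (ae_imp2 (fun _ x y => conj x y) (ae_neq 0)
  (ae_imp2 (fun _ x y => conj x y) (ae_neq L) (ae_neq (- (c * T))))))).
move=> y [{}H1 {}H2] [I [y0 [yL yT]]] s t s0 st tT h1 h2.
have cst : c * s <= c * t by rewrite ler_pM2l.
have cs0 : 0 <= c * s by rewrite mulr_ge0// ltW.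
have ctT : c * t <= c * T by rewrite ler_pM2l.
rewrite RintegralZl//; last exact: I.
have [ypos|yneg|y_eq0] := ltgtP 0 y; last by rewrite y_eq0 eqxx in y0.
  have yLlt : y < L by rewrite lt_neqAle yL/=; lra.
  have yin : y \in `]0, L[ by rewrite in_itv/= ypos yLlt.
  have I0t : leb.-integrable `[0, t] (EFin \o (fun r => g r (y + c * r))).
    by apply: I => //; rewrite mulr0 addr0 ltW.
  rewrite (H1 yin t)//; last by lra.
  rewrite (H1 yin s)//; [|lra|lra].
  by rewrite (Rintegral_itv_split s0 st I0t); ring.
(* The time at which the line with label [y < 0] enters through [x = 0]. *)
set tau := - c^-1 * y + 0 in H2.
have ctau : c * tau = - y by rewrite /tau; field.
have tau0 : 0 < tau by rewrite -(pmulr_rgt0 _ c_gt0) ctau; lra.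
have tauT : tau < T.
  rewrite -(ltr_pM2l c_gt0) ctau ltrNl lt_neqAle eq_sym yT/=; lra.
have taus : tau <= s by rewrite -(ler_pM2l c_gt0) ctau; lra.
have tauin : tau \in `]0, T[ by rewrite in_itv/= tau0 tauT.
have key r : tau <= r -> r <= t ->
    p r (y + c * r) = p tau 0 - k * \int[leb]_(q in `[tau, r]) g q (y + c * q).
  move=> tr rt; have crt : c * r <= c * t by rewrite ler_pM2l.
  have := H2 tauin (r - tau); rewrite subrKC.
  have -> : c * (r - tau) = y + c * r by rewrite mulrBr ctau; ring.
  move=> -> //; [|lra|lra|lra].
  congr (_ - k * _).
  have := @Rintegral_shift _ tau 0 (r - tau) (fun q => g q (y + c * q)).
  rewrite add0r subrK => <-.
    apply: eq_Rintegral => q _; congr g; first by rewrite addrC.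
    by rewrite mulrDr ctau; ring.
  by apply: I; rewrite ?ctau ?subrr//; lra.
rewrite key//; last by lra.
rewrite key//.
have Itt : leb.-integrable `[tau, t] (EFin \o (fun r => g r (y + c * r))).
  by apply: I; rewrite ?ctau ?subrr//; lra.
by rewrite (Rintegral_itv_split taus st Itt); ring.
Qed.

Lemma mild_solution_transported T (g : R -> R -> R) ini (w : pm (R -> R -> R)) : 0 < T ->
  ess_bounded leb2 (slab 0 T L) (uncur g) -> mild_solution c T L g ini w ->
  transported c L T (plus w) g /\
  transported c L T (fun t x => minus w t (L - x)) (fun t x => - g t (L - x)).
Proof.
move=> T0 bg [H1 H2 H3 H4]; split.
  have := @mild_transported T 1 (plus w) g (plus ini) T0 bg.
  rewrite (_ : (fun t x => 1 * g t x) = g); last first.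
    by apply/funext => t; apply/funext => x; rewrite mul1r.
  apply.
    apply: (ae_imp _ H1) => y + yL s s0 sT ys => /(_ yL s s0 sT ys) ->; ring.
  apply: (ae_imp _ H2) => y + yL s s0 sT ys => /(_ yL s s0 sT ys) ->; ring.
have := @mild_transported T (-1) (fun t x => minus w t (L - x)) (fun t x => g t (L - x))
  (fun x => minus ini (L - x)) T0 (ess_bounded_mirror bg).
rewrite (_ : (fun t x => -1 * g t (L - x)) = (fun t x => - g t (L - x))); last first.
  by apply/funext => t; apply/funext => x; rewrite mulN1r.
have n1 : (-1 : R) != 0 by rewrite oppr_eq0 oner_eq0.
apply.
  apply: (ae_imp _ (ae_affine L n1 H3)) => y + yL s s0 sT ys.
  have -> : -1 * y + L = L - y by ring.
  have yL' : L - y \in `]0, L[.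
    by move: yL; rewrite !in_itv/= => /andP[? ?]; apply/andP; split; lra.
  move=> /(_ yL' s s0 sT); rewrite (_ : L - y - c * s = L - (y + c * s)); last by ring.
  have ys' : 0 <= L - (y + c * s) by lra.
  move=> /(_ ys') ->; rewrite mulN1r opprK; congr (_ + _).
  by apply: eq_Rintegral => r _; congr g; ring.
apply: (ae_imp _ H4) => y + yT s s0 sT ys.
have ys' : 0 <= L - c * s by lra.
by move=> /(_ yT s s0 sT ys') ->; rewrite mulN1r opprK subr0.
Qed.

End TransportClosure.

Section FiniteSums.
Context d (X : measurableType d) (R : realType).
Variable mu : {measure set X -> \bar R}.

Lemma ess_bounded_sum (I : Type) (r : seq I) (P : pred I) (D : set X) (f : I -> X -> R) :
  (forall i, P i -> ess_bounded mu D (f i)) ->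
  ess_bounded mu D (fun x => \sum_(i <- r | P i) f i x).
Proof.
move=> bf; elim: r => [|i r IHr].
  rewrite (_ : (fun _ => _) = cst 0); first exact: ess_bounded_cst.
  by apply/funext => x; rewrite big_nil.
have [Pi|nPi] := boolP (P i); last first.
  by rewrite (_ : (fun _ => _) = (fun x => \sum_(j <- r | P j) f j x))//;
    apply/funext => x; rewrite big_cons (negbTE nPi).
rewrite (_ : (fun _ => _) = (fun x => f i x + \sum_(j <- r | P j) f j x)).
  by apply: ess_boundedD => //; exact: bf.
by apply/funext => x; rewrite big_cons Pi.
Qed.

Lemma Rintegral_sum (I : Type) (r : seq I) (P : pred I) (D : set X) (f : I -> X -> R) :
  measurable D -> (mu D < +oo)%E -> (forall i, P i -> ess_bounded mu D (f i)) ->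
  \int[mu]_(x in D) (\sum_(i <- r | P i) f i x) =
  \sum_(i <- r | P i) \int[mu]_(x in D) f i x.
Proof.
move=> mD Doo bf; elim: r => [|i r IHr].
  rewrite big_nil -[RHS](mul0r (fine (mu D))) -Rintegral_cst//.
  by apply: eq_Rintegral => x _; rewrite big_nil.
rewrite big_cons; case: ifPn => [Pi|nPi]; last first.
  by rewrite -IHr; apply: eq_Rintegral => x _; rewrite big_cons (negbTE nPi).
transitivity (\int[mu]_(x in D) (f i x + \sum_(j <- r | P j) f j x)).
  by apply: eq_Rintegral => x _; rewrite big_cons Pi.
rewrite RintegralD// ?IHr//; apply: ess_bounded_integrable => //; first exact: bf.
exact: ess_bounded_sum.
Qed.

End FiniteSums.

(** * Both components on one edge *)

Section EdgeSolutions.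
Context {R : realType}.
Local Notation leb := (@lebesgue_measure R).
Local Notation leb2 := (leb \x leb)%E.

Lemma fubini_slab t1 t2 L (F : R * R -> R) : 0 < L ->
  ess_bounded leb2 (slab t1 t2 L) F ->
  ess_bounded leb `[t1, t2] (fun t => \int[leb]_(x in `[0, L]) F (t, x)) /\
  \int[leb2]_(z in slab t1 t2 L) F z =
    \int[leb]_(t in `[t1, t2]) \int[leb]_(x in `[0, L]) F (t, x).
Proof.
move=> L0 bF; have mS := measurable_slab t1 t2 L.
have [mF [K FK]] := bF.
pose f := F \_ (slab t1 t2 L).
have intf : leb2.-integrable setT (EFin \o f).
  by apply: integrable_restrict_EFin => //; exact: ess_bounded_slab_integrable.
pose H t := (\int[leb]_x (f (t, x))%:E)%E.
have HE t : t \in `[t1, t2] -> H t = (\int[leb]_(x in `[0%R, L]) (F (t, x))%:E)%E.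
  move=> tI; rewrite [RHS]integral_mkcond; apply: eq_integral => x _.
  rewrite /f /patch /=; have -> : ((t, x) \in slab t1 t2 L) = (x \in `[0, L]%classic).
    by apply/idP/idP => [/set_mem[_ xL]|/set_mem xL]; rewrite inE.
  by case: ifPn.
have H0 t : t \notin `[t1, t2] -> H t = 0%E.
  move=> tI; apply: integral0_eq => x _.
  rewrite /f /patch /=; case: ifPn => //; rewrite inE => -[/= tI' _].
  by rewrite tI' in tI.
have mH : measurable_fun setT H by exact: (measurable_fubini_F intf).
have LE t : t \in `[t1, t2] -> \int[leb]_(x in `[0, L]) F (t, x) = fine (H t).
  by move=> tI; rewrite HE.
have bL : ess_bounded leb `[t1, t2] (fun t => \int[leb]_(x in `[0, L]) F (t, x)).
  split.
    apply: (@eq_measurable_fun _ _ _ _ _ (fine \o H)).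
      by move=> t; rewrite inE => tI; rewrite LE.
    by apply: measurable_funTS; apply: measurableT_comp.
  exists (K * (L - 0)); apply: (ae_imp _ (ae_xsection FK)) => t Ht tI.
  apply: Rintegral_itv_le => //; first exact: ltW.
    exact: (measurable_slab_l mF tI).
  by apply: (ae_imp _ Ht) => x + xI; apply; split.
split => //.
have -> : \int[leb2]_(z in slab t1 t2 L) F z = \int[leb2]_(z in setT) f z.
  by rewrite -Rintegral_mkcond.
rewrite /Rintegral; congr fine.
rewrite -integral12_prod_meas1// -/(fubini_F leb _).
rewrite [RHS]integral_mkcond; apply: ae_eq_integral => //.
  apply/(measurable_restrictT _ _).1 => //.
  by apply/measurable_EFinP; exact: bL.1.
apply: (ae_imp _ (ae_xsection FK)) => t Ht _.
rewrite /fubini_F -/(H t) /patch; case: ifPn => [|tI]; last first.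
  by rewrite H0//; apply: contra tI => yJ; rewrite inE.
rewrite inE/= => tI; rewrite HE// fineK//; apply: integrable_fin_num => //.
apply: (@ess_bounded_itv_integrable R _ _ (fun x => F (t, x))); split.
  exact: (measurable_slab_l mF tI).
by exists K; apply: (ae_imp _ Ht) => x + xI; apply; split.
Qed.

(** The minus component is kept in reflected form, in which it travels with speed [c] and has the
    source [- g]; each result on one transported function then applies to both components. *)
Record edge_solution (c L T : R) (w : pm (R -> R -> R)) (g : R -> R -> R) : Prop :=
  EdgeSolution {
  es_plus : ess_bounded leb2 (slab 0 T L) (uncur (plus w));
  es_minus : ess_bounded leb2 (slab 0 T L) (uncur (minus w));
  es_source : ess_bounded leb2 (slab 0 T L) (uncur g);
  es_transport_plus : transported c L T (plus w) g;
  es_transport_minus :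
    transported c L T (fun t x => minus w t (L - x)) (fun t x => - g t (L - x)) }.

Definition edge_energy (L : R) (w : pm (R -> R -> R)) (t : R) : R :=
  \int[leb]_(x in `[0, L]) (plus w t x ^+ 2) + \int[leb]_(x in `[0, L]) (minus w t x ^+ 2).

(** The argument of the friction law, and also the factor conjugate to the source: [g] acts with
    opposite signs on the two components, so the energy sees it through [g * gap]. *)
Definition gap (w : pm (R -> R -> R)) (z : R * R) : R := uncur (plus w) z - uncur (minus w) z.

Section OneEdge.
Variables (c L T : R) (w : pm (R -> R -> R)) (g : R -> R -> R).
Hypotheses (c_gt0 : 0 < c) (L_gt0 : 0 < L) (T_gt0 : 0 < T).
Hypothesis sol : edge_solution c L T w g.

Let L0 : (0 : R) \in `[0, L]. Proof. by rewrite in_itv/= lexx ltW. Qed.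
Let es_mirror_minus :
  ess_bounded leb2 (slab 0 T L) (uncur (fun t x => minus w t (L - x))).
Proof. exact: (ess_bounded_mirror (es_minus sol)). Qed.

Let es_mirror_source :
  ess_bounded leb2 (slab 0 T L) (uncur (fun t x => - g t (L - x))).
Proof. apply: ess_boundedN; exact: (ess_bounded_mirror (es_source sol)). Qed.

Lemma ess_bounded_plus_section t : t \in `[0, T] -> ess_bounded leb `[0, L] (plus w t).
Proof.
exact: (ess_bounded_section c_gt0 L_gt0 T_gt0 (es_plus sol) (es_source sol) (es_transport_plus sol)).
Qed.

Lemma ess_bounded_plus_trace x : x \in `[0, L] -> ess_bounded leb `[0, T] ((plus w)^~ x).
Proof.
exact: (ess_bounded_trace c_gt0 L_gt0 T_gt0 (es_plus sol) (es_source sol) (es_transport_plus sol)).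
Qed.

Lemma ess_bounded_minus_section t : t \in `[0, T] -> ess_bounded leb `[0, L] (minus w t).
Proof.
move=> tT.
have := ess_bounded_section c_gt0 L_gt0 T_gt0 es_mirror_minus es_mirror_source
  (es_transport_minus sol) tT.
have n1 : (-1 : R) != 0 by rewrite oppr_eq0 oner_eq0.
have E : (affine (-1) L @^-1` `[0, L]) = `[0, L]%classic.
  by apply/seteqP; split=> x; rewrite /affine /= !in_itv/= => /andP[? ?]; apply/andP; split; lra.
move/(@scaled_ess_bounded _ _ _ _ _ leb leb (`|-1|^-1) (affine (-1) L)
  (@measurable_affine _ _ _ _) (fun A mA => affine_measure L n1 mA) `[0, L] _).
rewrite E (_ : _ \o _ = minus w t); first by apply.
by apply/funext => x /=; rewrite /affine; congr (minus w t _); ring.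
Qed.

Lemma ess_bounded_minus_trace x : x \in `[0, L] -> ess_bounded leb `[0, T] ((minus w)^~ x).
Proof.
move=> xL; have xL' : L - x \in `[0, L].
  by move: xL; rewrite !in_itv/= => /andP[? ?]; apply/andP; split; lra.
have := ess_bounded_trace c_gt0 L_gt0 T_gt0 es_mirror_minus es_mirror_source
  (es_transport_minus sol) xL'.
by rewrite (_ : (fun _ => _) = (minus w)^~ x)//; apply/funext => t; rewrite subKr.
Qed.

Let Rintegral_mirror_itv t : t \in `[0, T] ->
  \int[leb]_(x in `[0, L]) (minus w t (L - x) ^+ 2) = \int[leb]_(x in `[0, L]) (minus w t x ^+ 2).
Proof.
move=> tT; have := @Rintegral_reflect R 1 L 0 L (fun x => minus w t x ^+ 2) ltr01.
rewrite subrr subr0 mul0r divr1 mul1r => <-; first by under [RHS]eq_Rintegral do rewrite divr1.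
exact: (ess_bounded_itv_integrable (ess_boundedX 2 (ess_bounded_minus_section tT))).
Qed.

Variables t1 t2 : R.
Hypotheses (t10 : 0 <= t1) (t12 : t1 <= t2) (t2T : t2 <= T).

Let sub F : ess_bounded leb2 (slab 0 T L) F -> ess_bounded leb2 (slab t1 t2 L) F.
Proof. by apply: ess_boundedS; [exact: measurable_slab|exact: slabS]. Qed.

Let t1T : t1 \in `[0, T]. Proof. by rewrite in_itv/= t10 (le_trans t12). Qed.
Let t2T' : t2 \in `[0, T]. Proof. by rewrite in_itv/= t2T (le_trans t10). Qed.

Lemma edge_balance :
  edge_energy L w t2 + c * (\int[leb]_(t in `[t1, t2]) (plus w t L ^+ 2) +
                            \int[leb]_(t in `[t1, t2]) (minus w t 0 ^+ 2))
  = edge_energy L w t1 + c * (\int[leb]_(t in `[t1, t2]) (plus w t 0 ^+ 2) +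
                            \int[leb]_(t in `[t1, t2]) (minus w t L ^+ 2))
    - 2 * \int[leb2]_(z in slab t1 t2 L) (uncur g z * gap w z).
Proof.
have E1 := edge_energy_identity c_gt0 L_gt0 T_gt0 (es_plus sol) (es_source sol)
  (es_transport_plus sol) t10 t12 t2T.
have E2 := edge_energy_identity c_gt0 L_gt0 T_gt0 es_mirror_minus es_mirror_source
  (es_transport_minus sol) t10 t12 t2T.
rewrite !Rintegral_mirror_itv// subrr subr0 in E2.
have bmg : ess_bounded leb2 (slab t1 t2 L) (fun z => uncur (minus w) z * uncur g z).
  by apply: sub; apply: ess_boundedM; [exact: es_minus sol|exact: es_source sol].
have bpg : ess_bounded leb2 (slab t1 t2 L) (fun z => uncur (plus w) z * uncur g z).
  by apply: sub; apply: ess_boundedM; [exact: es_plus sol|exact: es_source sol].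
have E3 : \int[leb2]_(z in slab t1 t2 L)
    (uncur (fun t x => minus w t (L - x)) z * uncur (fun t x => - g t (L - x)) z) =
   - \int[leb2]_(z in slab t1 t2 L) (uncur (minus w) z * uncur g z).
  rewrite -mulN1r -(Rintegral_mirror bmg) -RintegralZl//.
  - by apply: eq_Rintegral => z _; rewrite mulN1r -mulrN.
  - exact: measurable_slab.
  - exact: (ess_bounded_slab_integrable (ess_bounded_mirror bmg)).
rewrite E3 in E2.
have -> : \int[leb2]_(z in slab t1 t2 L) (uncur g z * gap w z) =
   \int[leb2]_(z in slab t1 t2 L) (uncur (plus w) z * uncur g z) -
   \int[leb2]_(z in slab t1 t2 L) (uncur (minus w) z * uncur g z).
  rewrite -RintegralB//.
  - by apply: eq_Rintegral => z _; rewrite /gap; ring.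
  - exact: measurable_slab.
  - exact: ess_bounded_slab_integrable.
  - exact: ess_bounded_slab_integrable.
rewrite /edge_energy; move: E1 E2.
move: (\int[leb]_(x in _) _) => a1; move: (\int[leb]_(x in _) _) => a2.
move: (\int[leb]_(x in _) _) => a3; move: (\int[leb]_(x in _) _) => a4.
move: (\int[leb2]_(x in _) _) => a5 E1.
move: (\int[leb]_(x in _) _) => a6; move: (\int[leb]_(x in _) _) => a7.
move: (\int[leb]_(x in _) _) => a8; move: (\int[leb]_(x in _) _) => a9.
move: (\int[leb2]_(x in _) _) => a10 E2.
lra.
Qed.

Lemma observe_plus_entry : L / c <= t2 - t1 ->
  \int[leb]_(x in `[0, L]) (plus w t2 x ^+ 2) <=
  2 * c * \int[leb]_(t in `[t1, t2]) (plus w t 0 ^+ 2)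
  + 2 * (t2 - t1) * \int[leb2]_(z in slab t1 t2 L) (uncur g z ^+ 2).
Proof.
exact: (observe_entry c_gt0 L_gt0 T_gt0 (es_plus sol) (es_source sol) (es_transport_plus sol)).
Qed.

Lemma observe_plus_exit : L / c <= t2 - t1 ->
  \int[leb]_(x in `[0, L]) (plus w t1 x ^+ 2) <=
  2 * c * \int[leb]_(t in `[t1, t2]) (plus w t L ^+ 2)
  + 2 * (t2 - t1) * \int[leb2]_(z in slab t1 t2 L) (uncur g z ^+ 2).
Proof.
exact: (observe_exit c_gt0 L_gt0 T_gt0 (es_plus sol) (es_source sol) (es_transport_plus sol)).
Qed.

Let mirror_source_sqr :
  \int[leb2]_(z in slab t1 t2 L) (uncur (fun t x => - g t (L - x)) z ^+ 2) =
  \int[leb2]_(z in slab t1 t2 L) (uncur g z ^+ 2).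
Proof.
rewrite -(@Rintegral_mirror _ L t1 t2 (fun z => uncur g z ^+ 2)).
  by apply: eq_Rintegral => z _; rewrite /uncur /= sqrrN.
by apply: sub; apply: ess_boundedX; exact: es_source sol.
Qed.

Lemma observe_minus_entry : L / c <= t2 - t1 ->
  \int[leb]_(x in `[0, L]) (minus w t2 x ^+ 2) <=
  2 * c * \int[leb]_(t in `[t1, t2]) (minus w t L ^+ 2)
  + 2 * (t2 - t1) * \int[leb2]_(z in slab t1 t2 L) (uncur g z ^+ 2).
Proof.
move=> Lc; have := observe_entry c_gt0 L_gt0 T_gt0 es_mirror_minus es_mirror_source
  (es_transport_minus sol) t10 t12 t2T Lc.
by rewrite mirror_source_sqr Rintegral_mirror_itv// subr0.
Qed.

Lemma observe_minus_exit : L / c <= t2 - t1 ->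
  \int[leb]_(x in `[0, L]) (minus w t1 x ^+ 2) <=
  2 * c * \int[leb]_(t in `[t1, t2]) (minus w t 0 ^+ 2)
  + 2 * (t2 - t1) * \int[leb2]_(z in slab t1 t2 L) (uncur g z ^+ 2).
Proof.
move=> Lc; have := observe_exit c_gt0 L_gt0 T_gt0 es_mirror_minus es_mirror_source
  (es_transport_minus sol) t10 t12 t2T Lc.
by rewrite mirror_source_sqr Rintegral_mirror_itv// subrr.
Qed.

End OneEdge.
End EdgeSolutions.

(** * Energy of the network *)

Section NetworkEnergy.
Context {R : realType} {V E : finType} (G : network R V E).
Local Notation leb := (@lebesgue_measure R).
Local Notation leb2 := (leb \x leb)%E.

(** Sums over nodes become sums over edges; the two ends of an edge are distinct nodes, so each edge
    is counted exactly twice. *)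
Lemma sum_incident (f : E -> V -> R) :
  \sum_v \sum_(e in E0 G v) f e v = \sum_e (f e (node0 G e) + f e (nodeL G e)).
Proof.
rewrite (exchange_big_dep xpredT)//=; apply: eq_bigr => e _.
rewrite (eq_bigl (fun v => v \in V0 G e)) => [|v]; last by rewrite inE.
rewrite /V0 big_setU1 ?inE ?node0_neq_nodeL//= big_set1//.
Qed.

Lemma trace_in_nodeL w e t : trace_in G w e (nodeL G e) t = plus (w e) t (len G e).
Proof. by rewrite /trace_in /xend eqxx. Qed.

Lemma trace_out_nodeL w e t : trace_out G w e (nodeL G e) t = minus (w e) t (len G e).
Proof. by rewrite /trace_out /xend eqxx. Qed.

Lemma trace_in_node0 w e t : trace_in G w e (node0 G e) t = minus (w e) t 0.
Proof. by rewrite /trace_in /xend (negbTE (node0_neq_nodeL G e)). Qed.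

Lemma trace_out_node0 w e t : trace_out G w e (node0 G e) t = plus (w e) t 0.
Proof. by rewrite /trace_out /xend (negbTE (node0_neq_nodeL G e)). Qed.

Variables (c : R) (mu : V -> R).
Hypotheses (c_gt0 : 0 < c) (mu_le1 : forall v, `|mu v| <= 1).
Hypothesis damping_node : forall e, exists2 v, e \in E0 G v & `|mu v| < 1.

Definition net_energy (w : E -> pm (R -> R -> R)) (t : R) : R :=
  \sum_e diam G e ^+ 2 * edge_energy (len G e) (w e) t.

(* [A] bounds the friction coefficient of the linearised source [g] and [F] its
   inhomogeneous part: for g = a (w_+ - w_-) + f with 0 <= a <= A / 2 and
   |f| <= F both inequalities of [ds_damping] hold. *)
Record damped_system (A T : R) (w : E -> pm (R -> R -> R)) (g : E -> R -> R -> R)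
    (F : E -> R * R -> R) : Prop := DampedSystem {
  ds_edge : forall e, edge_solution c (len G e) T (w e) (g e);
  ds_defect : forall e, ess_bounded leb2 (slab 0 T (len G e)) (F e);
  ds_damping : forall e, \forall z \ae leb2, slab 0 T (len G e) z ->
    let r := uncur (g e) z * gap (w e) z + `|F e z| * `|gap (w e) z| in
    0 <= r /\ uncur (g e) z ^+ 2 <= A * r + 2 * F e z ^+ 2;
  ds_node : \forall t \ae leb, t \in `]0, T[ -> forall v,
    \sum_(e in E0 G v) diam G e ^+ 2 * trace_out G w e v t ^+ 2 =
    mu v ^+ 2 * \sum_(e in E0 G v) diam G e ^+ 2 * trace_in G w e v t ^+ 2 }.

Definition defect_energy (F : E -> R * R -> R) (t1 t2 : R) : R :=
  \sum_e diam G e ^+ 2 * \int[leb2]_(z in slab t1 t2 (len G e)) (F e z ^+ 2).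

Let mu2_le1 v : 0 <= 1 - mu v ^+ 2.
Proof. by rewrite subr_ge0 -real_normK ?num_real// expr_le1. Qed.

Section Solution.
Variables (A T : R) (w : E -> pm (R -> R -> R)) (g : E -> R -> R -> R) (F : E -> R * R -> R).
Hypothesis T_gt0 : 0 < T.
Hypothesis A_ge0 : 0 <= A.
Hypothesis sys : damped_system A T w g F.

Let len0 e : (0 : R) \in `[0, len G e]. Proof. by rewrite in_itv/= lexx ltW ?len_gt0. Qed.
Let lenL e : len G e \in `[0, len G e]. Proof. by rewrite in_itv/= lexx ltW ?len_gt0. Qed.

(** At almost every time this is the incoming minus the outgoing flux, by [ds_node]; in terms of the
    incoming traces alone it is visibly nonnegative. *)
Let loss t := \sum_v (1 - mu v ^+ 2) *
  \sum_(e in E0 G v) diam G e ^+ 2 * trace_in G w e v t ^+ 2.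

Let ess_bounded_trace_in e v : ess_bounded leb `[0, T] (trace_in G w e v).
Proof.
have H x : x \in `[0, len G e] -> ess_bounded leb `[0, T] ((plus (w e))^~ x) /\
    ess_bounded leb `[0, T] ((minus (w e))^~ x).
  move=> xL; have Le := len_gt0 G e; split.
    exact: (ess_bounded_plus_trace c_gt0 Le T_gt0 (ds_edge sys e) xL).
  exact: (ess_bounded_minus_trace c_gt0 Le T_gt0 (ds_edge sys e) xL).
rewrite /trace_in /xend; case: ifPn => vL.
  exact: (H _ (lenL e)).1.
exact: (H _ (len0 e)).2.
Qed.

Let ess_bounded_trace_out e v : ess_bounded leb `[0, T] (trace_out G w e v).
Proof.
have H x : x \in `[0, len G e] -> ess_bounded leb `[0, T] ((plus (w e))^~ x) /\
    ess_bounded leb `[0, T] ((minus (w e))^~ x).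
  move=> xL; have Le := len_gt0 G e; split.
    exact: (ess_bounded_plus_trace c_gt0 Le T_gt0 (ds_edge sys e) xL).
  exact: (ess_bounded_minus_trace c_gt0 Le T_gt0 (ds_edge sys e) xL).
rewrite /trace_out /xend; case: ifPn => vL.
  exact: (H _ (lenL e)).2.
exact: (H _ (len0 e)).1.
Qed.

Let ess_bounded_loss : ess_bounded leb `[0, T] loss.
Proof.
apply: ess_bounded_sum => v _; apply: ess_boundedM; first exact: ess_bounded_cst.
apply: ess_bounded_sum => e _; apply: ess_boundedM; first exact: ess_bounded_cst.
exact: ess_boundedX.
Qed.

Let loss_ge0 t : 0 <= loss t.
Proof.
apply: sumr_ge0 => v _; rewrite mulr_ge0//; apply: sumr_ge0 => e _.
by rewrite mulr_ge0// sqr_ge0.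
Qed.

Let ess_bounded_gap e : ess_bounded leb2 (slab 0 T (len G e)) (gap (w e)).
Proof. by apply: ess_boundedB; [exact: es_plus (ds_edge sys e)|exact: es_minus (ds_edge sys e)]. Qed.

Section Window.
Variables t1 t2 : R.
Hypotheses (t10 : 0 <= t1) (t12 : t1 <= t2) (t2T : t2 <= T).

Let sub F' e : ess_bounded leb2 (slab 0 T (len G e)) F' -> ess_bounded leb2 (slab t1 t2 (len G e)) F'.
Proof. by apply: ess_boundedS; [exact: measurable_slab|exact: slabS]. Qed.

Let sub1 f : ess_bounded leb `[0, T] f -> ess_bounded leb `[t1, t2] f.
Proof.
apply: (@ess_boundedS _ _ _ leb) => //; move=> x /=; rewrite !in_itv/= => /andP[h1 h2].
by rewrite (le_trans t10 h1) (le_trans h2 t2T).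
Qed.

Let I2 F' e : ess_bounded leb2 (slab 0 T (len G e)) F' -> leb2.-integrable (slab t1 t2 (len G e)) (EFin \o F').
Proof. by move=> bF; apply: ess_bounded_slab_integrable; exact: sub. Qed.

Let I1 f : ess_bounded leb `[0, T] f -> leb.-integrable `[t1, t2] (EFin \o f).
Proof. by move=> bF; apply: ess_bounded_itv_integrable; exact: sub1. Qed.

Definition total_loss := \int[leb]_(t in `[t1, t2]) loss t.
(** The product [|F| * |gap|] makes the integrand nonnegative almost everywhere; [defect_work]
    compensates for it in the balance. *)
Definition dissipation := \sum_e diam G e ^+ 2 * \int[leb2]_(z in slab t1 t2 (len G e))
  (uncur (g e) z * gap (w e) z + `|F e z| * `|gap (w e) z|).
Definition defect_work := \sum_e diam G e ^+ 2 * \int[leb2]_(z in slab t1 t2 (len G e))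
  (`|F e z| * `|gap (w e) z|).

Let ae_window : \forall t \ae leb, t \in `[t1, t2] -> t \in `]0, T[.
Proof.
apply: (ae_imp2 _ (ae_neq 0) (ae_neq T)) => t t0 tT; rewrite !in_itv/= => /andP[h1 h2].
by rewrite !lt_neqAle eq_sym t0 tT (le_trans t10 h1) (le_trans h2 t2T).
Qed.

Let ess_bounded_work e : ess_bounded leb2 (slab 0 T (len G e)) (fun z => `|F e z| * `|gap (w e) z|).
Proof.
by apply: ess_boundedM; apply: ess_bounded_norm => //; exact: ds_defect sys e.
Qed.

Let ess_bounded_source_gap e : ess_bounded leb2 (slab 0 T (len G e)) (fun z => uncur (g e) z * gap (w e) z).
Proof. by apply: ess_boundedM => //; exact: es_source (ds_edge sys e). Qed.

(** The edge balances with weights [D ^+ 2], added up. Regrouped by nodes, their boundary terms form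
    the loss, since the node conditions turn the outgoing flux into [mu v ^+ 2] times the incoming
    one. *)
Lemma energy_balance :
  net_energy w t2 + c * total_loss + 2 * dissipation = net_energy w t1 + 2 * defect_work.
Proof.
pose inn e := \int[leb]_(t in `[t1, t2]) (plus (w e) t (len G e) ^+ 2) +
              \int[leb]_(t in `[t1, t2]) (minus (w e) t 0 ^+ 2).
pose out e := \int[leb]_(t in `[t1, t2]) (plus (w e) t 0 ^+ 2) +
              \int[leb]_(t in `[t1, t2]) (minus (w e) t (len G e) ^+ 2).
have HL : total_loss = \sum_e diam G e ^+ 2 * (inn e - out e).
  pose fl e t := diam G e ^+ 2 *
    ((trace_in G w e (nodeL G e) t ^+ 2 + trace_in G w e (node0 G e) t ^+ 2)
     - (trace_out G w e (node0 G e) t ^+ 2 + trace_out G w e (nodeL G e) t ^+ 2)).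
  have bin e v : ess_bounded leb `[0, T] (fun t => trace_in G w e v t ^+ 2) by exact: ess_boundedX.
  have bout e v : ess_bounded leb `[0, T] (fun t => trace_out G w e v t ^+ 2) by exact: ess_boundedX.
  have bfl e : ess_bounded leb `[0, T] (fl e).
    apply: ess_boundedM; first exact: ess_bounded_cst.
    by apply: ess_boundedB; apply: ess_boundedD.
  transitivity (\int[leb]_(t in `[t1, t2]) (\sum_e fl e t)).
    apply: ae_eq_Rintegral => //; first exact: (sub1 ess_bounded_loss).1.
      by apply: (sub1 (ess_bounded_sum _ _)).1 => e _; exact: bfl.
    apply: (ae_imp2 _ ae_window (ds_node sys)) => t tw + /tw t0T => /(_ t0T) nodes.
    rewrite /loss; under eq_bigr => v _ do rewrite mulrBl mul1r -nodes.
    rewrite sumrB (sum_incident (fun e v => diam G e ^+ 2 * trace_in G w e v t ^+ 2)).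
    rewrite (sum_incident (fun e v => diam G e ^+ 2 * trace_out G w e v t ^+ 2)) -sumrB.
    by apply: eq_bigr => e _; rewrite /fl; ring.
  rewrite Rintegral_sum//; [|exact: lebesgue_itv_lty|by move=> e _; exact: sub1].
  apply: eq_bigr => e _; rewrite /fl.
  rewrite RintegralZl//; last by apply: I1; apply: ess_boundedB; apply: ess_boundedD.
  congr (_ * _); rewrite RintegralB//; [|by apply: I1; exact: ess_boundedD|by apply: I1; exact: ess_boundedD].
  rewrite !RintegralD//; [|exact: I1|exact: I1|exact: I1|exact: I1].
  rewrite /inn /out; under eq_Rintegral do rewrite trace_in_nodeL.
  under [in X in _ + X - _]eq_Rintegral do rewrite trace_in_node0.
  under [in X in _ - (X + _)]eq_Rintegral do rewrite trace_out_node0.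
  by under [in X in _ - (_ + X)]eq_Rintegral do rewrite trace_out_nodeL.
have HP : dissipation = defect_work + \sum_e diam G e ^+ 2 *
    \int[leb2]_(z in slab t1 t2 (len G e)) (uncur (g e) z * gap (w e) z).
  rewrite /dissipation /defect_work -big_split/=; apply: eq_bigr => e _.
  rewrite RintegralD//; [by ring|exact: measurable_slab|exact: I2|exact: I2].
rewrite HL HP /net_energy.
have step e : edge_energy (len G e) (w e) t2 + c * (inn e - out e)
    + 2 * \int[leb2]_(z in slab t1 t2 (len G e)) (uncur (g e) z * gap (w e) z)
    = edge_energy (len G e) (w e) t1.
  have := edge_balance c_gt0 (len_gt0 G e) T_gt0 (ds_edge sys e) t10 t12 t2T.
  rewrite -/(inn e) -/(out e); lra.
suff -> : \sum_e diam G e ^+ 2 * edge_energy (len G e) (w e) t1 =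
    \sum_e diam G e ^+ 2 * edge_energy (len G e) (w e) t2 +
    c * (\sum_e diam G e ^+ 2 * (inn e - out e)) + 2 * (\sum_e diam G e ^+ 2 *
    \int[leb2]_(z in slab t1 t2 (len G e)) (uncur (g e) z * gap (w e) z)) by ring.
rewrite !mulr_sumr -!big_split/=; apply: eq_bigr => e _.
by rewrite -step; ring.
Qed.

Lemma total_loss_ge0 : 0 <= total_loss.
Proof. by apply: Rintegral_ge0 => t _; exact: loss_ge0. Qed.

Lemma defect_work_ge0 : 0 <= defect_work.
Proof.
apply: sumr_ge0 => e _; rewrite mulr_ge0 ?sqr_ge0//.
by apply: Rintegral_ge0 => z _; rewrite mulr_ge0.
Qed.

Let damping_window e : \forall z \ae leb2, slab t1 t2 (len G e) z ->
    let r := uncur (g e) z * gap (w e) z + `|F e z| * `|gap (w e) z| in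
    0 <= r /\ uncur (g e) z ^+ 2 <= A * r + 2 * F e z ^+ 2.
Proof. by apply: (ae_imp _ (ds_damping sys e)) => z + /(slabS t10 t2T). Qed.

Lemma dissipation_ge0 : 0 <= dissipation.
Proof.
apply: sumr_ge0 => e _; rewrite mulr_ge0 ?sqr_ge0//.
rewrite -(mul0r (fine (leb2 (slab t1 t2 (len G e))))) -Rintegral_cst; last exact: measurable_slab.
apply: ae_le_Rintegral.
- exact: measurable_slab.
- by apply: I2; exact: ess_bounded_cst.
- by apply: I2; exact: ess_boundedD.
- by apply: (ae_imp _ (damping_window e)) => z + zs => /(_ zs) [].
Qed.

(** The source terms that appear in the observation of an edge are absorbed by the dissipation, up
    to the defect. *)
Lemma source_energy : defect_energy (fun e => uncur (g e)) t1 t2 <=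
  A * dissipation + 2 * defect_energy F t1 t2.
Proof.
rewrite /defect_energy /dissipation !mulr_sumr -big_split/=.
apply: ler_sum => e _; rewrite !(mulrCA _ (diam G e ^+ 2)) -mulrDr ler_wpM2l ?sqr_ge0//.
have bF2 : ess_bounded leb2 (slab 0 T (len G e)) (fun z => F e z ^+ 2).
  by apply: ess_boundedX; exact: ds_defect sys e.
have br : ess_bounded leb2 (slab 0 T (len G e))
  (fun z => uncur (g e) z * gap (w e) z + `|F e z| * `|gap (w e) z|) by exact: ess_boundedD.
rewrite -!RintegralZl; [|exact: measurable_slab|exact: I2|exact: measurable_slab|exact: I2].
have b1 : ess_bounded leb2 (slab 0 T (len G e)) (fun z => 2 * F e z ^+ 2).
  by apply: ess_boundedM => //; exact: ess_bounded_cst.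
have b2 : ess_bounded leb2 (slab 0 T (len G e))
  (fun z => A * (uncur (g e) z * gap (w e) z + `|F e z| * `|gap (w e) z|)).
  by apply: ess_boundedM => //; exact: ess_bounded_cst.
rewrite -RintegralD; [|exact: measurable_slab|exact: I2|exact: I2].
apply: ae_le_Rintegral.
- exact: measurable_slab.
- by apply: I2; apply: ess_boundedX; exact: es_source (ds_edge sys e).
- by apply: I2; exact: ess_boundedD.
- by apply: (ae_imp _ (damping_window e)) => z + zs => /(_ zs) [].
Qed.

(** The node loses the fraction [1 - mu v ^+ 2] of the incoming flux and the outgoing flux does not
    exceed the incoming one, whence the factor 2. *)
Lemma node_loss e v : e \in E0 G v -> `|mu v| < 1 ->
  diam G e ^+ 2 * \int[leb]_(t in `[t1, t2]) (trace_in G w e v t ^+ 2 + trace_out G w e v t ^+ 2)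
    <= 2 / (1 - mu v ^+ 2) * total_loss.
Proof.
move=> ev muv; have muv2 : 0 < 1 - mu v ^+ 2.
  by rewrite subr_gt0 -real_normK ?num_real// expr_lt1.
have bb : ess_bounded leb `[0, T] (fun t => trace_in G w e v t ^+ 2 + trace_out G w e v t ^+ 2).
  by apply: ess_boundedD; exact: ess_boundedX.
rewrite -!RintegralZl//; [|exact: I1|exact: I1].
apply: ae_le_Rintegral => //.
- by apply: I1; apply: ess_boundedM => //; exact: ess_bounded_cst.
- by apply: I1; apply: ess_boundedM => //; exact: ess_bounded_cst.
- apply: (ae_imp2 _ ae_window (ds_node sys)) => t tw + /tw t0T => /(_ t0T v) node.
  set Q := \sum_(e in E0 G v) _ in node; set Q' := \sum_(e in E0 G v) _ in node.
  have Q'0 : 0 <= Q' by apply: sumr_ge0 => f _; rewrite mulr_ge0 ?sqr_ge0.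
  have single (f : E -> R) : diam G e ^+ 2 * f e ^+ 2 <= \sum_(e in E0 G v) diam G e ^+ 2 * f e ^+ 2.
    rewrite (bigD1 e)//= lerDl; apply: sumr_ge0 => e' _; by rewrite mulr_ge0 ?sqr_ge0.
  have h1 := single (fun e => trace_in G w e v t); have h2 := single (fun e => trace_out G w e v t).
  rewrite -/Q' in h1; rewrite -/Q node in h2.
  have h3 : (1 - mu v ^+ 2) * Q' <= loss t.
    rewrite /loss (bigD1 v)//= lerDl; apply: sumr_ge0 => v' _; rewrite mulr_ge0//.
    by apply: sumr_ge0 => f _; rewrite mulr_ge0 ?sqr_ge0.
  rewrite mulrDr (le_trans (lerD h1 h2))//.
  rewrite [leRHS]mulrAC ler_pdivlMr//.
  have := mulr_ge0 (sqr_ge0 (1 - mu v ^+ 2)) Q'0.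
  move: (mu v ^+ 2) h3 => m; move: (loss t) Q' {h1 h2 Q'0 node single Q} => l q h3 h4; lra.
Qed.

(** Young's inequality with weight [eps], followed by [gap ^+ 2 <= 2 * (w_+ ^+ 2 + w_- ^+ 2)]. The
    parameter decides how much of the defect work is charged to the energy. *)
Lemma work_le eps : 0 < eps ->
  2 * defect_work <= 2 * eps * (\sum_e diam G e ^+ 2 *
    \int[leb]_(t in `[t1, t2]) edge_energy (len G e) (w e) t) + defect_energy F t1 t2 / eps.
Proof.
move=> eps0; rewrite /defect_work /defect_energy !mulr_sumr mulr_suml -big_split/=.
apply: ler_sum => e _.
have bp := es_plus (ds_edge sys e); have bm := es_minus (ds_edge sys e).
have bF := ds_defect sys e.
have bw : ess_bounded leb2 (slab 0 T (len G e)) (fun z => uncur (plus (w e)) z ^+ 2 + uncur (minus (w e)) z ^+ 2).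
  by apply: ess_boundedD; exact: ess_boundedX.
have bF2 : ess_bounded leb2 (slab 0 T (len G e)) (fun z => F e z ^+ 2) by exact: ess_boundedX.
have -> : \int[leb]_(t in `[t1, t2]) edge_energy (len G e) (w e) t =
    \int[leb2]_(z in slab t1 t2 (len G e)) (uncur (plus (w e)) z ^+ 2 + uncur (minus (w e)) z ^+ 2).
  rewrite (fubini_slab (len_gt0 G e) (sub bw)).2; apply: eq_Rintegral => t; rewrite inE/= in_itv/= => /andP[h1 h2].
  have tT : t \in `[0, T] by rewrite in_itv/= (le_trans t10 h1) (le_trans h2 t2T).
  have Le := len_gt0 G e.
  rewrite /edge_energy -RintegralD//; apply: ess_bounded_itv_integrable; apply: ess_boundedX.
    exact: (ess_bounded_plus_section c_gt0 Le T_gt0 (ds_edge sys e) tT).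
  exact: (ess_bounded_minus_section c_gt0 Le T_gt0 (ds_edge sys e) tT).
set Y := \int[leb2]_(z in _) (_ + _); set Phi := \int[leb2]_(z in _) (_ ^+ 2).
set N := \int[leb2]_(z in _) _.
suff H : 2 * N <= 2 * eps * Y + eps^-1 * Phi.
  have := ler_wpM2l (sqr_ge0 (diam G e)) H; lra.
have cst k F' : ess_bounded leb2 (slab 0 T (len G e)) F' -> ess_bounded leb2 (slab 0 T (len G e)) (fun z => k * F' z).
  by move=> ?; apply: ess_boundedM => //; exact: ess_bounded_cst.
rewrite /N /Y /Phi.
rewrite -!RintegralZl; [|exact: measurable_slab|exact: I2|exact: measurable_slab|exact: I2|exact: measurable_slab|exact: I2].
rewrite -RintegralD; [|exact: measurable_slab|by apply: I2; exact: cst|by apply: I2; exact: cst].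
apply: le_Rintegral.
- exact: measurable_slab.
- by apply: I2; exact: cst.
- by apply: I2; apply: ess_boundedD; exact: cst.
- move=> z _.
  have -> : 2 * (`|F e z| * `|gap (w e) z|) = eps^-1 * (2 * (`|F e z| * (eps * `|gap (w e) z|))).
    by field; rewrite gt_eqF.
  have -> : 2 * eps * (uncur (plus (w e)) z ^+ 2 + uncur (minus (w e)) z ^+ 2) + eps^-1 * F e z ^+ 2
    = eps^-1 * (2 * eps ^+ 2 * (uncur (plus (w e)) z ^+ 2 + uncur (minus (w e)) z ^+ 2) + F e z ^+ 2).
    by field; rewrite gt_eqF.
  rewrite ler_pM2l ?invr_gt0//.
  have := sqr_ge0 (`|F e z| - eps * `|gap (w e) z|).
  rewrite sqrrB exprMn !real_normK ?num_real//.
  have : eps ^+ 2 * gap (w e) z ^+ 2 <= eps ^+ 2 * (2 * (uncur (plus (w e)) z ^+ 2 + uncur (minus (w e)) z ^+ 2)).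
    rewrite ler_wpM2l ?sqr_ge0// /gap.
    have := sqr_ge0 (uncur (plus (w e)) z + uncur (minus (w e)) z); lra.
  move: (eps ^+ 2 * gap _ _ ^+ 2) (`|F e z| * (eps * _)) => X Y'.
  rewrite mulr2n; lra.
Qed.

End Window.

Lemma defect_work_mono t1 t2 s1 s2 : 0 <= t1 -> t1 <= s1 -> s1 <= s2 -> s2 <= t2 -> t2 <= T ->
  defect_work s1 s2 <= defect_work t1 t2.
Proof.
move=> t10 ts st s2t t2T; apply: ler_sum => e _; rewrite ler_wpM2l ?sqr_ge0//.
apply: le_Rintegral_subset; [exact: measurable_slab|exact: measurable_slab|exact: slabS| | ].
  by move=> z; rewrite mulr_ge0.
apply: ess_bounded_slab_integrable.
apply: (@ess_boundedS _ _ _ leb2 (slab 0 T (len G e))); [exact: measurable_slab|exact: slabS|].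
apply: ess_boundedM; apply: ess_bounded_norm => //; exact: ds_defect sys e.
Qed.

Lemma energy_growth t1 t2 t : 0 <= t1 -> t1 <= t -> t <= t2 -> t2 <= T ->
  net_energy w t <= net_energy w t1 + 2 * defect_work t1 t2.
Proof.
move=> t10 tt t2t t2T; have tT := le_trans t2t t2T.
have := energy_balance t10 tt tT.
have := dissipation_ge0 t10 tT; have := total_loss_ge0 t1 t.
have := defect_work_mono t10 (lexx _) tt t2t t2T.
move=> h1 h2 h3; have := mulr_ge0 (ltW c_gt0) h2; lra.
Qed.

Lemma net_energy_ge0 t : 0 <= net_energy w t.
Proof.
apply: sumr_ge0 => e _; rewrite mulr_ge0 ?sqr_ge0// addr_ge0//;
  by apply: Rintegral_ge0 => x _; exact: sqr_ge0.
Qed.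

Lemma defect_energy_ge0 t1 t2 : 0 <= defect_energy F t1 t2.
Proof.
apply: sumr_ge0 => e _; rewrite mulr_ge0 ?sqr_ge0//.
by apply: Rintegral_ge0 => x _; exact: sqr_ge0.
Qed.

(** [energy_growth] bounds the energy inside the window by its initial value plus twice the defect
    work. Inserted into [work_le] this brings the defect work back on the right with the factor
    [8 * tau * eps <= 1], where half of the left side absorbs it. *)
Lemma window_work t1 t2 tau eps : 0 <= t1 -> t1 <= t2 -> t2 <= T -> t2 - t1 <= 2 * tau ->
  0 < eps -> 8 * tau * eps <= 1 ->
  2 * defect_work t1 t2 <= 8 * tau * eps * net_energy w t1 + 2 / eps * defect_energy F t1 t2.
Proof.
move=> t10 t12 t2T t2tau eps0 epstau.
have := work_le t10 t2T eps0.
set Y := \sum_e _ * _; set N := defect_work t1 t2; set Phi := defect_energy F t1 t2.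
have bE e : ess_bounded leb `[t1, t2] (fun t => edge_energy (len G e) (w e) t).
  have bw : ess_bounded leb2 (slab t1 t2 (len G e)) (fun z => uncur (plus (w e)) z ^+ 2 + uncur (minus (w e)) z ^+ 2).
    apply: (@ess_boundedS _ _ _ leb2 (slab 0 T (len G e))); [exact: measurable_slab|exact: slabS|].
    by apply: ess_boundedD; apply: ess_boundedX; [exact: es_plus (ds_edge sys e)|exact: es_minus (ds_edge sys e)].
  have [[mb [K bK]] _] := fubini_slab (len_gt0 G e) bw.
  have bE t : t \in `[t1, t2] -> \int[leb]_(x in `[0, len G e]) (uncur (plus (w e)) (t, x) ^+ 2 + uncur (minus (w e)) (t, x) ^+ 2) = edge_energy (len G e) (w e) t.
    rewrite in_itv/= => /andP[h1 h2].
    have tT : t \in `[0, T] by rewrite in_itv/= (le_trans t10 h1) (le_trans h2 t2T).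
    have Le := len_gt0 G e.
    rewrite /edge_energy -RintegralD//; apply: ess_bounded_itv_integrable; apply: ess_boundedX.
      exact: (ess_bounded_plus_section c_gt0 Le T_gt0 (ds_edge sys e) tT).
    exact: (ess_bounded_minus_section c_gt0 Le T_gt0 (ds_edge sys e) tT).
  split; first by apply: eq_measurable_fun mb => t; rewrite inE => /bE.
  by exists K; apply: (ae_imp _ bK) => t + tI => /(_ tI); rewrite bE.
have YE : Y = \int[leb]_(t in `[t1, t2]) net_energy w t.
  rewrite /net_energy Rintegral_sum//; last 2 first.
  - exact: lebesgue_itv_lty.
  - by move=> e _; apply: ess_boundedM => //; exact: ess_bounded_cst.
  by apply: eq_bigr => e _; rewrite RintegralZl//; exact: ess_bounded_itv_integrable.
have Yle : Y <= (net_energy w t1 + 2 * N) * (t2 - t1).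
  rewrite YE -(fine_lebesgue_itv t12) -Rintegral_cst//.
  apply: le_Rintegral => //.
  - apply: ess_bounded_itv_integrable; apply: ess_bounded_sum => e _.
    by apply: ess_boundedM => //; exact: ess_bounded_cst.
  - by apply: ess_bounded_itv_integrable; exact: ess_bounded_cst.
  - by move=> t /=; rewrite in_itv/= => /andP[h1 h2]; exact: energy_growth.
have N0 : 0 <= N by exact: defect_work_ge0.
have En0 := net_energy_ge0 t1.
have Phi0 : 0 <= Phi / eps by rewrite divr_ge0 ?defect_energy_ge0// ltW.
have Yle2 : Y <= (net_energy w t1 + 2 * N) * (2 * tau).
  by apply: (le_trans Yle); rewrite ler_wpM2l//; lra.
have : 2 * eps * Y <= 2 * eps * ((net_energy w t1 + 2 * N) * (2 * tau)).
  by rewrite ler_pM2l// mulr_gt0.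
have : 8 * tau * eps * N <= 1 * N by rewrite ler_wpM2r.
rewrite (_ : 2 / eps * Phi = 2 * (Phi / eps)); last by ring.
move: (net_energy w t1) (Phi / eps) => En X; lra.
Qed.

(** Twice the factor of [node_loss], the 2 coming from the observation of an edge. The sum over all
    edges and damping ends avoids choosing an end for each edge and taking a maximum. *)
Definition observability_constant : R :=
  \sum_e \sum_(v in V0 G e | `|mu v| < 1) 4 / (1 - mu v ^+ 2).

(** The component leaving [v] that is on the edge at time [m] was at [v] during [[m - tau, m]]; the
    one heading for [v] arrives during [[m, m + tau]]. Both are thus seen at the same end, and each
    contributes [2 * tau] to the factor of the source. *)
Lemma edge_observability e v tau m : e \in E0 G v -> len G e / c <= tau ->
  0 <= m - tau -> m + tau <= T ->
  edge_energy (len G e) (w e) m <=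
    2 * c * \int[leb]_(t in `[m - tau, m + tau]) (trace_in G w e v t ^+ 2 + trace_out G w e v t ^+ 2)
    + 4 * tau * \int[leb2]_(z in slab (m - tau) (m + tau) (len G e)) (uncur (g e) z ^+ 2).
Proof.
move=> ev Ltau mtau mT; have Le := len_gt0 G e.
have tau0 : 0 < tau by apply: lt_le_trans Ltau; rewrite divr_gt0.
have [m0 mm1 mm2 mT'] : [/\ 0 <= m, m - tau <= m, m <= m + tau & m <= T] by split; lra.
have [l1 l2] : len G e / c <= m - (m - tau) /\ len G e / c <= m + tau - m by split; lra.
have [e1 e2] : m - (m - tau) = tau /\ m + tau - m = tau by split; ring.
have ed := ds_edge sys e.
have bin : ess_bounded leb `[0, T] (fun t => trace_in G w e v t ^+ 2) by exact: ess_boundedX.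
have bout : ess_bounded leb `[0, T] (fun t => trace_out G w e v t ^+ 2) by exact: ess_boundedX.
have I f : ess_bounded leb `[0, T] f -> leb.-integrable `[m - tau, m + tau] (EFin \o f).
  by move=> bf; apply: (@integrable_itvS _ 0 T) => //; exact: ess_bounded_itv_integrable.
rewrite RintegralD//; [|exact: I|exact: I].
have monl (f : R -> R) : ess_bounded leb `[0, T] (fun t => f t ^+ 2) ->
    \int[leb]_(t in `[m - tau, m]) (f t ^+ 2) <= \int[leb]_(t in `[m - tau, m + tau]) (f t ^+ 2).
  by move=> bf; apply: le_Rintegral_itvS => //; [move=> x; exact: sqr_ge0|exact: I].
have monr (f : R -> R) : ess_bounded leb `[0, T] (fun t => f t ^+ 2) ->
    \int[leb]_(t in `[m, m + tau]) (f t ^+ 2) <= \int[leb]_(t in `[m - tau, m + tau]) (f t ^+ 2).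
  by move=> bf; apply: le_Rintegral_itvS => //; [move=> x; exact: sqr_ge0|exact: I].
have Ig : leb2.-integrable (slab (m - tau) (m + tau) (len G e)) (EFin \o (fun z => uncur (g e) z ^+ 2)).
  apply: ess_bounded_slab_integrable.
  apply: (@ess_boundedS _ _ _ leb2 (slab 0 T (len G e))); [exact: measurable_slab|exact: slabS|].
  by apply: ess_boundedX; exact: es_source ed.
have gmon s1 s2 : m - tau <= s1 -> s2 <= m + tau ->
    \int[leb2]_(z in slab s1 s2 (len G e)) (uncur (g e) z ^+ 2) <=
    \int[leb2]_(z in slab (m - tau) (m + tau) (len G e)) (uncur (g e) z ^+ 2).
  move=> h1 h2; apply: le_Rintegral_subset => //;
    [exact: measurable_slab|exact: measurable_slab|exact: slabS|by move=> z; exact: sqr_ge0].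
have gm1 := gmon _ _ (lexx _) mm2; have gm2 := gmon _ _ mm1 (lexx _).
have combine a b i1 i2 j1 j2 g1 g2 g' :
    a <= 2 * c * i1 + 2 * tau * g1 -> b <= 2 * c * i2 + 2 * tau * g2 ->
    i1 <= j1 -> i2 <= j2 -> g1 <= g' -> g2 <= g' ->
    a + b <= 2 * c * (j1 + j2) + 4 * tau * g'.
  move=> ha hb hi1 hi2 hg1 hg2.
  have := ler_wpM2l (ltW c_gt0) hi1; have := ler_wpM2l (ltW c_gt0) hi2.
  have := ler_wpM2l (ltW tau0) hg1; have := ler_wpM2l (ltW tau0) hg2; lra.
move: ev; rewrite inE /V0 !inE => /orP[] /eqP ve.
- have H1 := observe_plus_entry c_gt0 Le T_gt0 ed mtau mm1 mT' l1.
  have H2 := observe_minus_exit c_gt0 Le T_gt0 ed m0 mm2 mT l2.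
  have Ein : trace_in G w e v = (minus (w e))^~ 0 by apply/funext => t; rewrite ve trace_in_node0.
  have Eout : trace_out G w e v = (plus (w e))^~ 0 by apply/funext => t; rewrite ve trace_out_node0.
  rewrite Ein in bin *; rewrite Eout in bout *.
  rewrite e1 in H1; rewrite e2 in H2.
  rewrite [X in 2 * c * X]addrC.
  by apply: (combine _ _ _ _ _ _ _ _ _ H1 H2) => //; [exact: monl|exact: monr].
- have H1 := observe_plus_exit c_gt0 Le T_gt0 ed m0 mm2 mT l2.
  have H2 := observe_minus_entry c_gt0 Le T_gt0 ed mtau mm1 mT' l1.
  have Ein : trace_in G w e v = (plus (w e))^~ (len G e) by apply/funext => t; rewrite ve trace_in_nodeL.
  have Eout : trace_out G w e v = (minus (w e))^~ (len G e) by apply/funext => t; rewrite ve trace_out_nodeL.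
  rewrite Ein in bin *; rewrite Eout in bout *.
  rewrite e2 in H1; rewrite e1 in H2.
  by apply: (combine _ _ _ _ _ _ _ _ _ H1 H2) => //; [exact: monr|exact: monl].
Qed.

End Solution.
End NetworkEnergy.

(** * Exponential decay *)

(** A discrete Gronwall argument for a contraction with exponentially decaying forcing; the growth
    hypothesis covers the times between multiples of [tau]. The constants precede [T], [phi] and
    [e], which gives the uniformity needed for time increments. *)
Lemma exponential_decay (R : realType) (tau q K m : R) :
  0 < tau -> 0 <= q -> q < 1 -> 0 <= K -> 0 < m ->
  exists C m' : R, [/\ 0 < C, 0 < m' &
  forall (T phi : R) (e : R -> R), 0 <= phi -> (forall t, 0 <= e t) ->
    (forall s t, 0 <= s -> s <= t -> t <= T -> t - s <= tau ->
       e t <= 2 * e s + K * (phi * expR (- m * s))) ->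
    (forall s, 0 <= s -> s + tau <= T ->
       e (s + tau) <= q * e s + K * (phi * expR (- m * s))) ->
    forall t, 0 <= t -> t <= T -> e t <= C * expR (- m' * t) * (e 0 + phi)].
Proof.
move=> tau0 q0 q1 K0 m0.
(* The rate [r] lies strictly above both the contraction and the decay of the forcing, so no
   resonance occurs when the two coincide. *)
pose M := Num.max q (expR (- m * tau)); pose r := (1 + M) / 2.
have M1 : M < 1.
  by rewrite /M gt_max q1 -expR0 ltr_expR mulNr oppr_lt0 mulr_gt0.
have Mq : q <= M by rewrite le_max lexx.
have Mm : expR (- m * tau) <= M by rewrite le_max lexx orbT.
have Mr : M < r by rewrite /r; lra.
have r1 : r < 1 by rewrite /r; lra.
have r0 : 0 < r by lra.
have rq : 0 < r - q by lra.
pose m' := - ln r / tau.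
have m'0 : 0 < m' by rewrite divr_gt0// oppr_gt0 ln_lt0// r0 r1.
have Er : expR (- m' * tau) = r.
  rewrite /m' mulNr mulfVK ?gt_eqF// opprK lnK//.
(* The quotient makes [q * C0 + K <= r * C0], the induction step; the added 1 gives [1 <= C0], its
   start. *)
pose C0 := K / (r - q) + 1.
have C00 : 0 < C0 by rewrite ltr_wpDl// divr_ge0// ltW.
have C0K : q * C0 + K <= r * C0.
  have : K / (r - q) * (r - q) = K by rewrite mulfVK// gt_eqF.
  rewrite /C0; nra.
(* The numerator comes from one growth step after the last multiple of [tau]; the division by [r]
   accounts for [r ^+ k] when [t] exceeds [k * tau] by up to [tau]. *)
exists ((2 * C0 + K) / r), m'; split => //.
  by rewrite divr_gt0// ltr_wpDr// mulr_gt0.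
move=> T phi e phi0 e0 growth step t t0 tT.
pose S := e 0 + phi.
have S0 : 0 <= S by rewrite addr_ge0.
have Em k : expR (- m * (k%:R * tau)) <= r ^+ k.
  rewrite mulrCA expRM_natl lerXn2r ?nnegrE ?expR_ge0 ?ltW//.
  exact: le_lt_trans Mr.
have phiS : phi <= S by rewrite lerDr.
have tail k : K * (phi * expR (- m * (k%:R * tau))) <= K * (r ^+ k * S).
  by rewrite ler_wpM2l// mulrC ler_pM ?expR_ge0.
have main k : k%:R * tau <= T -> e (k%:R * tau) <= C0 * (r ^+ k * S).
  elim: k => [|k IHk] kT.
    rewrite mul0r expr0 mul1r; apply: (@le_trans _ _ (1 * S)); first by rewrite mul1r lerDl.
    by rewrite ler_wpM2r// lerDr divr_ge0// ltW.
  move: kT; rewrite -natr1 mulrDl mul1r => kT.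
  have ktau : 0 <= k%:R * tau by rewrite mulr_ge0// ltW.
  have {}IHk := IHk (le_trans _ kT); apply: (le_trans (step _ ktau kT)).
  have {}IHk : e (k%:R * tau) <= C0 * (r ^+ k * S) by apply: IHk; rewrite lerDl ltW.
  apply: (le_trans (lerD (ler_wpM2l q0 IHk) (tail k))).
  have X0 : 0 <= r ^+ k * S by rewrite mulr_ge0// exprn_ge0// ltW.
  have -> : C0 * (r ^+ k.+1 * S) = r * C0 * (r ^+ k * S) by rewrite exprS; ring.
  have -> : q * (C0 * (r ^+ k * S)) + K * (r ^+ k * S) = (q * C0 + K) * (r ^+ k * S) by ring.
  exact: ler_wpM2r.
pose k := Num.truncn (t / tau).
have [k1 k2] : k%:R * tau <= t /\ t <= k.+1%:R * tau.
  have ttau : 0 <= t / tau by rewrite divr_ge0// ltW.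
  have /andP[h1 h2] := truncn_itv ttau.
  by split; [rewrite -ler_pdivlMr|rewrite -ler_pdivrMr// ltW].
have kT := le_trans k1 tT.
have ktau : 0 <= k%:R * tau by rewrite mulr_ge0// ltW.
apply: (le_trans (growth _ _ ktau k1 tT _)).
  by move: k2; rewrite -natr1 mulrDl mul1r; lra.
apply: (le_trans (lerD (ler_wpM2l _ (main k kT)) (tail k))) => //.
have rk : r ^+ k <= expR (- m' * t) / r.
  rewrite ler_pdivlMr// -exprSr -Er -expRM_natl ler_expR mulrCA.
  by rewrite !mulNr lerN2 ler_pM2l.
have : (2 * C0 + K) * (r ^+ k * S) <= (2 * C0 + K) * (expR (- m' * t) / r * S).
  by rewrite ler_wpM2l ?ler_wpM2r// addr_ge0// mulr_ge0// ltW.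
rewrite -/S; have -> : (2 * C0 + K) / r * expR (- m' * t) * S = (2 * C0 + K) * (expR (- m' * t) / r * S) by ring.
by apply: le_trans; rewrite le_eqVlt; apply/orP; left; apply/eqP; ring.
Qed.

(** The final energy is at most the energy at the middle plus defect work, and the balance rewrites
    the observed quantity as [E1 + 2 * N - E2]. Solving for [E2] gains the fraction [1 / (1 + Kc)]
    of [E1]; the defect work uses up half of it. *)
Lemma contraction (R : realFieldType) (Kc c tau k E1 E2 Em Lam P N N' Phi : R) :
  E2 + c * Lam + 2 * P = E1 + 2 * N -> E2 <= Em + 2 * N' -> N' <= N ->
  Em <= Kc * (c * Lam + 2 * P) + 8 * tau * Phi ->
  2 * N <= (2 * (1 + Kc))^-1 * E1 + k * Phi ->
  0 <= Kc -> 0 <= tau -> 0 <= Phi ->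
  E2 <= (1 - (2 * (1 + Kc))^-1) * E1 + (k + 8 * tau) * Phi.
Proof.
move=> bal grow N'N obs work Kc0 tau0 Phi0; have Kc1 : 0 < 1 + Kc by lra.
have iE : (2 * (1 + Kc))^-1 * (1 + Kc) = 2^-1 by field; rewrite gt_eqF.
have XE : c * Lam + 2 * P = E1 + 2 * N - E2 by lra.
rewrite XE in obs.
rewrite -(ler_pM2l Kc1).
have := ler_wpM2l (ltW Kc1) work.
have -> : (1 + Kc) * ((2 * (1 + Kc))^-1 * E1 + k * Phi) =
  (2 * (1 + Kc))^-1 * (1 + Kc) * E1 + (1 + Kc) * (k * Phi) by move: (_^-1) => i; ring.
rewrite iE => work'.
have -> : (1 + Kc) * ((1 - (2 * (1 + Kc))^-1) * E1 + (k + 8 * tau) * Phi) =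
  (1 + Kc) * E1 - (2 * (1 + Kc))^-1 * (1 + Kc) * E1 + (1 + Kc) * (k * Phi) + (1 + Kc) * (8 * (tau * Phi)).
  by move: (_^-1) => i; ring.
rewrite iE; have := mulr_ge0 Kc0 (mulr_ge0 tau0 Phi0).
move: work' obs; rewrite !mulrDl !mul1r !mulrBr !mulrDr; lra.
Qed.

(** * Observability and decay for damped systems on the network *)

Section NetworkDecay.
Context {R : realType} {V E : finType} (G : network R V E).
Local Notation leb := (@lebesgue_measure R).
Local Notation leb2 := (leb \x leb)%E.
Variables (c : R) (mu : V -> R).
Hypotheses (c_gt0 : 0 < c) (mu_le1 : forall v, `|mu v| <= 1).
Hypothesis damping_node : forall e, exists2 v, e \in E0 G v & `|mu v| < 1.

Let mu2_lt1 v : `|mu v| < 1 -> 0 < 1 - mu v ^+ 2.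
Proof. by move=> muv; rewrite subr_gt0 -real_normK ?num_real// expr_lt1. Qed.

Lemma observability_constant_ge0 : 0 <= observability_constant G mu.
Proof.
apply: sumr_ge0 => e _; apply: sumr_ge0 => v /andP[_ muv].
by rewrite divr_ge0// ltW// mu2_lt1.
Qed.

Section Observability.
Variables (A T : R) (w : E -> pm (R -> R -> R)) (g : E -> R -> R -> R) (F : E -> R * R -> R).
Hypotheses (T_gt0 : 0 < T) (A_ge0 : 0 <= A).
Hypothesis sys : damped_system G c mu A T w g F.
Variable tau : R.
Hypotheses (tau_gt0 : 0 < tau) (len_tau : forall e, len G e / c <= tau).

(** Each edge is observed from a damping end: [node_loss] bounds its traces and [source_energy] its
    source. The term [2 * tau * A] is the share of the dissipation spent on the sources. *)
Lemma net_observability m : 0 <= m - tau -> m + tau <= T ->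
  net_energy G w m <= (observability_constant G mu + 2 * tau * A) *
    (c * total_loss G mu w (m - tau) (m + tau) + 2 * dissipation G w g F (m - tau) (m + tau))
  + 8 * tau * defect_energy G F (m - tau) (m + tau).
Proof.
move=> h1 h2; set Lam := total_loss _ _ _ _ _; set P := dissipation _ _ _ _ _ _.
set Phi := defect_energy _ _ _ _.
have Lam0 : 0 <= Lam by exact: total_loss_ge0.
have P0 : 0 <= P by exact: (dissipation_ge0 sys).
have c2 : 0 <= 2 * c by rewrite mulr_ge0// ltW.
have tau2 : 0 <= 2 * tau by rewrite mulr_ge0// ltW.
have tau4 : 0 <= 4 * tau by rewrite mulr_ge0// ltW.
have se := source_energy sys h1 h2; rewrite -/P -/Phi in se.
set Gam := defect_energy _ _ _ _ in se.
have H : net_energy G w m <= observability_constant G mu * (c * Lam) + 4 * tau * Gam.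
  rewrite /net_energy /observability_constant /Gam /defect_energy mulr_suml mulr_sumr -big_split/=.
  apply: ler_sum => e _; have [v ev muv] := damping_node e.
  have obs := edge_observability c_gt0 T_gt0 sys ev (len_tau e) h1 h2.
  have nl := node_loss c_gt0 mu_le1 T_gt0 sys h1 h2 ev muv; rewrite -/Lam in nl.
  apply: (le_trans (ler_wpM2l (sqr_ge0 _) obs)).
  rewrite mulrDr [in X in _ + X <= _]mulrCA lerD2r.
  rewrite [leLHS]mulrCA.
  apply: (@le_trans _ _ (4 / (1 - mu v ^+ 2) * (c * Lam))).
    have := ler_wpM2l c2 nl.
    move/le_trans; apply; rewrite le_eqVlt; apply/orP; left; apply/eqP.
    by field; rewrite gt_eqF// mu2_lt1.
  apply: ler_wpM2r; first by rewrite mulr_ge0// ltW.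
  rewrite (bigD1 v)/=; last by rewrite muv andbT; move: ev; rewrite inE.
  rewrite lerDl; apply: sumr_ge0 => v' /andP[/andP[_ muv'] _].
  by rewrite divr_ge0// ltW// mu2_lt1.
apply: (le_trans H).
have := ler_wpM2l tau4 se.
have := mulr_ge0 (mulr_ge0 tau2 A_ge0) (mulr_ge0 (ltW c_gt0) Lam0).
have := mulr_ge0 observability_constant_ge0 P0.
move: (observability_constant G mu) => KB.
have -> : (KB + 2 * tau * A) * (c * Lam + 2 * P) =
  KB * (c * Lam) + 2 * (KB * P) + 2 * tau * A * (c * Lam) + 4 * tau * (A * P) by ring.
rewrite !mulrDr; lra.
Qed.

End Observability.

Lemma damped_system_decay A tau m : 0 <= A -> 0 < tau -> (forall e, len G e / c <= tau) -> 0 < m ->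
  exists C m' : R, [/\ 0 < C, 0 < m' &
  forall T w g F phi, 0 < T -> damped_system G c mu A T w g F -> 0 <= phi ->
    (forall s t, 0 <= s -> s <= t -> t <= T -> t - s <= 2 * tau ->
       defect_energy G F s t <= phi * expR (- m * s)) ->
    forall t, 0 <= t -> t <= T ->
      net_energy G w t <= C * expR (- m' * t) * (net_energy G w 0 + phi)].
Proof.
move=> A0 tau0 Ltau m0.
pose Kc := observability_constant G mu + 2 * tau * A.
have Kc0 : 0 <= Kc by rewrite addr_ge0 ?observability_constant_ge0// !mulr_ge0// ltW.
(* Chosen so that [8 * tau * eps] is half of the gain [1 / (1 + Kc)]. *)
pose eps := (16 * tau * (1 + Kc))^-1.
have eps0 : 0 < eps by rewrite invr_gt0 !mulr_gt0// ltr_wpDr.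
have epsE : 8 * tau * eps = (2 * (1 + Kc))^-1.
  by rewrite /eps; field; rewrite !gt_eqF// ltr_wpDr.
have i1 : 0 < (2 * (1 + Kc))^-1 by rewrite invr_gt0 mulr_gt0// ltr_wpDr.
have i2 : (2 * (1 + Kc))^-1 <= 2^-1.
  by rewrite lef_pV2 ?posrE ?mulr_gt0// ?ltr_wpDr//; lra.
have epstau : 8 * tau * eps <= 1 by rewrite epsE; lra.
pose q := 1 - (2 * (1 + Kc))^-1; pose K := 2 / eps + 8 * tau.
have K0 : 0 <= K by apply: addr_ge0; [rewrite divr_ge0// ltW|rewrite mulr_ge0// ltW].
have K2 : 2 / eps <= K by rewrite lerDl mulr_ge0// ltW.
have tau20 : 0 < 2 * tau by rewrite mulr_gt0.
have q01 : 0 <= q /\ q < 1 by rewrite /q; split; lra.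
have [C [m' [C0 m'0 H]]] := exponential_decay tau20 q01.1 q01.2 K0 m0.
exists C, m'; split => // T w g F phi T0 sys phi0 Fphi t t0 tT.
apply: (H T) => //; first exact: net_energy_ge0.
  move=> s r s0 sr rT rs.
  have ww := window_work c_gt0 mu_le1 T0 sys s0 sr rT rs eps0 epstau.
  have gr := energy_growth c_gt0 mu_le1 T0 sys s0 sr (lexx r) rT.
  have Phi0 := defect_energy_ge0 G F s r.
  have := ler_wpM2l K0 (Fphi s r s0 sr rT rs).
  have := ler_wpM2r Phi0 K2.
  have := ler_wpM2r (net_energy_ge0 G w s) epstau.
  lra.
move=> s s0 sT.
have [e1 e2] : s + tau - tau = s /\ s + tau + tau = s + 2 * tau by split; ring.
have [s1 s2 s3] : [/\ s <= s + 2 * tau, s <= s + tau & s + tau <= s + 2 * tau] by split; lra.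
have l2 : s + 2 * tau - s <= 2 * tau by lra.
have stau0 : 0 <= s + tau by lra.
have ww := window_work c_gt0 mu_le1 T0 sys s0 s1 sT l2 eps0 epstau.
have bal := energy_balance c_gt0 T0 sys s0 s1 sT.
have bal2 := energy_growth c_gt0 mu_le1 T0 sys stau0 s3 (lexx _) sT.
have mono := defect_work_mono sys s0 s2 s3 (lexx _) sT.
have obs := @net_observability A T w g F T0 A0 sys tau tau0 Ltau (s + tau).
rewrite e1 e2 -/Kc in obs; have {}obs := obs s0 sT.
have := ler_wpM2l K0 (Fphi s _ s0 s1 sT l2).
have Phi0 := defect_energy_ge0 G F s (s + 2 * tau).
move=> Fs; rewrite -/eps in ww; rewrite epsE in ww.
have X := contraction bal bal2 mono obs ww.
move: Fs; rewrite /K => Fs.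
by apply: (le_trans (X _ _ _)) => //; [exact: ltW|rewrite lerD2l].
Qed.

End NetworkDecay.

(** * The error system *)

Section ChordSlope.
Context {R : realFieldType}.
Implicit Types x y : R.

(* The slope of the chord of x |-> |x| x, written so that it also makes sense
   when the two points coincide. *)
Definition slope x y : R :=
  if 0 <= x * y then `|x| + `|y| else (x ^+ 2 + y ^+ 2) / (`|x| + `|y|).

Lemma slopeC x y : slope x y = slope y x.
Proof. by rewrite /slope mulrC addrC [x ^+ 2 + _]addrC. Qed.

Lemma slopeN x y : slope (- x) (- y) = slope x y.
Proof. by rewrite /slope mulrNN !normrN !sqrrN. Qed.

Let slope_pos x y : 0 < y -> slope x y = if 0 <= x then x + y else (x ^+ 2 + y ^+ 2) / (y - x).
Proof.
move=> y0; rewrite /slope pmulr_lge0// (gtr0_norm y0); case: ifPn => x0.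
  by rewrite ger0_norm.
have xn : x < 0 by rewrite ltNge.
by rewrite ltr0_norm// [- x + y]addrC.
Qed.

Let slope0 x : slope x 0 = `|x|.
Proof. by rewrite /slope mulr0 lexx normr0 addr0. Qed.

Let slope_ind (P : R -> R -> Prop) :
  (forall x y, P (- x) (- y) -> P x y) -> (forall x, P x 0) ->
  (forall x y, 0 < y -> P x y) -> forall x y, P x y.
Proof.
move=> PN P0 Ppos x y; have [y0|y0|->] := ltgtP y 0; [|exact: Ppos|exact: P0].
by apply: PN; apply: Ppos; rewrite oppr_gt0.
Qed.

Lemma slopeE x y : `|x| * x - `|y| * y = slope x y * (x - y).
Proof.
move: x y; apply: slope_ind => [x y|x|x y y0].
- by rewrite slopeN !normrN => H; move: H; lra.
- by rewrite slope0 normr0; ring.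
- rewrite slope_pos// (gtr0_norm y0); case: ifPn => x0; first by rewrite ger0_norm//; ring.
  have xn : x < 0 by rewrite ltNge.
  by rewrite ltr0_norm//; field; lra.
Qed.

Lemma slope_ge0 x y : 0 <= slope x y.
Proof. by rewrite /slope; case: ifPn => _; rewrite ?divr_ge0 ?addr_ge0 ?sqr_ge0. Qed.

Lemma slope_le x y : slope x y <= `|x| + `|y|.
Proof.
move: x y; apply: slope_ind => [x y|x|x y y0].
- by rewrite slopeN !normrN.
- by rewrite slope0 normr0 addr0.
- rewrite slope_pos// (gtr0_norm y0); case: ifPn => x0; first by rewrite ger0_norm.
  have xn : x < 0 by rewrite ltNge.
  by rewrite ltr0_norm// ler_pdivrMr; nra.
Qed.

(** By oddness the common point may be taken positive; the other two then lie on the same or on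
    different sides of 0, where the slope is affine or rational. *)
Lemma slope_lipschitz_l x x' y : `|slope x y - slope x' y| <= `|x - x'|.
Proof.
suff H u v z : 0 < z -> `|slope u z - slope v z| <= `|u - v|.
  have [y0|y0|->] := ltgtP y 0; [|exact: H|].
    rewrite -(slopeN x) -(slopeN x') (_ : `|x - x'| = `|- x - - x'|); last first.
      by rewrite -normrN; congr `|_|; ring.
    by apply: H; rewrite oppr_gt0.
  by rewrite !slope0; exact: ler_dist_dist.
move=> z0.
wlog uv : u v / v <= u.
  move=> W; have [|/ltW] := leP v u; first exact: W.
  by rewrite (distrC (slope u z)) (distrC u); exact: W.
rewrite [leRHS]ger0_norm ?subr_ge0//.
have key a : a < 0 -> (a ^+ 2 + z ^+ 2) / (z - a) = z - a + 2 * (a * z) / (z - a).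
  by move=> a0; field; lra.
rewrite !slope_pos//; case: (leP 0 v) => v0.
  by rewrite (le_trans v0 uv) ger0_norm; lra.
have zv : 0 < z - v by lra.
have vzE : (v ^+ 2 + z ^+ 2) / (z - v) * (z - v) = v ^+ 2 + z ^+ 2 by rewrite mulfVK// gt_eqF.
case: (leP 0 u) => u0.
  rewrite ler_norml; apply/andP; split; rewrite -(ler_pM2r zv) mulrBl vzE; nra.
have zu : 0 < z - u by lra.
have uzE : (u ^+ 2 + z ^+ 2) / (z - u) * (z - u) = u ^+ 2 + z ^+ 2 by rewrite mulfVK// gt_eqF.
(* The last fraction has absolute value at most 1, because its denominator is
   [z ^+ 2 - z * (u + v) + u * v] with [u, v < 0 < z]. *)
have D : (u ^+ 2 + z ^+ 2) / (z - u) - (v ^+ 2 + z ^+ 2) / (z - v) =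
    (u - v) * ((z ^+ 2 + z * (u + v) - u * v) / ((z - u) * (z - v))) by field; lra.
rewrite D normrM ger0_norm ?subr_ge0// ler_piMr ?subr_ge0//.
have p0 : 0 < (z - u) * (z - v) by rewrite mulr_gt0.
by rewrite ler_norml ler_pdivlMr// ler_pdivrMr//; apply/andP; split; nra.
Qed.

Lemma slope_lipschitz x y x' y' :
  `|slope x y - slope x' y'| <= `|x - x'| + `|y - y'|.
Proof.
have -> : slope x y - slope x' y' = (slope x y - slope x' y) + (slope x' y - slope x' y') by ring.
rewrite (le_trans (ler_normD _ _))// lerD ?slope_lipschitz_l//.
by rewrite (slopeC x' y) (slopeC x' y') slope_lipschitz_l.
Qed.

(** [|f * d| <= |F| * |d|] leaves [a * d ^+ 2 <= r]; then [g ^+ 2 <= 2 * (a * d) ^+ 2 + 2 * f ^+ 2]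
    and [(a * d) ^+ 2 <= A * r]. *)
Lemma damping_inequality (A a f F d g : R) : g = a * d + f -> 0 <= a -> a <= A ->
  `|f| <= `|F| ->
  let r := g * d + `|F| * `|d| in 0 <= r /\ g ^+ 2 <= 2 * A * r + 2 * F ^+ 2.
Proof.
move=> -> a0 aA fF r.
have ad2 : a * d ^+ 2 <= r.
  rewrite /r mulrDl -addrA -mulrA -expr2 lerDl.
  have := ler_norm (- (f * d)); rewrite normrN normrM.
  have := ler_wpM2r (normr_ge0 d) fF; lra.
have ad0 : 0 <= a * d ^+ 2 by rewrite mulr_ge0 ?sqr_ge0.
split; first exact: le_trans ad2.
have f2 : f ^+ 2 <= F ^+ 2 by rewrite -[f ^+ 2]real_normK ?num_real// -[F ^+ 2]real_normK ?num_real// lerXn2r ?nnegrE.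
have := sqr_ge0 (a * d - f).
have : a * (a * d ^+ 2) <= A * r.
  by apply: ler_pM.
nra.
Qed.

End ChordSlope.

(** * Node conditions of the error system *)

Section NodeConditions.
Context {R : realType} {V E : finType} (G : network R V E) (mu : V -> R).

(** For bare families of traces at one time, so that linearity carries the condition over to time
    increments. *)
Definition node_relation (v : V) (inn out : E -> R) : Prop := forall e, e \in E0 G v ->
  (#|E0 G v| = 1%N -> out e = mu v * inn e) /\
  ((2 <= #|E0 G v|)%N -> out e = - mu v * inn e
     + mu v * omega G v * \sum_(g in E0 G v) diam G g ^+ 2 * inn g).

Lemma node_relationB v i1 o1 i2 o2 : node_relation v i1 o1 -> node_relation v i2 o2 ->
  node_relation v (fun e => i1 e - i2 e) (fun e => o1 e - o2 e).
Proof.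
move=> H1 H2 e ev; have [H11 H12] := H1 e ev; have [H21 H22] := H2 e ev; split=> card.
  by rewrite H11// H21//; ring.
rewrite H12// H22//.
under [X in _ = _ + _ * X]eq_bigr do rewrite mulrBr.
by rewrite sumrB; ring.
Qed.

(* The coupling is the reflection along the weighted mean, hence an isometry
   for the norm with weights D^2, composed with the multiplication by mu. *)
Lemma node_relation_sqr v inn out : node_relation v inn out ->
  \sum_(e in E0 G v) diam G e ^+ 2 * out e ^+ 2 =
  mu v ^+ 2 * \sum_(e in E0 G v) diam G e ^+ 2 * inn e ^+ 2.
Proof.
move=> H; have [c1|c2|c0] := ltngtP #|E0 G v| 1.
- have E0v : E0 G v = finset.set0 by apply: cards0_eq; move: c1; case: #|_|.
  by rewrite E0v !big_set0 mulr0.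
- set s := \sum_(g in E0 G v) diam G g ^+ 2 * inn g.
  set D := \sum_(g in E0 G v) diam G g ^+ 2.
  have D0 : D != 0.
    have [e ev] : exists e, e \in E0 G v by apply/card_gt0P; exact: ltn_trans c2.
    rewrite gt_eqF// /D (bigD1 e)//= ltr_wpDr ?exprn_gt0 ?diam_gt0//.
    by apply: sumr_ge0 => f _; exact: sqr_ge0.
  (* After expansion the last two sums cancel because [omega] times the sum of the [D ^+ 2] equals
     2. *)
  transitivity (\sum_(e in E0 G v) (mu v ^+ 2 * (diam G e ^+ 2 * inn e ^+ 2)
     + (- 2 * mu v ^+ 2 * omega G v * s) * (diam G e ^+ 2 * inn e)
     + (mu v * omega G v * s) ^+ 2 * diam G e ^+ 2)).
    by apply: eq_bigr => e ev; rewrite (H e ev).2// -/s; ring.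
  rewrite !big_split/= -!mulr_sumr -/s -/D /omega -/D; field; exact: D0.
- rewrite mulr_sumr; apply: eq_bigr => e ev; rewrite (H e ev).1//; ring.
Qed.

End NodeConditions.

Section Conversions.
Context {R : realType}.
Local Notation leb := (@lebesgue_measure R).
Local Notation leb2 := (leb \x leb)%E.

Lemma Lfun_ess_bounded d (X : measurableType d) (nu : {measure set X -> \bar R})
    (D : set X) (f : X -> R) : measurable D -> (0 < nu setT)%E ->
  f \_ D \in Lfun nu +oo%E -> ess_bounded nu D f.
Proof.
move=> mD nu0; rewrite inE => /andP[]; rewrite !inE/= => mf fin.
split; first exact/measurable_restrictT.
(* The norm with exponent [+oo] is an essential supremum only if the whole space has positive
   measure. *)
move: fin; rewrite /finite_norm unlock/= nu0 => fin.
have H := ess_sup_ge nu (abse \o (EFin \o f \_ D)).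
exists (fine (ess_sup nu (abse \o (EFin \o f \_ D)))).
apply: (ae_imp _ H) => x /= + Dx.
rewrite /patch mem_set//; move: fin; case: (ess_sup _ _) => [r|//|//] /=.
by rewrite lee_fin.
Qed.

Lemma lebesgue_setT_gt0 : (0 < leb setT)%E.
Proof.
apply: (@lt_le_trans _ _ (leb `[0, 1])); last by apply: le_measure; rewrite ?inE.
by rewrite lebesgue_measure_itv/= lte_fin ltr01 oppr0 adde0 lte_fin.
Qed.

Lemma lebesgue2_setT_gt0 : (0 < leb2 setT)%E.
Proof. by rewrite -setXTT product_measure1E// mule_gt0// lebesgue_setT_gt0. Qed.

Lemma Linfty_rect_ess_bounded T L (w : R -> R -> R) :
  Linfty_rect T L w -> ess_bounded leb2 (slab 0 T L) (uncur w).
Proof.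
apply: Lfun_ess_bounded; [exact: measurable_slab|exact: lebesgue2_setT_gt0].
Qed.

End Conversions.

Section Energy.
Context {R : realType} {V E : finType} (G : network R V E).
Local Notation leb := (@lebesgue_measure R).

Lemma nu_gt0 e : 0 < nu G e.
Proof. by rewrite /nu /theta !divr_gt0 ?fric_gt0 ?diam_gt0. Qed.

Lemma T0_ge0 (c : R) : 0 < c -> 0 <= T0 G c.
Proof.
move=> c0; rewrite /T0 /max_edge; have [[e]|nE] := pselect (inhabited E).
  apply: (@le_trans _ _ (len G e / c)); first by rewrite divr_ge0 ?ltW ?len_gt0.
  apply: ub_le_sup; last by exists e.
  exists (\sum_e len G e / c) => _ [f _ <-].
  rewrite (bigD1 f)//= lerDl; apply: sumr_ge0 => f' _.
  by rewrite divr_ge0 ?ltW ?len_gt0.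
(* Without edges [sup] takes its default value 0 on the empty set. *)
rewrite [X in sup X](_ : _ = set0) ?sup0//; apply/seteqP; split => // y [e _ _].
by case: nE; exists.
Qed.

Lemma energyE (w : E -> pm (R -> R -> R)) t :
  (forall e, leb.-integrable `[0, len G e] (EFin \o (fun x => plus (w e) t x ^+ 2)) /\
             leb.-integrable `[0, len G e] (EFin \o (fun x => minus (w e) t x ^+ 2))) ->
  energy G w t = (net_energy G w t)%:E.
Proof.
move=> bw; rewrite /energy /net_energy -sumEFin; apply: eq_bigr => e _.
rewrite [RHS]EFinM; congr (_ * _)%E.
have [bp bm] := bw e.
rewrite /edge_energy -RintegralD// /Rintegral fineK; last first.
  apply: integrable_fin_num => //.
  rewrite (_ : (fun _ => _) = (EFin \o (fun x => plus (w e) t x ^+ 2)%R) \+ (EFin \o (fun x => minus (w e) t x ^+ 2)%R))%E.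
    exact: integrableD.
  by apply/funext.
by apply: eq_integral => x _; rewrite !real_normK ?num_real.
Qed.

End Energy.

Section Synchronization.
Context {R : realType} {V E : finType} (G : network R V E).
Local Notation leb := (@lebesgue_measure R).
Local Notation leb2 := (leb \x leb)%E.

(** The bounds on the solutions are stated for almost every [x] and then almost every time. Since
    [f] is measurable, so is the set where the bound fails, and Tonelli applies. *)
Lemma ae_slab_le t1 t2 L K (f : R * R -> R) : measurable_fun (slab t1 t2 L) f ->
  (\forall x \ae leb, x \in `[0, L] -> \forall s \ae leb, s \in `[t1, t2] -> f (s, x) <= K) ->
  \forall z \ae leb2, slab t1 t2 L z -> f z <= K.
Proof.
move=> mf H; pose N := slab t1 t2 L `&` f @^-1` `]K, +oo[.
have mN : measurable N by apply: mf => //; exact: measurable_slab.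
have : \forall z \ae leb2, ~ N z.
  apply: ae_from_ysection => //; apply: (ae_imp _ H) => x Hx.
  have [xL|xL] := boolP (x \in `[0, L]).
    apply: (ae_imp _ (Hx xL)) => s Hs [[/= sT _]]; rewrite in_itv/= andbT.
    by rewrite ltNge Hs.
  by apply: nearW => s [[/= _ xL']]; rewrite xL' in xL.
apply: ae_imp => z nN zs; rewrite leNgt; apply/negP => Kf.
by apply: nN; split => //=; rewrite in_itv/= Kf.
Qed.

Definition diff_source (S delta : E -> pm (R -> R -> R)) (e : E) (t x : R) : R :=
  sigma G e (plus (delta e) t x + plus (S e) t x) (minus (delta e) t x + minus (S e) t x)
  - sigma G e (plus (S e) t x) (minus (S e) t x).

Lemma diff_sourceE S delta e z : uncur (diff_source S delta e) z =
  nu G e * (`|gap (S e) z + gap (delta e) z| * (gap (S e) z + gap (delta e) z)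
            - `|gap (S e) z| * gap (S e) z).
Proof.
rewrite /uncur /diff_source /sigma /gap /uncur.
have -> : plus (delta e) z.1 z.2 + plus (S e) z.1 z.2 - (minus (delta e) z.1 z.2 + minus (S e) z.1 z.2)
  = plus (S e) z.1 z.2 - minus (S e) z.1 z.2 + (plus (delta e) z.1 z.2 - minus (delta e) z.1 z.2) by ring.
ring.
Qed.

Lemma ess_bounded_diff_source (D : set (R * R)) S delta e :
  ess_bounded leb2 D (gap (S e)) -> ess_bounded leb2 D (gap (delta e)) ->
  ess_bounded leb2 D (uncur (diff_source S delta e)).
Proof.
move=> bS bd; rewrite (_ : uncur _ = fun z => nu G e *
  (`|gap (S e) z + gap (delta e) z| * (gap (S e) z + gap (delta e) z)
            - `|gap (S e) z| * gap (S e) z)); last by apply/funext => z; exact: diff_sourceE.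
apply: ess_boundedM; first exact: ess_bounded_cst.
apply: ess_boundedB; apply: ess_boundedM => //; try exact: ess_boundedD.
  by apply: ess_bounded_norm; exact: ess_boundedD.
exact: ess_bounded_norm.
Qed.

Variables (c : R) (mu : V -> R).
Hypotheses (c_gt0 : 0 < c).

Section OneSynchronization.
Variables (T M : R) (y z : E -> pm (R -> R)) (u : E -> R -> R)
  (S Rs delta : E -> pm (R -> R -> R)).
Hypothesis T_gt0 : 0 < T.
Hypothesis sync : synchronization G c mu T M y z u S Rs delta.

Lemma sync_S_bounded e : ess_bounded leb2 (slab 0 T (len G e)) (uncur (plus (S e))) /\
  ess_bounded leb2 (slab 0 T (len G e)) (uncur (minus (S e))).
Proof. by have [? ?] := sync_S_Linfty sync e; split; exact: Linfty_rect_ess_bounded. Qed.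

Lemma sync_delta_bounded e : ess_bounded leb2 (slab 0 T (len G e)) (uncur (plus (delta e))) /\
  ess_bounded leb2 (slab 0 T (len G e)) (uncur (minus (delta e))).
Proof.
have [S1 S2] := sync_S_bounded e; have [R1 R2] := sync_R_Linfty sync e.
rewrite (sync_delta sync); split; apply: ess_boundedB => //; exact: Linfty_rect_ess_bounded.
Qed.

Lemma sync_S_gap e : ess_bounded leb2 (slab 0 T (len G e)) (gap (S e)).
Proof. by have [? ?] := sync_S_bounded e; exact: ess_boundedB. Qed.

Lemma sync_delta_gap e : ess_bounded leb2 (slab 0 T (len G e)) (gap (delta e)).
Proof. by have [? ?] := sync_delta_bounded e; exact: ess_boundedB. Qed.

Lemma sync_edge e : edge_solution c (len G e) T (delta e) (diff_source S delta e).
Proof.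
have [b1 b2] := sync_delta_bounded e.
have bg := ess_bounded_diff_source (sync_S_gap e) (sync_delta_gap e).
have [tp tm] := mild_solution_transported c_gt0 T_gt0 bg ((sync_Diff sync).1 e).
by split.
Qed.

Lemma sync_sections e t : t \in `[0, T] ->
  ess_bounded leb `[0, len G e] (plus (delta e) t) /\
  ess_bounded leb `[0, len G e] (minus (delta e) t).
Proof.
move=> tT; have Le := len_gt0 G e; split.
  exact: (ess_bounded_plus_section c_gt0 Le T_gt0 (sync_edge e) tT).
exact: (ess_bounded_minus_section c_gt0 Le T_gt0 (sync_edge e) tT).
Qed.

Lemma sync_bound_S e : \forall s \ae leb2, slab 0 T (len G e) s -> `|gap (S e) s| <= M.
Proof.
apply: (@ae_slab_le _ _ _ _ (fun s => `|gap (S e) s|)).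
  exact: (ess_bounded_norm (sync_S_gap e)).1.
apply: (ae_imp _ (sync_A sync e)) => x + xL => /(_ xL).
by apply: ae_imp => s + sT => /(_ sT) [].
Qed.

Lemma sync_bound_R e :
  \forall s \ae leb2, slab 0 T (len G e) s -> `|gap (S e) s + gap (delta e) s| <= M.
Proof.
apply: (@ae_slab_le _ _ _ _ (fun s => `|gap (S e) s + gap (delta e) s|)).
  exact: (ess_bounded_norm (ess_boundedD (sync_S_gap e) (sync_delta_gap e))).1.
apply: (ae_imp _ (sync_A sync e)) => x + xL => /(_ xL).
apply: ae_imp => s + sT => /(_ sT) [_]; rewrite /gap /uncur/=.
by rewrite !addrA.
Qed.

Lemma sync_nodes : \forall t \ae leb, t \in `]0, T[ -> forall v,
  node_relation G mu v (fun e => trace_in G delta e v t) (fun e => trace_out G delta e v t).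
Proof.
by apply: (ae_imp _ (sync_Diff sync).2) => t + tT => /(_ tT) H v e ev; exact: H.
Qed.

End OneSynchronization.

(** A chord slope at two points bounded by [M] is at most [2 * M]. The sum dominates each [nu], and
    [|M|] keeps the bound nonnegative for every [M]. *)
Definition friction_bound (M : R) : R := 2 * (\sum_e nu G e) * `|M|.

Lemma friction_bound_ge0 M : 0 <= friction_bound M.
Proof. by rewrite !mulr_ge0// sumr_ge0// => e _; rewrite ltW// nu_gt0. Qed.

Lemma nu_le_sum e : nu G e <= \sum_f nu G f.
Proof. by rewrite (bigD1 e)//= lerDl sumr_ge0// => f _; rewrite ltW// nu_gt0. Qed.

Lemma friction_slope M e a b : `|a| <= M -> `|b| <= M ->
  0 <= nu G e * slope a b /\ nu G e * slope a b <= friction_bound M.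
Proof.
move=> aM bM; have nu0 := nu_gt0 G e; split; first by rewrite mulr_ge0 ?slope_ge0// ltW.
have M0 : 0 <= M by exact: le_trans aM.
rewrite /friction_bound -mulrA mulrCA; apply: ler_pM; [exact: ltW|exact: slope_ge0|exact: nu_le_sum|].
rewrite ger0_norm// (le_trans (slope_le a b))//; lra.
Qed.

(** The source is exactly the chord slope between the gaps of observer and original state times the
    gap of [delta]; there is no defect. *)
Lemma sync_damped T M y z u S Rs delta : 0 < T ->
  synchronization G c mu T M y z u S Rs delta ->
  damped_system G c mu (2 * friction_bound M) T delta (diff_source S delta) (fun _ _ => 0).
Proof.
move=> T0 sync; split.
- exact: (sync_edge T0 sync).
- by move=> e; exact: ess_bounded_cst.
- move=> e; apply: (ae_imp2 _ (sync_bound_S sync e) (sync_bound_R sync e)) => s SM RM sL.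
  have [a0 aA] := friction_slope e (RM sL) (SM sL).
  apply: (@damping_inequality _ _ _ 0) a0 aA _; last by rewrite normr0.
  by rewrite diff_sourceE slopeE; ring.
- by apply: (ae_imp _ (sync_nodes sync)) => t + tT => /(_ tT) H v; exact: node_relation_sqr.
Qed.

End Synchronization.

(* [lra] goes through all hypotheses, and those about integrals are slow to process. *)
Ltac slra :=
  (repeat match goal with
   | H : context [@integral] |- _ => clear H
   | H : context [@Rintegral] |- _ => clear H
   | H : almost_everywhere _ _ |- _ => clear H
   end; lra) || lra.

(** * Time increments *)

Section TimeIncrements.
Context {R : realType} {V E : finType} (G : network R V E).
Local Notation leb := (@lebesgue_measure R).
Local Notation leb2 := (leb \x leb)%E.

Definition increment (h : R) (p : R -> R -> R) (t x : R) : R := p (t + h) x - p t x.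

Definition pm_increment (h : R) (w : E -> pm (R -> R -> R)) (e : E) : pm (R -> R -> R) :=
  PM (increment h (plus (w e))) (increment h (minus (w e))).

Lemma ae_shift h (P : R * R -> Prop) :
  (\forall z \ae leb2, P z) -> \forall z \ae leb2, P (z.1 + h, z.2).
Proof.
have h1 : (1 : R) != 0 by rewrite oner_eq0.
move=> /(@scaled_ae _ _ _ _ _ leb2 leb2 (`|1|^-1) (skew h 1 0 0)
  (@measurable_skew R h 1 0 0 setT) (fun A mA => skew_measure h 0 0 h1 mA)).
by apply: ae_imp => z; rewrite /skew mul0r !addr0 mul1r.
Qed.

Lemma trace_in_increment h w e v t :
  trace_in G (pm_increment h w) e v t = trace_in G w e v (t + h) - trace_in G w e v t.
Proof. by rewrite /trace_in; case: ifP. Qed.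

Lemma trace_out_increment h w e v t :
  trace_out G (pm_increment h w) e v t = trace_out G w e v (t + h) - trace_out G w e v t.
Proof. by rewrite /trace_out; case: ifP. Qed.

Lemma gap_increment h w e z :
  gap (pm_increment h w e) z = gap (w e) (z.1 + h, z.2) - gap (w e) z.
Proof. by rewrite /gap /uncur/= /increment; ring. Qed.

Lemma ess_bounded_increment T L h (p : R -> R -> R) : 0 <= h ->
  ess_bounded leb2 (slab 0 T L) (uncur p) ->
  ess_bounded leb2 (slab 0 (T - h) L) (uncur (increment h p)).
Proof.
move=> h0 bp; apply: ess_boundedB; first exact: (ess_bounded_shift h0 bp).
apply: (@ess_boundedS _ _ _ leb2 _ _ _ (measurable_slab 0 T L) _ bp).
by apply: slabS => //; slra.
Qed.

Lemma transported_shorten (c L T T' : R) (p g : R -> R -> R) : T' <= T ->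
  transported c L T p g -> transported c L T' p g.
Proof.
move=> TT; apply: ae_imp => y H s t s0 st tT h1 h2; apply: H => //.
exact: le_trans TT.
Qed.

Lemma edge_solution_increment (c L T h : R) (w : pm (R -> R -> R)) (g : R -> R -> R) : 0 < c -> 0 <= h ->
  edge_solution c L T w g ->
  edge_solution c L (T - h) (PM (increment h (plus w)) (increment h (minus w))) (increment h g).
Proof.
move=> c0 h0 [bp bm bg tp tm].
have TT : T - h <= T by slra.
have sub (f : R * R -> R) : ess_bounded leb2 (slab 0 T L) f -> ess_bounded leb2 (slab 0 (T - h) L) f.
  by move=> bf; apply: (@ess_boundedS _ _ _ leb2 _ _ _ (measurable_slab 0 T L) _ bf); apply: slabS.
have bgm : ess_bounded leb2 (slab 0 T L) (uncur (fun t x => - g t (L - x))).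
  by apply: ess_boundedN; exact: (ess_bounded_mirror bg).
split; try exact: ess_bounded_increment.
- exact: (transportedB c0 (ess_bounded_shift h0 bg) (sub _ bg)
    (transported_shift c0 h0 bg tp) (transported_shorten TT tp)).
- have := transportedB c0 (ess_bounded_shift h0 bgm) (sub _ bgm)
    (transported_shift c0 h0 bgm tm) (transported_shorten TT tm).
  congr transported; apply/funext => t; apply/funext => x.
  by rewrite /increment/=; ring.
Qed.

Variables (c : R) (mu : V -> R).
Hypothesis c_gt0 : 0 < c.

(** [K] bounds the increment of the gap of [S]; the other factor bounds the difference between the
    chord slopes of the observer and of [S] from time [t] to time [t + h]. *)
Definition increment_defect (K : R) (delta : E -> pm (R -> R -> R)) (h : R) (e : E) (z : R * R) : R :=
  nu G e * K * (`|gap (delta e) (z.1 + h, z.2)| + `|gap (delta e) z|).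

(** With gaps [a, a'] of [S] and [d, d'] of [delta] at the two times, the increment of the source is
    [nu] times [s * (d' - d) + (s - s0) * (a' - a)], where [s = slope (a' + d') (a + d)] and
    [s0 = slope a' a]. The first term is friction on the increment; in the second,
    [|s - s0| <= |d'| + |d|]. Grouping the slopes in time, not state against state, leaves only
    increments of [S] to be bounded. *)
Lemma increment_damped T M h K y z u S Rs delta : 0 < h -> h < T -> 0 <= K ->
  synchronization G c mu T M y z u S Rs delta ->
  (forall e, \forall z \ae leb2, slab 0 (T - h) (len G e) z ->
     `|gap (S e) (z.1 + h, z.2) - gap (S e) z| <= K) ->
  damped_system G c mu (2 * friction_bound G M) (T - h) (pm_increment h delta)
    (fun e => increment h (diff_source G S delta e)) (increment_defect K delta h).
Proof.
move=> h0 hT K0 sync lip; have T0 : 0 < T by slra.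
have h0' := ltW h0.
have sub e (f : R * R -> R) : ess_bounded leb2 (slab 0 T (len G e)) f ->
    ess_bounded leb2 (slab 0 (T - h) (len G e)) f.
  move=> bf; apply: (@ess_boundedS _ _ _ leb2 _ _ _ (measurable_slab 0 T (len G e)) _ bf).
  by apply: slabS => //; slra.
split.
- by move=> e; apply: edge_solution_increment => //; exact: (sync_edge c_gt0 T0 sync).
- move=> e; apply: ess_boundedM; first exact: ess_bounded_cst.
  have bd := sync_delta_gap sync e.
  apply: ess_boundedD; apply: ess_bounded_norm; last exact: sub.
  exact: (ess_bounded_shift h0' bd).
- move=> e.
  have A1 := ae_imp2 (fun _ x y => conj x y) (sync_bound_S sync e) (sync_bound_R sync e).
  apply: (ae_imp2 _ (ae_imp2 (fun _ x y => conj x y) A1 (ae_shift h A1)) (lip e)).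
  move=> s [[S1 R1] [S2 R2]] ls sL.
  have sT : slab 0 T (len G e) s by apply: (slabS (lexx 0) _ sL); slra.
  have sT' : slab 0 T (len G e) (s.1 + h, s.2).
    move: sL => [/=]; rewrite !in_itv/= => /andP[? ?] ?; split => //=.
    by rewrite in_itv/=; apply/andP; split; slra.
  have [a0 aA] := friction_slope G e (R2 sT') (R1 sT).
  have {}ls := ls sL.
  rewrite gap_increment /increment_defect.
  have E1 := diff_sourceE G S delta e s; have E2 := diff_sourceE G S delta e (s.1 + h, s.2).
  have -> : uncur (increment h (diff_source G S delta e)) s =
     uncur (diff_source G S delta e) (s.1 + h, s.2) - uncur (diff_source G S delta e) s by [].
  rewrite E1 E2.
  move: (gap (S e) s) (gap (S e) (s.1 + h, s.2)) (gap (delta e) s) (gap (delta e) (s.1 + h, s.2)) ls a0 aA {E1 E2 S1 R1 S2 R2 A1}.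
  move=> a a' d d' aK a0 aA.
  have nu0 := nu_gt0 G e.
  apply: (@damping_inequality _ _ _
    (nu G e * (slope (a' + d') (a + d) - slope a' a) * (a' - a)) _ _ _ _ a0 aA).
    have := slopeE (a' + d') (a + d); have := slopeE a' a.
    move: (slope (a' + d') (a + d)) (slope a' a) => s2 s1.
    move: (`|a'| * a') (`|a| * a) (`|a' + d'| * (a' + d')) (`|a + d| * (a + d)) => p1 p2 p3 p4 H1 H2.
    have -> : p3 = p4 + s2 * (a' + d' - (a + d)) by rewrite -H2; ring.
    have -> : p1 = p2 + s1 * (a' - a) by rewrite -H1; ring.
    ring.
  have := slope_lipschitz (a' + d') (a + d) a' a.
  have -> : a' + d' - a' = d' by ring.
  have -> : a + d - a = d by ring.
  move=> sl; move: (nu G e) nu0 {a0 aA} => n n0; rewrite !normrM (gtr0_norm n0) (ger0_norm K0) -!mulrA ler_pM2l// mulrC.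
  by apply: ler_pM => //; rewrite [leRHS]ger0_norm ?addr_ge0.
- have one0 : (1 : R) != 0 by rewrite oner_eq0.
  have nodes := sync_nodes sync.
  apply: (ae_imp2 _ nodes (ae_affine h one0 nodes)) => t N1 N2 tT v.
  move: tT; rewrite in_itv/= => /andP[t0 tTh].
  have t1 : t \in `]0, T[ by rewrite in_itv/=; apply/andP; split; slra.
  have t2 : 1 * t + h \in `]0, T[ by rewrite in_itv/=; apply/andP; split; slra.
  have N := node_relationB (N2 t2 v) (N1 t1 v).
  under eq_bigr do rewrite trace_out_increment.
  under [in X in _ = _ * X]eq_bigr do rewrite trace_in_increment.
  by rewrite mul1r in N; exact: (node_relation_sqr N).
Qed.

(** The square of the defect is at most [4 * (nu * K) ^+ 2] times the energy densities of [delta] at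
    the two times, and both energies are bounded by the decay from time [s] on. *)
Lemma defect_energy_increment T M h K C m y z u S Rs delta s t : 0 <= h -> 0 < T -> 0 <= K ->
  0 <= C -> 0 <= m ->
  synchronization G c mu T M y z u S Rs delta ->
  (forall t, 0 <= t -> t <= T -> net_energy G delta t <= C * expR (- m * t)) ->
  0 <= s -> s <= t -> t <= T - h ->
  defect_energy G (increment_defect K delta h) s t <=
    8 * (t - s) * ((\sum_e nu G e) * K) ^+ 2 * C * expR (- m * s).
Proof.
move=> h0 T0 K0 C0 m0 sync decay s0 st tT.
have tT' : t <= T by slra.
pose k := ((\sum_e nu G e) * K) ^+ 2.
have k0 : 0 <= k by exact: sqr_ge0.
pose Q e (z : R * R) := uncur (plus (delta e)) z ^+ 2 + uncur (minus (delta e)) z ^+ 2.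
have bQ e : ess_bounded leb2 (slab 0 T (len G e)) (Q e).
  by have [? ?] := sync_delta_bounded sync e; apply: ess_boundedD; exact: ess_boundedX.
have subs e (f : R * R -> R) T' : t <= T' -> ess_bounded leb2 (slab 0 T' (len G e)) f ->
    ess_bounded leb2 (slab s t (len G e)) f.
  move=> tT1 bf; apply: (@ess_boundedS _ _ _ leb2 _ _ _ (measurable_slab 0 T' (len G e)) _ bf).
  exact: slabS.
have bQ1 e := subs e _ _ tT' (bQ e).
have bQ2 e := subs e _ _ tT (ess_bounded_shift h0 (bQ e)).
have bd e := ess_bounded_norm (sync_delta_gap sync e).
have bF e : ess_bounded leb2 (slab s t (len G e)) (increment_defect K delta h e).
  apply: ess_boundedM; first exact: ess_bounded_cst.
  apply: ess_boundedD; [exact: (subs e _ _ tT (ess_bounded_shift h0 (bd e)))|exact: (subs e _ _ tT' (bd e))].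
have secE e r : r \in `[0, T] -> \int[leb]_(x in `[0, len G e]) Q e (r, x) = edge_energy (len G e) (delta e) r.
  move=> rT; have [b1 b2] := sync_sections c_gt0 T0 sync e rT.
  by rewrite /Q /edge_energy -RintegralD//; apply: ess_bounded_itv_integrable; exact: ess_boundedX.
have I e (f : R * R -> R) : ess_bounded leb2 (slab s t (len G e)) f -> leb2.-integrable (slab s t (len G e)) (EFin \o f).
  exact: ess_bounded_slab_integrable.
have step e : \int[leb2]_(z in slab s t (len G e)) (increment_defect K delta h e z ^+ 2) <=
    4 * k * (\int[leb2]_(z in slab s t (len G e)) Q e (z.1 + h, z.2) + \int[leb2]_(z in slab s t (len G e)) Q e z).
  have mS := measurable_slab s t (len G e).
  rewrite -RintegralD//; [|exact: I|exact: I].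
  rewrite -RintegralZl//; last by apply: I; exact: ess_boundedD.
  apply: le_Rintegral => //.
  - by apply: I; exact: ess_boundedX.
  - by apply: I; apply: ess_boundedM; [exact: ess_bounded_cst|exact: ess_boundedD].
  - move=> r _; rewrite /increment_defect exprMn.
    have nuK : (nu G e * K) ^+ 2 <= k.
      have n0 := ltW (nu_gt0 G e); have nK : nu G e * K <= (\sum_e nu G e) * K.
        by rewrite ler_wpM2r// nu_le_sum.
      apply: lerXn2r => //; rewrite nnegrE; first exact: mulr_ge0.
      by apply: le_trans nK; exact: mulr_ge0.
    have g2 q : `|gap (delta e) q| ^+ 2 <= 2 * Q e q.
      rewrite real_normK ?num_real// /gap /Q.
      have := sqr_ge0 (uncur (plus (delta e)) q + uncur (minus (delta e)) q); slra.
    have := g2 r; have := g2 (r.1 + h, r.2).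
    move: (`|gap _ _|) (`|gap _ _|) => a b ha hb.
    have ab : (a + b) ^+ 2 <= 4 * (Q e (r.1 + h, r.2) + Q e r).
      have := sqr_ge0 (a - b); slra.
    rewrite [leRHS](_ : _ = k * (4 * (Q e (r.1 + h, r.2) + Q e r))); last by ring.
    apply: ler_pM; [exact: sqr_ge0|exact: sqr_ge0|exact: nuK|by rewrite addrC].
apply: (@le_trans _ _ (\sum_e diam G e ^+ 2 * (4 * k *
   (\int[leb]_(r in `[s, t]) edge_energy (len G e) (delta e) (r + h) +
    \int[leb]_(r in `[s, t]) edge_energy (len G e) (delta e) r)))).
  apply: ler_sum => e _; rewrite ler_wpM2l ?sqr_ge0//; apply: (le_trans (step e)).
  rewrite (fubini_slab (len_gt0 G e) (bQ1 e)).2 (fubini_slab (len_gt0 G e) (bQ2 e)).2 le_eqVlt.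
  apply/orP; left; apply/eqP; congr (_ * (_ + _)); apply: eq_Rintegral => r; rewrite inE/= in_itv/= => /andP[h1 h2].
    by apply: secE; rewrite in_itv/=; apply/andP; split; slra.
  by apply: secE; rewrite in_itv/=; apply/andP; split; slra.
have bE e : ess_bounded leb `[s, t] (edge_energy (len G e) (delta e)).
  have [[mb [B' bK]] _] := fubini_slab (len_gt0 G e) (bQ1 e).
  have eE r : r \in `[s, t] -> \int[leb]_(x in `[0, len G e]) Q e (r, x) = edge_energy (len G e) (delta e) r.
    rewrite in_itv/= => /andP[h1 h2]; apply: secE; rewrite in_itv/=; apply/andP; split; slra.
  split; first by apply: eq_measurable_fun mb => r; rewrite inE => /eE.
  by exists B'; apply: (ae_imp _ bK) => r + rI => /(_ rI); rewrite eE.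
have bEh e : ess_bounded leb `[s, t] (fun r => edge_energy (len G e) (delta e) (r + h)).
  have [[mb [B' bK]] _] := fubini_slab (len_gt0 G e) (bQ2 e).
  have eE r : r \in `[s, t] -> \int[leb]_(x in `[0, len G e]) Q e (r + h, x) = edge_energy (len G e) (delta e) (r + h).
    rewrite in_itv/= => /andP[h1 h2]; apply: secE; rewrite in_itv/=; apply/andP; split; slra.
  split; first by apply: eq_measurable_fun mb => r; rewrite inE => /eE.
  by exists B'; apply: (ae_imp _ bK) => r + rI => /(_ rI); rewrite eE.
have sumE (f : R -> R) : (forall e, ess_bounded leb `[s, t] (fun r => edge_energy (len G e) (delta e) (f r))) ->
    \sum_e diam G e ^+ 2 * \int[leb]_(r in `[s, t]) edge_energy (len G e) (delta e) (f r) =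
    \int[leb]_(r in `[s, t]) net_energy G delta (f r).
  move=> bf; rewrite /net_energy Rintegral_sum//; last 2 first.
  - exact: lebesgue_itv_lty.
  - by move=> e _; apply: ess_boundedM => //; exact: ess_bounded_cst.
  by apply: eq_bigr => e _; rewrite RintegralZl//; exact: ess_bounded_itv_integrable.
have bound (f : R -> R) : (forall e, ess_bounded leb `[s, t] (fun r => edge_energy (len G e) (delta e) (f r))) ->
    (forall r, s <= r -> r <= t -> s <= f r /\ f r <= T) ->
    \int[leb]_(r in `[s, t]) net_energy G delta (f r) <= C * expR (- m * s) * (t - s).
  move=> bf fr; rewrite -(fine_lebesgue_itv st) -Rintegral_cst//.
  apply: le_Rintegral => //.
  - apply: ess_bounded_itv_integrable; apply: ess_bounded_sum => e _.
    by apply: ess_boundedM => //; exact: ess_bounded_cst.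
  - by apply: ess_bounded_itv_integrable; exact: ess_bounded_cst.
  - move=> r /=; rewrite in_itv/= => /andP[h1 h2]; have [f1 f2] := fr r h1 h2.
    apply: (le_trans (decay _ (le_trans s0 f1) f2)); rewrite ler_wpM2l// ler_expR.
    by rewrite !mulNr lerN2 ler_wpM2l.
have B1 : \int[leb]_(r in `[s, t]) net_energy G delta (r + h) <= C * expR (- m * s) * (t - s).
  by apply: (bound (fun r => r + h) bEh) => r h1 h2 /=; split; slra.
have B2 : \int[leb]_(r in `[s, t]) net_energy G delta r <= C * expR (- m * s) * (t - s).
  by apply: (bound id bE) => r h1 h2 /=; split=> //; slra.
under eq_bigr do rewrite mulrCA mulrDr.
rewrite -mulr_sumr big_split/= (sumE (fun r => r + h) bEh) (sumE id bE)/=.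
have k4 : 0 <= 4 * k by rewrite mulr_ge0.
apply: (le_trans (ler_wpM2l k4 (lerD B1 B2))).
rewrite -/k le_eqVlt; apply/orP; left; apply/eqP; ring.
Qed.

End TimeIncrements.

(** * Lipschitz bounds from weak derivatives *)

Section Ramp.
Context {R : realType}.
Local Notation leb := (@lebesgue_measure R).
Implicit Types a x k eps : R.

(** Reads off derivatives of piecewise quadratic functions without treating their knots
    separately. *)
Lemma quadratic_remainder_derive (F f : R -> R) (C : R) :
  (forall x k, `|F (x + k) - F x - f x * k| <= C * k ^+ 2) ->
  forall x, is_derive x (1 : R) F (f x).
Proof.
move=> H x.
have lim : (fun h => h^-1 *: ((F \o shift x) (h *: (1 : R)) - F x)) @ 0^' --> f x.
  apply/cvgrPdist_le => /= e e0.
  have C0 : 0 < `|C| + 1 by rewrite ltr_wpDl.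
  near=> h.
  have h0 : h != 0 by near: h; exact: nbhs_dnbhs_neq.
  have he : `|h| <= e / (`|C| + 1).
    near: h; apply: dnbhs0_le; exact: divr_gt0.
  have nh0 : 0 < `|h| by rewrite normr_gt0.
  rewrite /= [_ *: (1 : R)]mulr1 /GRing.scale/=.
  have -> : f x - h^-1 * (F (h + x) - F x) = - (h^-1 * (F (x + h) - F x - f x * h)).
    by rewrite [h + x]addrC; field.
  rewrite normrN normrM normfV ler_pdivrMl//.
  apply: (le_trans (H x h)).
  rewrite -[h ^+ 2]real_normK ?num_real// expr2 mulrA mulrC ler_pM2l//.
  apply: (@le_trans _ _ ((`|C| + 1) * `|h|)).
    by rewrite ler_wpM2r// (le_trans (ler_norm C))// lerDl.
  by rewrite mulrC -ler_pdivlMr.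
apply: DeriveDef; first by apply/cvg_ex; exists (f x).
exact/cvg_lim.
Unshelve. all: by end_near. Qed.

Lemma lipschitz_continuous_fun (f : R -> R) (C : R) :
  (forall x y, `|f x - f y| <= C * `|x - y|) -> continuous f.
Proof.
move=> H x; apply/cvgrPdist_le => /= e e0.
have C0 : 0 < `|C| + 1 by rewrite ltr_wpDl.
near=> y; apply: (le_trans (H x y)).
apply: (@le_trans _ _ ((`|C| + 1) * `|x - y|)).
  by rewrite ler_wpM2r// (le_trans (ler_norm C))// lerDl.
rewrite mulrC -ler_pdivlMr//; near: y.
by apply: (@cvgr_dist_le _ _ _ (nbhs x) _ id x); [exact: cvg_id|exact: divr_gt0].
Unshelve. all: by end_near. Qed.

Definition pos_part (x : R) := Num.max 0 x.

Lemma pos_part_lipschitz x y : `|pos_part x - pos_part y| <= `|x - y|.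
Proof.
rewrite /pos_part; case: (leP 0 x) => hx; case: (leP 0 y) => hy; rewrite ?subrr ?normr0//.
  by rewrite subr0 ger0_norm// ger0_norm; lra.
by rewrite sub0r normrN ger0_norm// ler0_norm; lra.
Qed.

Lemma pos_part_sqr_taylor x k :
  `|pos_part (x + k) ^+ 2 - pos_part x ^+ 2 - 2 * pos_part x * k| <= k ^+ 2.
Proof.
rewrite /pos_part; case: (leP 0 x) => hx; case: (leP 0 (x + k)) => hk;
  rewrite ler_norml; apply/andP; split; nra.
Qed.

(* [ramp eps a] is C^1, vanishes before a - eps and equals 1 after a + eps; its
   derivative [hat eps a] is the tent function of height 1 / eps. *)
Definition ramp eps a x : R :=
  (pos_part (x - a + eps) ^+ 2 - 2 * pos_part (x - a) ^+ 2 + pos_part (x - a - eps) ^+ 2)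
  / (2 * eps ^+ 2).

Definition hat eps a x : R :=
  (pos_part (x - a + eps) - 2 * pos_part (x - a) + pos_part (x - a - eps)) / eps ^+ 2.

Variable eps : R.
Hypothesis eps_gt0 : 0 < eps.

Lemma ramp_left a x : x <= a - eps -> ramp eps a x = 0.
Proof.
have := eps_gt0 => e0 xa; rewrite /ramp /pos_part !max_l; first by rewrite expr0n/= mulr0 subr0 addr0 mul0r.
all: lra.
Qed.

Lemma ramp_right a x : a + eps <= x -> ramp eps a x = 1.
Proof.
have := eps_gt0 => e0 xa; rewrite /ramp /pos_part !max_r; last 3 first.
all: try lra.
by field; rewrite gt_eqF.
Qed.

Lemma ramp_ge0 a x : 0 <= ramp eps a x.
Proof.
have := eps_gt0 => e0; rewrite /ramp divr_ge0//; last by rewrite mulr_ge0// sqr_ge0.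
rewrite /pos_part; move: (x - a) => u.
by case: (leP 0 (u + eps)) => h1; case: (leP 0 u) => h2; case: (leP 0 (u - eps)) => h3; nra.
Qed.

Lemma ramp_le1 a x : ramp eps a x <= 1.
Proof.
have := eps_gt0 => e0; rewrite /ramp ler_pdivrMr ?mul1r; last by rewrite mulr_gt0// exprn_gt0.
rewrite /pos_part; move: (x - a) => u.
by case: (leP 0 (u + eps)) => h1; case: (leP 0 u) => h2; case: (leP 0 (u - eps)) => h3; nra.
Qed.

Lemma hat_out a x : x \notin `[a - eps, a + eps] -> hat eps a x = 0.
Proof.
have := eps_gt0 => e0; rewrite in_itv/= negb_and -!ltNge => /orP[xa|xa]; rewrite /hat /pos_part.
  by rewrite !max_l ?mulr0 ?subr0 ?addr0 ?mul0r//; lra.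
by rewrite !max_r; [rewrite (_ : _ + _ = 0) ?mul0r//; ring|lra..].
Qed.

Lemma hat_ge0 a x : 0 <= hat eps a x.
Proof.
have := eps_gt0 => e0; rewrite /hat divr_ge0 ?sqr_ge0//.
rewrite /pos_part; move: (x - a) => u.
by case: (leP 0 (u + eps)) => h1; case: (leP 0 u) => h2; case: (leP 0 (u - eps)) => h3; lra.
Qed.

Lemma hat_le a x : hat eps a x <= eps^-1.
Proof.
have := eps_gt0 => e0; rewrite /hat ler_pdivrMr ?exprn_gt0// expr2 mulrA mulVf ?gt_eqF// mul1r.
rewrite /pos_part; move: (x - a) => u.
by case: (leP 0 (u + eps)) => h1; case: (leP 0 u) => h2; case: (leP 0 (u - eps)) => h3; lra.
Qed.

Lemma ramp_taylor a x k :
  `|ramp eps a (x + k) - ramp eps a x - hat eps a x * k| <= (2 / eps ^+ 2) * k ^+ 2.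
Proof.
have := eps_gt0 => e0; have e2 : 0 < 2 * eps ^+ 2 by rewrite mulr_gt0// exprn_gt0.
have T1 := pos_part_sqr_taylor (x - a + eps) k.
have T2 := pos_part_sqr_taylor (x - a) k.
have T3 := pos_part_sqr_taylor (x - a - eps) k.
rewrite /ramp /hat.
have -> : x + k - a + eps = x - a + eps + k by ring.
have -> : x + k - a - eps = x - a - eps + k by ring.
have -> : x + k - a = x - a + k by ring.
move: T1 T2 T3; set X := pos_part (x - a + eps + k); set Y := pos_part (x - a + k).
set Z := pos_part (x - a - eps + k); set X' := pos_part (x - a + eps).
set Y' := pos_part (x - a); set Z' := pos_part (x - a - eps) => T1 T2 T3.
have -> : (X ^+ 2 - 2 * Y ^+ 2 + Z ^+ 2) / (2 * eps ^+ 2) - (X' ^+ 2 - 2 * Y' ^+ 2 + Z' ^+ 2) / (2 * eps ^+ 2)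
   - (X' - 2 * Y' + Z') / eps ^+ 2 * k =
   ((X ^+ 2 - X' ^+ 2 - 2 * X' * k) - 2 * (Y ^+ 2 - Y' ^+ 2 - 2 * Y' * k) + (Z ^+ 2 - Z' ^+ 2 - 2 * Z' * k)) / (2 * eps ^+ 2).
  by field; rewrite gt_eqF.
rewrite normrM [`|_^-1|]ger0_norm; last by rewrite invr_ge0 ltW.
rewrite ler_pdivrMr//.
have -> : 2 / eps ^+ 2 * k ^+ 2 * (2 * eps ^+ 2) = 4 * k ^+ 2 by field; rewrite gt_eqF.
move: T1 T2 T3; rewrite !ler_norml => /andP[? ?] /andP[? ?] /andP[? ?].
apply/andP; split; lra.
Qed.

Lemma hat_continuous a : continuous (hat eps a).
Proof.
have := eps_gt0 => e0; have e2 : 0 < eps ^+ 2 by rewrite exprn_gt0.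
apply: (@lipschitz_continuous_fun _ (4 / eps ^+ 2)) => x y.
have L1 := pos_part_lipschitz (x - a + eps) (y - a + eps).
have L2 := pos_part_lipschitz (x - a) (y - a).
have L3 := pos_part_lipschitz (x - a - eps) (y - a - eps).
rewrite (_ : x - a + eps - (y - a + eps) = x - y) in L1; last by ring.
rewrite (_ : x - a - (y - a) = x - y) in L2; last by ring.
rewrite (_ : x - a - eps - (y - a - eps) = x - y) in L3; last by ring.
rewrite /hat -mulrBl normrM [`|_^-1|]ger0_norm; last by rewrite invr_ge0 ltW.
rewrite mulrAC ler_pM2r ?invr_gt0//.
move: L1 L2 L3; rewrite !ler_norml => /andP[? ?] /andP[? ?] /andP[? ?].
apply/andP; split; lra.
Qed.

Lemma ramp_is_derive a x : is_derive x (1 : R) (ramp eps a) (hat eps a x).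
Proof. exact: (quadratic_remainder_derive (ramp_taylor a)). Qed.

Lemma Rintegral_hat a : \int[leb]_(x in `[a - eps, a + eps]) hat eps a x = 1.
Proof.
have := eps_gt0 => e0.
have cr : continuous (ramp eps a).
  by move=> x; have [dr _] := ramp_is_derive a x; apply: differentiable_continuous; apply/derivable1_diffP.
rewrite /Rintegral (@continuous_FTC2 _ _ (ramp eps a)); [|lra| | |].
- by rewrite ramp_right ?lexx// ramp_left ?lexx//= subr0.
- by apply: continuous_subspaceT => x; exact: hat_continuous.
- split.
  + by move=> x _; have [] := ramp_is_derive a x.
  + by apply: cvg_at_right_filter; exact: cr.
  + by apply: cvg_at_left_filter; exact: cr.
- by move=> x _; rewrite derive1E; have [] := ramp_is_derive a x.
Qed.

End Ramp.

Section WeakLipschitz.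
Context {R : realType}.
Local Notation leb := (@lebesgue_measure R).

Lemma Lp_norm_infty_ae (A : set R) (g : R -> R) (B : R) :
  (Lp_norm +oo%E A g <= B%:E)%E -> \forall x \ae leb, A x -> `|g x| <= B.
Proof.
rewrite /Lp_norm unlock lebesgue_setT_gt0 => /ess_supP.
by apply: ae_imp => x /= + Ax; rewrite /patch mem_set.
Qed.

Lemma lebesgue_pt_average (f : R -> R) (a eta : R) : 0 < eta ->
  lebesgue_pt f a -> \forall eps \near 0^'+,
    (\int[leb]_(x in ball a eps) `|(f x - f a)%:E| < (eta * (2 * eps))%:E)%E.
Proof.
move=> eta0 /fine_cvgP[fin]; move/cvgrPdist_lt => /(_ _ eta0) H.
near=> eps; have e0 : 0 < eps by near: eps; exact: nbhs_right_gt.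
have dfin : davg f a eps \is a fin_num by near: eps.
have : `|0 - (fine \o davg f a) eps| < eta by near: eps.
rewrite sub0r normrN/= ger0_norm; last by rewrite fine_ge0// davg_ge0.
move=> lt1; have : (davg f a eps < eta%:E)%E by rewrite -(fineK dfin) lte_fin.
rewrite /davg /iavg lebesgue_measure_ball ?ltW//.
have p0 : 0 < eps *+ 2 by rewrite mulrn_wgt0.
by rewrite inver gt_eqF// muleC lte_pdivrMr// -EFinM -[in X in (_ < X)%E -> _]mulr_natl.
Unshelve. all: by end_near. Qed.

(** [hat] has integral 1 and height [1 / eps] on an interval of length [2 * eps], so it averages
    with at most twice the mean deviation. *)
Lemma hat_average (f : R -> R) (eps a eta : R) : 0 < eps ->
  ess_bounded leb `[a - eps, a + eps] f ->
  (\int[leb]_(x in ball a eps) `|(f x - f a)%:E| < (eta * (2 * eps))%:E)%E ->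
  `|\int[leb]_(x in `[a - eps, a + eps]) (f x * hat eps a x) - f a| <= 2 * eta.
Proof.
move=> e0 bf avg.
have bh : ess_bounded leb `[a - eps, a + eps] (hat eps a).
  split.
    by apply: measurable_funTS; apply: continuous_measurable_fun; exact: hat_continuous.
  by exists eps^-1; apply: nearW => x _; rewrite ger0_norm ?hat_ge0// hat_le.
have I h : ess_bounded leb `[a - eps, a + eps] h -> leb.-integrable `[a - eps, a + eps] (EFin \o h).
  by apply: ess_bounded_integrable => //; exact: lebesgue_itv_lty.
have bd : ess_bounded leb `[a - eps, a + eps] (fun x => f x - f a).
  by apply: ess_boundedB => //; exact: ess_bounded_cst.
have -> : \int[leb]_(x in `[a - eps, a + eps]) (f x * hat eps a x) - f a =
    \int[leb]_(x in `[a - eps, a + eps]) ((f x - f a) * hat eps a x).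
  rewrite -[X in _ - X = _]mulr1 -(Rintegral_hat e0 a) -RintegralZl//; last exact: I.
  rewrite -RintegralB//; [|by apply: I; exact: ess_boundedM|].
    by apply: eq_Rintegral => x _; ring.
  by apply: I; apply: ess_boundedM => //; exact: ess_bounded_cst.
apply: (le_trans (le_normr_Rintegral _ (I _ (ess_boundedM bd bh)))) => //.
apply: (@le_trans _ _ (\int[leb]_(x in `[a - eps, a + eps]) (eps^-1 * `|f x - f a|))).
  apply: le_Rintegral => //.
  - by apply: I; apply: ess_bounded_norm; exact: ess_boundedM.
  - by apply: I; apply: ess_boundedM; [exact: ess_bounded_cst|exact: ess_bounded_norm].
  - move=> x _; rewrite normrM mulrC ler_wpM2r//.
    by rewrite ger0_norm ?hat_ge0// hat_le.
rewrite RintegralZl//; last by apply: I; exact: ess_bounded_norm.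
rewrite ler_pdivrMl//.
have bdn := ess_bounded_norm bd.
rewrite -lee_fin /Rintegral fineK; last by apply: integrable_fin_num => //; exact: I.
have -> : (\int[leb]_(x in `[(a - eps)%R, (a + eps)%R]) (`|f x - f a|%R)%:E =
   \int[leb]_(x in ball a eps) `|(f x - f a)%:E|)%E.
  rewrite ball_itv -integral_itv_bndo_bndc; last first.
    apply: measurable_funS (measurable_int leb (I _ bdn)) => //.
    by move=> x /=; rewrite !in_itv/= => /andP[-> /ltW].
  rewrite -integral_itv_obnd_cbnd//; apply: measurable_funS (measurable_int leb (I _ bdn)) => //.
  by move=> x /=; rewrite !in_itv/= => /andP[/ltW -> /ltW].
apply: (le_trans (ltW avg)); rewrite lee_fin; slra.
Qed.

(** Test with the difference of the ramps at [s] and [s + h]. Its derivative averages [f] near these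
    points, which gives the values of [f] if both are Lebesgue points; its integral against [g] is
    at most [B * (h + 2 * eps)]. *)
Lemma weak_derivative_lipschitz (T B h : R) (f g : R -> R) : 0 < h -> 0 <= B ->
  W1p +oo%E T f g -> (Lp_norm +oo%E `]0%R, T[ g <= B%:E)%E ->
  \forall s \ae leb, s \in `[0, T - h] -> `|f (s + h) - f s| <= B * h.
Proof.
move=> h0 B0 [Lf Lg weak] gB.
have bf : ess_bounded leb `]0, T[ f.
  by apply: Lfun_ess_bounded => //; exact: lebesgue_setT_gt0.
have gae := Lp_norm_infty_ae gB.
have [mg _] : ess_bounded leb `]0, T[ g.
  by apply: Lfun_ess_bounded => //; exact: lebesgue_setT_gt0.
have Too : (leb `]0%R, T[ < +oo)%E.
  by rewrite lebesgue_measure_itv/=; case: ifPn => // _; rewrite -EFinB ltry.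
pose fT := f \_ `]0, T[.
have locf : locally_integrable [set: R] fT.
  by apply: integrable_locally_restrict => //; exact: ess_bounded_integrable.
have pts := lebesgue_differentiation locf.
have one0 : (1 : R) != 0 by rewrite oner_eq0.
have h1 : (\forall s \ae leb, lebesgue_pt fT (1 * s + h)).
  have mA := fun A mA => @affine_measure R 1 h A one0 mA.
  exact: (@scaled_ae _ _ _ _ _ leb leb (`|1|^-1) (affine 1 h) (@measurable_affine _ _ _ _) mA _ pts).
apply: (ae_imp2 _ (ae_imp2 (fun _ x y => conj x y) pts h1)
   (ae_imp2 (fun _ x y => conj x y) (ae_neq 0) (ae_neq (T - h)))).
move=> s [p1 p2] [s0 sT]; rewrite in_itv/= => /andP[s0' sT'].
have {}s0 : 0 < s by rewrite lt_neqAle eq_sym s0.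
have {}sT : s < T - h by rewrite lt_neqAle sT.
rewrite mul1r in p2.
apply/ler_addgt0Pr => eta eta0.
(* Two averaging errors [2 * eta'] and the excess [2 * B * eps] of the support add up to at most
   [eta]. *)
pose eta' := eta / (2 * B + 4).
have B4 : 0 < 2 * B + 4 by slra.
have eta'0 : 0 < eta' by rewrite divr_gt0.
suff : `|f (s + h) - f s| <= B * (h + 2 * eta') + 4 * eta'.
  have : eta' * (2 * B + 4) = eta by rewrite /eta' mulfVK// gt_eqF.
  slra.
near (0 : R)^'+ => eps.
have e0 : 0 < eps by near: eps; exact: nbhs_right_gt.
have e1 : eps < s by near: eps; exact: nbhs_right_lt.
have e2 : eps < T - h - s by near: eps; apply: nbhs_right_lt; slra.
have e3 : eps < eta' by near: eps; exact: nbhs_right_lt.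
have a1 : (\int[leb]_(x in ball s eps) `|(fT x - fT s)%R%:E| < (eta' * (2 * eps))%:E)%E.
  by near: eps; exact: lebesgue_pt_average.
have a2 : (\int[leb]_(x in ball (s + h)%R eps) `|(fT x - fT (s + h))%R%:E| < (eta' * (2 * eps))%:E)%E.
  by near: eps; exact: lebesgue_pt_average.
have fin a : 0 < a -> a < T -> fT a = f a.
  by move=> a0 aT; rewrite /fT /patch mem_set//= in_itv/= a0 aT.
have sub a : eps < a -> a < T - eps -> `[a - eps, a + eps]%classic `<=` `]0, T[.
  by move=> ea aT x /=; rewrite !in_itv/= => /andP[? ?]; apply/andP; split; slra.
have av a : eps < a -> a < T - eps ->
   (\int[leb]_(x in ball a eps) `|(fT x - fT a)%R%:E| < (eta' * (2 * eps))%:E)%E ->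
   `|\int[leb]_(x in `]0, T[) (f x * hat eps a x) - f a| <= 2 * eta'.
  move=> ea aT avg.
  have bfT : ess_bounded leb `[a - eps, a + eps] fT.
    split; first by apply: measurable_funTS; apply/(measurable_restrictT _ _).1 => //; exact: bf.1.
    have [_ [K HK]] := bf; exists K; apply: (ae_imp _ HK) => x Hx /(sub a ea aT) xT.
    by rewrite /fT /patch mem_set//; exact: Hx.
  have := hat_average e0 bfT avg; rewrite fin; [|slra|slra].
  congr (`|_ - _| <= _); rewrite Rintegral_mkcond [RHS]Rintegral_mkcond.
  apply: eq_Rintegral => x _; rewrite /fT /patch; case: ifPn => xe.
    have xT : x \in `]0, T[%classic by rewrite inE; apply: sub ea aT _ _; rewrite inE in xe.
    by rewrite xT.
  rewrite hat_out//; last by apply: contra xe; rewrite inE.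
  by rewrite mulr0; case: ifP.
have v1 := av s e1 _ a1; have v2 := av (s + h) _ _ a2.
have {}v1 : `|\int[leb]_(x in `]0, T[) (f x * hat eps s x) - f s| <= 2 * eta' by apply: v1; slra.
have {}v2 : `|\int[leb]_(x in `]0, T[) (f x * hat eps (s + h) x) - f (s + h)| <= 2 * eta' by apply: v2; slra.
pose phi x := ramp eps s x - ramp eps (s + h) x.
have dphi x : is_derive x (1 : R) phi (hat eps s x - hat eps (s + h) x).
  by apply: is_deriveB; exact: ramp_is_derive.
have dphiE : derive1 phi = fun x => hat eps s x - hat eps (s + h) x.
  by apply/funext => x; rewrite derive1E; have [] := dphi x.
have tst : test_function T phi.
  split.
  - by move=> x; have [] := dphi x.
  - rewrite dphiE => x; apply: continuousB; exact: hat_continuous.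
  - exists (s - eps), (s + h + eps); split; [slra|slra|].
    move=> x; rewrite in_itv/= negb_and -!ltNge /phi => /orP[xs|xs].
      by rewrite !ramp_left ?subrr//; slra.
    by rewrite !ramp_right ?subrr//; slra.
have := weak phi tst; rewrite dphiE.
have bh a : ess_bounded leb `]0, T[ (hat eps a).
  split.
    by apply: measurable_funTS; apply: continuous_measurable_fun; exact: hat_continuous.
  by exists eps^-1; apply: nearW => x _; rewrite ger0_norm ?hat_ge0// hat_le.
have I k : ess_bounded leb `]0, T[ k -> leb.-integrable `]0, T[ (EFin \o k).
  exact: ess_bounded_integrable.
under eq_Rintegral do rewrite mulrBr.
rewrite RintegralB//; [|by apply: I; exact: ess_boundedM|by apply: I; exact: ess_boundedM].
move=> wk.
have phi_le1 x : `|phi x| <= 1.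
  rewrite ler_norml /phi; have := ramp_ge0 e0 s x; have := ramp_ge0 e0 (s + h) x.
  have := ramp_le1 e0 s x; have := ramp_le1 e0 (s + h) x; move=> *; apply/andP; split; slra.
have sup_phi x : x \notin `[s - eps, s + h + eps] -> phi x = 0.
  rewrite in_itv/= negb_and -!ltNge /phi => /orP[xs|xs].
    by rewrite !ramp_left ?subrr//; slra.
  by rewrite !ramp_right ?subrr//; slra.
have rhs : `|\int[leb]_(x in `]0, T[) (g x * phi x)| <= B * (h + 2 * eps).
  have -> : \int[leb]_(x in `]0, T[) (g x * phi x) = \int[leb]_(x in `[s - eps, s + h + eps]) (g x * phi x).
    rewrite Rintegral_mkcond [RHS]Rintegral_mkcond; apply: eq_Rintegral => x _; rewrite /patch.
    case: (boolP (x \in `[s - eps, s + h + eps]%classic)) => xe.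
      have -> // : x \in `]0, T[%classic.
      move: xe; rewrite !inE/= !in_itv/= => /andP[? ?]; apply/andP; split; slra.
    have xe' : x \notin `[s - eps, s + h + eps] by apply: contra xe => xe'; rewrite inE.
    by rewrite (sup_phi x xe') mulr0; case: ifP.
  have subT : `[s - eps, s + h + eps]%classic `<=` `]0, T[.
    by move=> x /=; rewrite !in_itv/= => /andP[? ?]; apply/andP; split; slra.
  rewrite (_ : h + 2 * eps = s + h + eps - (s - eps)); last by ring.
  apply: Rintegral_itv_le; first by slra.
    apply: measurable_funM; first exact: measurable_funS mg.
    apply: measurable_funTS; apply: continuous_measurable_fun => x.
    by have [dr _] := dphi x; apply: differentiable_continuous; apply/derivable1_diffP.
  apply: (ae_imp _ gae) => x gx xe; rewrite normrM -[leRHS]mulr1.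
  by apply: ler_pM => //; exact: gx (subT _ xe).
move: wk rhs v1 v2; move: (Rintegral _ _ _) (Rintegral _ _ _) (Rintegral _ _ _) => I1 I2 I3 wk.
rewrite !ler_norml => /andP[? ?] /andP[? ?] /andP[? ?].
have : B * eps <= B * eta' by rewrite ler_wpM2l// ltW.
move=> ?; apply/andP; split; slra.
Unshelve. all: by end_near. Qed.

End WeakLipschitz.

(** * Time derivatives *)

Section SquareIntegrable.
Context {R : realType}.
Local Notation leb := (@lebesgue_measure R).

Definition square_integrable (L : R) (f : R -> R) : Prop :=
  measurable_fun `[0, L] f /\ leb.-integrable `[0, L] (EFin \o (fun x => f x ^+ 2)).

Lemma ess_bounded_square_integrable (L : R) (f : R -> R) :
  ess_bounded leb `[0, L] f -> square_integrable L f.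
Proof.
move=> bf; split; first exact: bf.1.
exact: (ess_bounded_itv_integrable (ess_boundedX 2 bf)).
Qed.

Lemma measurable_itv_closure (L : R) (f : R -> R) :
  measurable_fun `]0, L[ f -> measurable_fun `[0, L] f.
Proof.
move=> mf; have [L0|L0] := ltP (0 : R) L.
  by apply/measurable_fun_itv_obnd_cbndP; apply/measurable_fun_itv_bndo_bndcP.
have [->|L0'] := eqVneq L 0; first by rewrite set_itv1; exact: measurable_fun_set1.
rewrite set_itv_ge; first exact: measurable_fun_set0.
by rewrite bnd_simp -ltNge lt_neqAle L0' L0.
Qed.

Lemma ge0_integral_itv_closure (L : R) (f : R -> \bar R) : measurable_fun `]0, L[ f ->
  (\int[leb]_(x in `]0%R, L[) f x = \int[leb]_(x in `[0%R, L]) f x)%E.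
Proof.
move=> mf; rewrite integral_itv_bndo_bndc//; apply: integral_itv_obnd_cbnd.
have [L0|L0] := ltP (0 : R) L.
  by apply/emeasurable_fun_itv_bndo_bndcP.
have [->|L0'] := eqVneq L 0; rewrite set_itv_ge ?bnd_simp//.
- exact: measurable_fun_set0.
- exact: measurable_fun_set0.
- by rewrite -leNgt.
Qed.

Lemma Lp_on2_square_integrable (L : R) (f : R -> R) :
  Lp_on 2%:E `]0, L[ f -> square_integrable L f.
Proof.
move=> Lf; have mf : measurable_fun `]0, L[ f.
  move: (Lf); rewrite /Lp_on inE => /andP[]; rewrite !inE/= => + _.
  by move/(measurable_restrictT _ _).2; apply.
split; first exact: measurable_itv_closure.
have mf2 : measurable_fun `]0, L[ (EFin \o (fun x => f x ^+ 2)).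
  by apply/measurable_EFinP; exact: measurable_funX.
have : leb.-integrable `]0, L[ (EFin \o (fun x => f x ^+ 2)).
  apply/(integrable_mkcond _ _).2 => //.
  apply: eq_integrable (Lfun2_integrable_sqr Lf) => // x _.
  by rewrite /patch /=; case: ifP => // _; rewrite expr0n.
move/integrableP => [_ fin]; apply/integrableP; split.
  by apply/measurable_EFinP; apply: measurable_funX; exact: measurable_itv_closure.
by rewrite -ge0_integral_itv_closure//; exact: measurableT_comp.
Qed.

Lemma Lp_norm2_lt (L : R) (f : R -> R) (eps : R) : 0 < eps -> square_integrable L f ->
  (Lp_norm 2%:E `]0%R, L[ f < eps%:E)%E -> \int[leb]_(x in `[0, L]) (f x ^+ 2) <= eps ^+ 2.
Proof.
move=> e0 [mf intf] lt1.
have mfo : measurable_fun `]0, L[ f.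
  by apply: measurable_funS mf => // x /=; rewrite !in_itv/= => /andP[/ltW -> /ltW].
have n20 : (2 : R) != 0 by rewrite pnatr_eq0.
have := powR_Lnorm leb (EFin \o (f \_ `]0, L[)) n20.
rewrite -[Lnorm _ _ _]/(Lp_norm 2%:E `]0, L[ f) => Nf.
have N0 : (0 <= Lp_norm 2%:E `]0%R, L[ f)%E by exact: Lnorm_ge0.
have le2 : (Lp_norm 2%:E `]0%R, L[ f `^ 2 <= (eps ^+ 2)%:E)%E.
  rewrite -(powR_mulrn 2 (ltW e0)) -poweR_EFin.
  apply: gt0_ler_poweR; rewrite ?in_itv/= ?leey ?andbT //; first by rewrite lee_fin ltW.
  exact: ltW.
have eqI : (\int[leb]_(x in `[0%R, L]) ((f x ^+ 2)%:E) = Lp_norm 2%:E `]0%R, L[ f `^ 2)%E.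
  rewrite Nf -ge0_integral_itv_closure; last first.
    apply/measurable_EFinP; exact: measurable_funX.
  rewrite [LHS]integral_mkcond; apply: eq_integral => x _.
  rewrite /patch /=; case: ifP => xA /=.
    by rewrite powR_mulrn// real_normK// num_real.
  by rewrite normr0 powR0.
have fin := integrable_fin_num _ intf.
rewrite -lee_fin /Rintegral fineK; last exact: fin.
by rewrite eqI.
Qed.

Lemma square_integrable_comb (L : R) (a b : R) (f g : R -> R) :
  square_integrable L f -> square_integrable L g ->
  square_integrable L (fun x => a * f x + b * g x).
Proof.
move=> [mf If] [mg Ig].
have mfg : measurable_fun `[0, L] (fun x => a * f x + b * g x).
  by apply: measurable_funD; apply: measurable_funM => //; exact: measurable_cst.
split => //.
pose F x : \bar R := ((2 * a ^+ 2)%:E * (f x ^+ 2)%:E + (2 * b ^+ 2)%:E * (g x ^+ 2)%:E)%E.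
have IF : leb.-integrable `[0, L] F.
  by apply: integrableD => //; apply: integrableZl.
apply: (@le_integrable _ _ _ leb _ _ _ F) => //.
  by apply/measurable_EFinP; exact: measurable_funX.
move=> x _; rewrite /F /= lee_fin.
rewrite ger0_norm ?sqr_ge0// ger0_norm; last by rewrite addr_ge0// mulr_ge0 ?sqr_ge0// mulr_ge0 ?sqr_ge0.
have := sqr_ge0 (a * f x - b * g x); nra.
Qed.

Lemma square_integral_comb (L : R) (f g : R -> R) :
  square_integrable L f -> square_integrable L g ->
  \int[leb]_(x in `[0, L]) ((f x + g x) ^+ 2) <=
  2 * \int[leb]_(x in `[0, L]) (f x ^+ 2) + 2 * \int[leb]_(x in `[0, L]) (g x ^+ 2).
Proof.
move=> sf sg; have [mf If] := sf; have [mg Ig] := sg.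
have [_ Ifg] := square_integrable_comb 1 1 sf sg.
rewrite -!RintegralZl// -RintegralD//; last 2 first.
- by apply: (integrableZl _ 2 If).
- by apply: (integrableZl _ 2 Ig).
apply: ae_le_Rintegral => //.
- by apply: eq_integrable Ifg => // x _; rewrite /= !mul1r.
- by apply: (integrableD _ (integrableZl _ 2 If) (integrableZl _ 2 Ig)).
- apply: aeW => x _; have := sqr_ge0 (f x - g x); nra.
Qed.

End SquareIntegrable.

Section DifferenceQuotients.
Context {R : realType}.
Local Notation leb := (@lebesgue_measure R).

(** Both directions are needed: at the final time the quotient bounds the derivative, at time 0 the
    derivative bounds the quotient. *)
Lemma difference_quotient_energy (L k eps : R) (d v : R -> R) : k != 0 ->
  square_integrable L d -> square_integrable L v ->
  \int[leb]_(x in `[0, L]) ((d x / k - v x) ^+ 2) <= eps ^+ 2 ->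
  \int[leb]_(x in `[0, L]) (v x ^+ 2) <=
    2 * (k ^- 2 * \int[leb]_(x in `[0, L]) (d x ^+ 2)) + 2 * eps ^+ 2 /\
  k ^- 2 * \int[leb]_(x in `[0, L]) (d x ^+ 2) <=
    2 * \int[leb]_(x in `[0, L]) (v x ^+ 2) + 2 * eps ^+ 2.
Proof.
move=> k0 sd sv le.
have sq : square_integrable L (fun x => k^-1 * d x + 0 * d x) by exact: square_integrable_comb.
have sr : square_integrable L (fun x => k^-1 * d x + (-1) * v x) by exact: square_integrable_comb.
have snr : square_integrable L (fun x => (- k^-1) * d x + 1 * v x) by exact: square_integrable_comb.
have eqq : \int[leb]_(x in `[0, L]) ((k^-1 * d x + 0 * d x) ^+ 2) =
    k ^- 2 * \int[leb]_(x in `[0, L]) (d x ^+ 2).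
  rewrite -RintegralZl//; last exact: sd.2.
  by apply: eq_Rintegral => x _; rewrite mul0r addr0 exprMn exprVn.
have eqr : \int[leb]_(x in `[0, L]) ((k^-1 * d x + (-1) * v x) ^+ 2) =
    \int[leb]_(x in `[0, L]) ((d x / k - v x) ^+ 2).
  by apply: eq_Rintegral => x _; congr (_ ^+ 2); rewrite mulN1r mulrC.
have eqnr : \int[leb]_(x in `[0, L]) (((- k^-1) * d x + 1 * v x) ^+ 2) =
    \int[leb]_(x in `[0, L]) ((d x / k - v x) ^+ 2).
  by apply: eq_Rintegral => x _; rewrite -sqrrN; congr (_ ^+ 2); ring.
have := square_integral_comb sq snr; have := square_integral_comb sr sv.
rewrite eqq eqr eqnr.
have -> : \int[leb]_(x in `[0, L]) ((k^-1 * d x + (-1) * v x + v x) ^+ 2) =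
    k ^- 2 * \int[leb]_(x in `[0, L]) (d x ^+ 2).
  by rewrite -eqq; apply: eq_Rintegral => x _; congr (_ ^+ 2); ring.
have -> : \int[leb]_(x in `[0, L]) ((k^-1 * d x + 0 * d x + ((- k^-1) * d x + 1 * v x)) ^+ 2) =
    \int[leb]_(x in `[0, L]) (v x ^+ 2).
  by apply: eq_Rintegral => x _; congr (_ ^+ 2); ring.
move: (k ^- 2 * _) (\int[leb]_(x in _) (v x ^+ 2)) (\int[leb]_(x in _) ((d x / k - v x) ^+ 2)) le => a b e le.
by split; lra.
Qed.

Lemma L2_time_derivative_near (T L eps t0 : R) (w dw : R -> R -> R) : 0 < eps ->
  t0 \in `[0, T] -> L2_time_derivative T L w dw ->
  (forall t, t \in `[0, T] -> ess_bounded leb `[0, L] (w t)) ->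
  \forall t \near within `[0, T] t0^',
    \int[leb]_(x in `[0, L]) (((w t x - w t0 x) / (t - t0) - dw t0 x) ^+ 2) <= eps ^+ 2.
Proof.
move=> e0 t0T [Ldw cv] bw.
have N0 : nbhs 0%E [set x : \bar R | (x < eps%:E)%E].
  by apply: open_nbhs_nbhs; split; [exact: open_ereal_lt_ereal|rewrite /= lte_fin].
have H := cv _ t0T _ N0.
have D : \forall t \near within `[0, T] t0^', t \in `[0, T] by exact: withinT.
apply: filterS2 D H => t /= tT lt; apply: (Lp_norm2_lt e0) => //.
have sd := square_integrable_comb 1 (-1)
  (ess_bounded_square_integrable (bw t tT)) (ess_bounded_square_integrable (bw t0 t0T)).
have := square_integrable_comb (t - t0)^-1 (-1) sd (Lp_on2_square_integrable (Ldw _ t0T)).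
by congr square_integrable; apply/funext => x; ring.
Qed.

Lemma within_dnbhs_ball (D : set R) (t0 : R) (P : R -> Prop) :
  (\forall t \near within D t0^', P t) ->
  exists2 r, 0 < r & forall t, D t -> t != t0 -> `|t - t0| < r -> P t.
Proof.
rewrite /prop_near1 /within /= => /nbhs_ballP[r /= r0 H]; exists r => // t Dt tt lt.
by apply: H => //; rewrite -ball_normE /= distrC.
Qed.

Context {V E : finType} (G : network R V E).

Definition difference_energy (w : E -> pm (R -> R -> R)) (t0 t : R) : R :=
  \sum_e diam G e ^+ 2 *
    (\int[leb]_(x in `[0, len G e]) ((plus (w e) t x - plus (w e) t0 x) ^+ 2) +
     \int[leb]_(x in `[0, len G e]) ((minus (w e) t x - minus (w e) t0 x) ^+ 2)).

(** Allows the quotient at the final time to be taken backwards, from [t - h] to [t], which stays in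
    [[0, T]] when [t = T]. *)
Lemma difference_energyC w t0 t : difference_energy w t0 t = difference_energy w t t0.
Proof.
by apply: eq_bigr => e _; congr (_ * (_ + _)); apply: eq_Rintegral => x _; rewrite -sqrrN opprB.
Qed.

Lemma net_energy_increment h w t :
  net_energy G (pm_increment h w) t = difference_energy w t (t + h).
Proof. by []. Qed.

Lemma time_derivative_energy (T eps t0 : R) (w dw : E -> pm (R -> R -> R)) : 0 < eps ->
  t0 \in `[0, T] -> time_derivative G T w dw ->
  (forall e t, t \in `[0, T] -> ess_bounded leb `[0, len G e] (plus (w e) t) /\
                              ess_bounded leb `[0, len G e] (minus (w e) t)) ->
  exists2 r, 0 < r & forall t, t \in `[0, T] -> t != t0 -> `|t - t0| < r ->
    net_energy G dw t0 <= 2 * ((t - t0) ^- 2 * difference_energy w t0 t) +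
                          4 * (\sum_e diam G e ^+ 2) * eps ^+ 2 /\
    (t - t0) ^- 2 * difference_energy w t0 t <= 2 * net_energy G dw t0 +
                          4 * (\sum_e diam G e ^+ 2) * eps ^+ 2.
Proof.
move=> e0 t0T dt bw.
have : \forall t \near within `[0, T] t0^', forall e,
  \int[leb]_(x in `[0, len G e]) (((plus (w e) t x - plus (w e) t0 x) / (t - t0) - plus (dw e) t0 x) ^+ 2) <= eps ^+ 2 /\
  \int[leb]_(x in `[0, len G e]) (((minus (w e) t x - minus (w e) t0 x) / (t - t0) - minus (dw e) t0 x) ^+ 2) <= eps ^+ 2.
  apply: filter_forall => e; have [dp dm] := dt e.
  apply: filterS2 (L2_time_derivative_near e0 t0T dp (fun t tT => (bw e t tT).1))
    (L2_time_derivative_near e0 t0T dm (fun t tT => (bw e t tT).2)) => t; exact: conj.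
move/within_dnbhs_ball => [r r0 H]; exists r => // t tT tt0 lt.
have {}H := H t tT tt0 lt.
have k0 : t - t0 != 0 by rewrite subr_eq0.
have edge e : edge_energy (len G e) (dw e) t0 <=
    2 * ((t - t0) ^- 2 * (\int[leb]_(x in `[0, len G e]) ((plus (w e) t x - plus (w e) t0 x) ^+ 2) +
     \int[leb]_(x in `[0, len G e]) ((minus (w e) t x - minus (w e) t0 x) ^+ 2))) + 4 * eps ^+ 2 /\
    (t - t0) ^- 2 * (\int[leb]_(x in `[0, len G e]) ((plus (w e) t x - plus (w e) t0 x) ^+ 2) +
     \int[leb]_(x in `[0, len G e]) ((minus (w e) t x - minus (w e) t0 x) ^+ 2)) <=
    2 * edge_energy (len G e) (dw e) t0 + 4 * eps ^+ 2.
  have diff (p : R -> R -> R) : ess_bounded leb `[0, len G e] (p t) -> ess_bounded leb `[0, len G e] (p t0) ->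
      square_integrable (len G e) (fun x => p t x - p t0 x).
    by move=> b1 b2; apply: ess_bounded_square_integrable; exact: ess_boundedB.
  have [Hp Hm] := H e; have [bp bm] := bw e t tT; have [bp0 bm0] := bw e t0 t0T.
  have [[Lp _] [Lm _]] := dt e.
  have := difference_quotient_energy k0 (diff _ bp bp0) (Lp_on2_square_integrable (Lp _ t0T)) Hp.
  have := difference_quotient_energy k0 (diff _ bm bm0) (Lp_on2_square_integrable (Lm _ t0T)) Hm.
  rewrite /edge_energy.
  move: (_ ^- 2) (\int[leb]_(x in _) _) (\int[leb]_(x in _) _) (\int[leb]_(x in _) _) (\int[leb]_(x in _) _) => k a b a' b'.
  by move=> [h1 h2] [h3 h4]; split; lra.
rewrite /net_energy /difference_energy !mulr_sumr !mulr_suml -!big_split /=.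
split; apply: ler_sum => e _; have [h1 h2] := edge e; have D0 := sqr_ge0 (diam G e).
  have := ler_wpM2l D0 h1; move: (edge_energy _ _ _) (_ + \int[leb]_(x in _) _) => a b; lra.
have := ler_wpM2l D0 h2; move: (edge_energy _ _ _) (_ + \int[leb]_(x in _) _) => a b; lra.
Qed.

End DifferenceQuotients.

Lemma small_step (R : realFieldType) (r0 r1 t : R) : 0 < r0 -> 0 < r1 -> 0 < t ->
  exists h, [/\ 0 < h, h < r0, h < r1, h < t & h <= 1].
Proof.
move=> r00 r10 t0; pose m := Num.min (Num.min r0 r1) (Num.min t 1).
have m0 : 0 < m by rewrite !lt_min r00 r10 t0 ltr01.
have lt : m / 2 < m by rewrite ltr_pdivrMr// ltr_pMr// ltr1n.
exists (m / 2); split; first exact: divr_gt0; try apply: (lt_le_trans lt).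
- by rewrite /m !ge_min lexx.
- by rewrite /m !ge_min lexx !orbT.
- by rewrite /m !ge_min lexx !orbT.
- by apply: (le_trans (ltW lt)); rewrite /m !ge_min lexx !orbT.
Qed.

(** * Decay of the error and of its time derivative *)

Section Decay.
Context {R : realType} {V E : finType} (G : network R V E).
Local Notation leb := (@lebesgue_measure R).
Local Notation leb2 := (leb \x leb)%E.

Lemma sync_gap_lipschitz (c : R) (mu : V -> R) (T M h B : R) y z u S Rs delta e :
  0 < h -> 0 <= B -> synchronization G c mu T M y z u S Rs delta ->
  regular_synchronization G T B y S delta ->
  \forall z \ae leb2, slab 0 (T - h) (len G e) z ->
     `|gap (S e) (z.1 + h, z.2) - gap (S e) z| <= B * h.
Proof.
move=> h0 B0 sync reg.
apply: (@ae_slab_le _ _ _ _ _ (fun z => `|gap (S e) (z.1 + h, z.2) - gap (S e) z|)).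
  have bS := sync_S_gap sync e.
  have /ess_bounded_norm [] // : ess_bounded leb2 (slab 0 (T - h) (len G e))
      (fun z => gap (S e) (z.1 + h, z.2) - gap (S e) z).
  apply: ess_boundedB; first exact: (ess_bounded_shift (ltW h0) bS).
  apply: (@ess_boundedS _ _ _ leb2 _ _ _ (measurable_slab 0 T (len G e)) _ bS).
  by apply: slabS => //; lra.
apply: (ae_imp2 _ (reg_S_dt reg e) (ae_imp2 (fun _ a b => conj a b)
  (ae_neq (0 : R)) (ae_neq (len G e)))) => x Hx [x0 xL] xin.
have [|g [Wg gB]] := Hx.
  move: xin; rewrite !in_itv/= => /andP[xa xb].
  by rewrite !lt_neqAle xa xb xL eq_sym x0.
exact: (weak_derivative_lipschitz h0 B0 Wg gB).
Qed.

Lemma travel_time_bound (c : R) e : 0 < c -> len G e / c <= 1 + \sum_f len G f / c.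
Proof.
move=> c0; rewrite (bigD1 e)//= addrCA lerDl addr_ge0// sumr_ge0// => f _.
by rewrite divr_ge0 ?ltW ?len_gt0.
Qed.

Lemma travel_time_bound_gt0 (c : R) : 0 < c -> 0 < 1 + \sum_f len G f / c.
Proof.
move=> c0; rewrite ltr_wpDr// sumr_ge0// => f _.
by rewrite divr_ge0 ?ltW ?len_gt0.
Qed.

Variables (c M : R) (mu : V -> R).
Hypotheses (c_gt0 : 0 < c) (mu_le1 : forall v, `|mu v| <= 1).
Hypothesis damping_node : forall e, exists2 v, e \in E0 G v & `|mu v| < 1.

(** The sum dominates every travel time; the 1 keeps [tau] positive when there are no edges. *)
Let tau := 1 + \sum_f len G f / c.
Let tau0 : 0 < tau. Proof. exact: travel_time_bound_gt0. Qed.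
Let tauL e : len G e / c <= tau. Proof. exact: travel_time_bound. Qed.
Let A0 : 0 <= 2 * friction_bound G M. Proof. by rewrite mulr_ge0 ?friction_bound_ge0. Qed.

Lemma sync_energy_decay : exists C1 mu0 : R, [/\ 0 < C1, 0 < mu0 &
  forall T y z u S Rs delta, 0 < T -> synchronization G c mu T M y z u S Rs delta ->
  forall t, 0 <= t -> t <= T ->
    net_energy G delta t <= C1 * expR (- mu0 * t) * net_energy G delta 0].
Proof.
(* The defect is zero and so is [phi]; the decay rate 1 asked of it is arbitrary. *)
have [C1 [mu0 [C0 m0 H]]] := damped_system_decay c_gt0 mu_le1 damping_node A0 tau0 tauL ltr01.
exists C1, mu0; split => // T y z u S Rs delta T0 sync t t0 tT.
have := H T delta _ _ 0 T0 (sync_damped c_gt0 T0 sync) (lexx 0) _ t t0 tT.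
rewrite addr0; apply => s r s0 sr rT _.
rewrite mul0r /defect_energy big1// => e _.
under eq_Rintegral do rewrite expr0n /=.
by rewrite Rintegral_cst ?mul0r ?mulr0//; exact: measurable_slab.
Qed.

(** The defect of the increment over [h] has energy of order [h ^+ 2], so dividing the decay
    estimate by [h ^+ 2] leaves constants free of [h]; comparison with the derivative costs an error
    [eps] that is then sent to 0. *)
Lemma sync_derivative_decay C1 mu0 B : 0 < C1 -> 0 < mu0 -> 0 < B ->
  (forall T y z u S Rs delta, 0 < T -> synchronization G c mu T M y z u S Rs delta ->
   forall t, 0 <= t -> t <= T ->
     net_energy G delta t <= C1 * expR (- mu0 * t) * net_energy G delta 0) ->
  exists mu1 Ct : R, [/\ 0 < mu1, mu1 < mu0, 0 < Ct &
    forall T y z u S Rs delta dt_delta, 0 < T ->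
    synchronization G c mu T M y z u S Rs delta ->
    regular_synchronization G T B y S delta ->
    time_derivative G T delta dt_delta ->
    forall t, 0 <= t -> t <= T ->
      net_energy G dt_delta t <= Ct * expR (- mu1 * t) *
        (net_energy G dt_delta 0 + net_energy G delta 0)].
Proof.
move=> C10 m00 B0 decay.
have [C [m [C0 m0 H]]] := damped_system_decay c_gt0 mu_le1 damping_node A0 tau0 tauL m00.
pose N := \sum_e nu G e; pose DD := \sum_e diam G e ^+ 2.
(* The bound on the defect energy per [h ^+ 2] and per initial energy of [delta]: 8 times a window
   length of at most [2 * tau]. *)
pose k := 16 * tau * (N * B) ^+ 2 * C1.
have N2 : 0 <= (N * B) ^+ 2 by exact: sqr_ge0.
have k0 : 0 <= k by rewrite /k mulr_ge0 ?(ltW C10)// mulr_ge0// mulr_ge0 ?(ltW tau0).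
have DD0 : 0 <= DD by apply: sumr_ge0 => e _; exact: sqr_ge0.
(* The first 2 compares derivative and quotient at time [t], [expR m] pays for evaluating at [t - h]
   with [h <= 1], [2 + k] bounds the initial quotient and the defect, and the final 1 serves
   [t = 0]. *)
pose Ct := 2 * C * expR m * (2 + k) + 1.
have em0 : 0 < expR m by exact: expR_gt0.
have Ct1 : 1 <= Ct.
  by rewrite /Ct lerDr !mulr_ge0// ?addr_ge0// ltW.
(* Halving [mu0] makes the inequality between the two rates strict. *)
exists (Num.min m (mu0 / 2)), Ct; split.
- by rewrite lt_min m0 divr_gt0.
- by rewrite gt_min; apply/orP; right; move: m00; lra.
- exact: lt_le_trans Ct1.
move=> T y z u S Rs delta dtd T0 sync reg dt t t0 tT.
set d0 := net_energy G delta 0; set v0 := net_energy G dtd 0.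
have d00 : 0 <= d0 by exact: net_energy_ge0.
have v00 : 0 <= v0 by exact: net_energy_ge0.
have sec e s (sT : s \in `[0, T]) := sync_sections c_gt0 T0 sync e sT.
have [->|tn0] := eqVneq t 0.
  rewrite mulr0 expR0 mulr1 (@le_trans _ _ (1 * (v0 + d0)))//; first by rewrite mul1r lerDl.
  by rewrite ler_wpM2r// addr_ge0.
have tpos : 0 < t by rewrite lt_neqAle eq_sym tn0.
have zT : (0 : R) \in `[0, T] by rewrite in_itv/= lexx ltW.
have ttT : t \in `[0, T] by rewrite in_itv/= t0.
have key (eps : R) : 0 < eps ->
    net_energy G dtd t <= 2 * C * expR m * expR (- m * t) * (2 * v0 + k * d0 + 4 * DD * eps ^+ 2)
      + 4 * DD * eps ^+ 2.
  move=> e0.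
  have [r0 r00 H0] := time_derivative_energy e0 zT dt sec.
  have [r1 r10 H1] := time_derivative_energy e0 ttT dt sec.
  have [h [h0 hr0 hr1 ht h1]] := small_step r00 r10 tpos.
  have hT : h \in `[0, T] by rewrite in_itv/= (ltW h0) (le_trans (ltW ht)).
  have th0 : 0 <= t - h by rewrite subr_ge0 ltW.
  have thT : t - h \in `[0, T] by rewrite in_itv/= th0 lerBlDr (le_trans tT)// lerDl ltW.
  have hT' : h < T by exact: lt_le_trans tT.
  have BhT : 0 <= B * h by rewrite mulr_ge0// ltW.
  have th : t - h != t by rewrite lt_eqF// gtrBl.
  have tht : t - h - t = - h by rewrite addrAC subrr add0r.
  have [|_ {H0}] := H0 h hT (lt0r_neq0 h0); first by rewrite subr0 gtr0_norm.
  have [|{H1} + _] := H1 (t - h) thT th; first by rewrite tht normrN gtr0_norm.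
  rewrite tht sqrrN subr0.
  have -> : difference_energy G delta t (t - h) = net_energy G (pm_increment h delta) (t - h).
    by rewrite net_energy_increment subrK difference_energyC.
  have -> : difference_energy G delta 0 h = net_energy G (pm_increment h delta) 0.
    by rewrite net_energy_increment add0r.
  rewrite -/DD -/v0.
  have Th0 : 0 < T - h by rewrite subr_gt0.
  (* The factor [h ^+ 2] comes from the Lipschitz bound [B * h] on the increment of the gap of
     [S]. *)
  pose phi := h ^+ 2 * k * d0.
  have h2 : 0 <= h ^+ 2 by exact: sqr_ge0.
  have phi0 : 0 <= phi by rewrite /phi mulr_ge0// mulr_ge0.
  have sys := increment_damped c_gt0 h0 hT' BhT sync (fun e => sync_gap_lipschitz e h0 (ltW B0) sync reg).
  have src s r : 0 <= s -> s <= r -> r <= T - h -> r - s <= 2 * tau ->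
      defect_energy G (increment_defect G (B * h) delta h) s r <= phi * expR (- mu0 * s).
    move=> s0 sr rT rs.
    have Cd0 : 0 <= C1 * d0 by rewrite mulr_ge0// ltW.
    have dec r' : 0 <= r' -> r' <= T -> net_energy G delta r' <= C1 * d0 * expR (- mu0 * r').
      by move=> a b; rewrite mulrAC; exact: (decay _ _ _ _ _ _ _ T0 sync).
    apply: le_trans (defect_energy_increment c_gt0 (ltW h0) T0 BhT Cd0 (ltW m00) sync dec s0 sr rT) _.
    rewrite -/N /phi /k ler_wpM2r ?expR_ge0//.
    have -> : 8 * (r - s) * (N * (B * h)) ^+ 2 * (C1 * d0) =
      (r - s) * (8 * ((N * (B * h)) ^+ 2 * (C1 * d0))) by ring.
    have -> : h ^+ 2 * (16 * tau * (N * B) ^+ 2 * C1) * d0 =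
      2 * tau * (8 * ((N * (B * h)) ^+ 2 * (C1 * d0))) by ring.
    have NBh : 0 <= (N * (B * h)) ^+ 2 by exact: sqr_ge0.
    by rewrite ler_wpM2r// mulr_ge0// mulr_ge0.
  have thT' : t - h <= T - h by rewrite lerD2r.
  have := H _ _ _ _ _ Th0 sys phi0 src _ th0 thT'.
  have : expR (- m * (t - h)) <= expR m * expR (- m * t).
    by rewrite -expRD ler_expR mulrBr !mulNr opprK addrC lerD2r ger_pMr.
  move: (net_energy_ge0 G (pm_increment h delta) 0).
  move: (net_energy G (pm_increment h delta) _) (net_energy G (pm_increment h delta) _) => Eh E0h.
  rewrite /phi => E0p le1 le2 le3 le4.
  have h20 : 0 < h ^- 2 by rewrite invr_gt0 exprn_gt0.
  have h2h : h ^- 2 * h ^+ 2 = 1 by rewrite mulVf// expf_neq0// gt_eqF.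
  set q := h ^- 2 * E0h in le4.
  have le5 : h ^- 2 * Eh <= C * (expR m * expR (- m * t)) * (q + k * d0).
    have -> : q + k * d0 = h ^- 2 * (E0h + h ^+ 2 * k * d0).
      by rewrite /q mulrDr; congr (_ + _); rewrite -[h ^+ 2 * k * d0]mulrA [RHS]mulrA h2h mul1r.
    rewrite [leRHS]mulrCA ler_wpM2l ?(ltW h20)//.
    apply: (le_trans le2); rewrite ler_wpM2r ?addr_ge0//.
    by rewrite ler_wpM2l// ltW.
  apply: (le_trans le3); rewrite lerD2r.
  have -> : 2 * C * expR m * expR (- m * t) * (2 * v0 + k * d0 + 4 * DD * eps ^+ 2) =
    2 * (C * (expR m * expR (- m * t)) * (2 * v0 + k * d0 + 4 * DD * eps ^+ 2)) by ring.
  rewrite ler_pM2l//; apply: (le_trans le5); rewrite ler_wpM2l//.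
    by rewrite !mulr_ge0 ?expR_ge0// ltW.
  lra.
have lim : net_energy G dtd t <= 2 * C * expR m * expR (- m * t) * (2 * v0 + k * d0).
  apply/ler_addgt0Pr => eta eta0.
  pose X := 2 * C * expR m * expR (- m * t).
  have X0 : 0 <= X by rewrite !mulr_ge0 ?expR_ge0// ltW.
  (* The error terms sum to [(X + 1) * (4 * DD) * eps ^+ 2 <= eta]; the last 1 keeps the denominator
     positive when [DD = 0]. *)
  pose eps := Num.sqrt (eta / ((X + 1) * (4 * DD + 1))).
  have den : 0 < (X + 1) * (4 * DD + 1) by rewrite mulr_gt0// ltr_wpDl// mulr_ge0.
  have e0 : 0 < eps by rewrite sqrtr_gt0 divr_gt0.
  apply: le_trans (key eps e0) _.
  rewrite -/X mulrDr -addrA lerD2l.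
  have -> : eps ^+ 2 = eta / ((X + 1) * (4 * DD + 1)) by rewrite sqr_sqrtr// divr_ge0// ltW.
  have -> : X * (4 * DD * (eta / ((X + 1) * (4 * DD + 1)))) + 4 * DD * (eta / ((X + 1) * (4 * DD + 1)))
    = eta * ((X + 1) * (4 * DD) / ((X + 1) * (4 * DD + 1))) by ring.
  rewrite -[leRHS]mulr1 ler_wpM2l ?(ltW eta0)// ler_pdivrMr// mul1r ler_wpM2l ?addr_ge0//.
  by rewrite lerDl.
apply: (le_trans lim).
have le_exp : expR (- m * t) <= expR (- Num.min m (mu0 / 2) * t).
  rewrite ler_expR !mulNr lerN2 ler_wpM2r// ge_min lexx//.
apply: (@le_trans _ _ (2 * C * expR m * (2 + k) * expR (- Num.min m (mu0 / 2) * t) * (v0 + d0))); last first.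
  rewrite ler_wpM2r ?addr_ge0// ler_wpM2r ?expR_ge0//.
  by rewrite /Ct lerDl.
have -> : 2 * C * expR m * (2 + k) * expR (- Num.min m (mu0 / 2) * t) * (v0 + d0) =
  2 * C * expR m * expR (- Num.min m (mu0 / 2) * t) * ((2 + k) * (v0 + d0)) by ring.
apply: ler_pM.
- by rewrite !mulr_ge0 ?expR_ge0// ltW.
- by rewrite addr_ge0// mulr_ge0.
- by rewrite ler_wpM2l// !mulr_ge0 ?expR_ge0// ltW.
have := mulr_ge0 k0 v00; lra.
Qed.

End Decay.

Theorem theorem4 (R : realType) (V E : finType) (G : network R V E)
    (c : R) (mu : V -> R) (Vt : {set V}) (M : R) :
  0 < c ->
  (forall v, `|mu v| <= 1) ->
  (forall e, exists v, [/\ v \in Vt, e \in E0 G v & `|mu v| < 1]) ->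
  exists C1 mu0 : R, [/\ 0 < C1, 0 < mu0,
    forall T : R, 2 * T0 G c < T ->
    forall (y z : E -> pm (R -> R)) (u : E -> R -> R)
           (S Rs delta : E -> pm (R -> R -> R)),
    synchronization G c mu T M y z u S Rs delta ->
    forall t : R, t \in `[0, T] ->
      (energy G delta t <= (C1 * expR (- mu0 * t))%:E * energy G delta 0)%E
  & forall B : R, 0 < B ->
    H1_smallness G c mu M B ->
    exists mu1 Ct : R, [/\ 0 < mu1, mu1 < mu0, 0 < Ct &
      forall T : R, 2 * T0 G c < T ->
      forall (y z : E -> pm (R -> R)) (u : E -> R -> R)
             (S Rs delta dt_delta : E -> pm (R -> R -> R)),
      synchronization G c mu T M y z u S Rs delta ->
      regular_synchronization G T B y S delta ->
      time_derivative G T delta dt_delta ->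
      forall t : R, t \in `[0, T] ->
        (energy G dt_delta t <= (Ct * expR (- mu1 * t))%:E *
           (energy G dt_delta 0 + energy G delta 0))%E]].
Proof.
move=> c0 mu1 damp.
have damping_node e : exists2 v, e \in E0 G v & `|mu v| < 1.
  by have [v [_ ev lt]] := damp e; exists v.
have pos T : 2 * T0 G c < T -> 0 < T.
  by apply: le_lt_trans; rewrite mulr_ge0 ?T0_ge0.
(* Finiteness of the energies turns the inequalities in the extended reals into real ones. *)
have finE T y z u S Rs delta t : 0 < T -> synchronization G c mu T M y z u S Rs delta ->
    t \in `[0, T] -> energy G delta t = (net_energy G delta t)%:E.
  move=> T_gt0 sync tT; apply: energyE => e.
  have [bp bm] := sync_sections c0 T_gt0 sync e tT.
  by split; [exact: (ess_bounded_square_integrable bp).2|exact: (ess_bounded_square_integrable bm).2].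
have zero T : 0 < T -> (0 : R) \in `[0, T] by move=> T_gt0; rewrite in_itv/= lexx ltW.
have [C1 [mu0 [C10 mu00 decay]]] := sync_energy_decay M c0 mu1 damping_node.
exists C1, mu0; split => //.
  move=> T /pos T_gt0 y z u S Rs delta sync t tT.
  rewrite !(finE _ _ _ _ _ _ _ _ T_gt0 sync)// ?zero// -EFinM lee_fin.
  by move: (tT); rewrite in_itv/= => /andP[t0 tT']; exact: (decay _ _ _ _ _ _ _ T_gt0 sync).
move=> B B0 _.
have [m1 [Ct [m10 m1mu0 Ct0 decay']]] := sync_derivative_decay c0 mu1 damping_node C10 mu00 B0 decay.
exists m1, Ct; split => // T /pos T_gt0 y z u S Rs delta dtd sync reg dt t tT.
have finD s : s \in `[0, T] -> energy G dtd s = (net_energy G dtd s)%:E.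
  move=> sT; apply: energyE => e; have [[Lp _] [Lm _]] := dt e.
  by split; [exact: (Lp_on2_square_integrable (Lp s sT)).2|exact: (Lp_on2_square_integrable (Lm s sT)).2].
rewrite !finD ?zero// (finE _ _ _ _ _ _ _ _ T_gt0 sync) ?zero// -EFinD -EFinM lee_fin.
by move: (tT); rewrite in_itv/= => /andP[t0 tT']; exact: (decay' _ _ _ _ _ _ _ _ T_gt0 sync).
Qed.
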